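(* Let $\lambda_n\to\lambda$ with $\lambda\in(0,\infty)$, let $d>-1$ be fixed and $d^*=\max(1,d)$. Suppose that the sequence of alternatives belongs to the intermediate family $\mathfrak{I}_{alt}$ and that one of the following holds: (i) $-1<d\le 0$ (with no further restriction on the sequence in $\mathfrak{I}_{alt}$); (ii) $d\ge 1$ is an integer and $\varepsilon(N)\ll n^{-d/(1+2d)}$; (iii) $d>0$ is not an integer and $\varepsilon(N)\ll \min\left(n^{-3/8},\,n^{-d^*/(1+2d^* )}\right)$. Then, as $n\to\infty$, $$\frac{e_N^{\alpha}(S_N^{h_d})}{n\lambda_n\,\varepsilon^2(N)}=\frac14\,\rho^2(h_d,\lambda_n)\,(1+o(1)).$$
   Context: All asymptotics are as $n\to\infty$; $a_n\ll b_n$ means $a_n=o(b_n)$. $N=N(n)\to\infty$, $\lambda_n=n/N$ converges to a limit in $[0,\infty]$, and $n^2/N=n\lambda_n\to\infty$. The random vector $(\eta_1,\dots,\eta_N)$ has the multinomial distribution with $n$ trials and cell probabilities $(p_1,\dots,p_N)$, $p_m>0$, $\sum_m p_m=1$. The hypothesis is $H_0: p_m=1/N$ for all $m$; $P_0$ denotes probability under $H_0$. Alternatives $H_{1n}$ are sequences $p_m=N^{-1}(1+\varepsilon_{m,n})\ (m=1,\dots,N)$, not identically uniform, with $\sum_m\varepsilon_{m,n}=0$, $\max_{m}|\varepsilon_{m,n}|\to0$; put $\varepsilon(N)=\frac1N\sum_{m=1}^N(Np_m-1)^2$, so $\varepsilon(N)\to0$. The intermediate family $\mathfrak{I}_{alt}$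 consists of all such sequences of alternatives with $\sqrt{n\lambda_n}\,\varepsilon(N)\to\infty$ and $\varepsilon(N)=o(\lambda_n^{-1})$. For a function $h$ on $\{0,1,2,\dots\}$ (possibly depending on $\lambda_n$) let $S_N^h=\sum_{m=1}^N h(\eta_m)$ (large values reject $H_0$), let $A_1(h)=N^{-1}\sum_{m=1}^N E\,h(\xi_m)$ where $\xi_m$ is Poisson with parameter $np_m$, the $p_m$ being the cell probabilities under $H_{1n}$, and define $$e_N^{\alpha}(S_N^h)=-\log P_0\{S_N^h>N A_1(h)\}.$$ Power divergence functions: for $d>-1$, $d\ne0$, $h_d(x)=\frac{2}{d(d+1)}\,x\left[(x/\lambda_n)^d-1\right]$, and $h_0(x)=2x\log(x/\lambda_n)$, with $h_d(0)=0$. With $\xi$ Poisson with parameter $\lambda_n$ and $\tau_n=\lambda_n^{-1}\operatorname{cov}(h(\xi),\xi)$, put $\rho(h,\lambda_n)=\operatorname{corr}\left(h(\xi)-\tau_n\xi,\ \xi^2-(2\lambda_n+1)\xi\right)$. *)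

(* Defs.v *)
From HB Require Import structures.
From mathcomp Require Import all_boot all_order all_algebra.
From mathcomp Require Import all_classical all_reals all_analysis.

Set Implicit Arguments.
Unset Strict Implicit.
Unset Printing Implicit Defensive.

Import Order.TTheory GRing.Theory Num.Theory.
Import numFieldNormedType.Exports.

Local Open Scope classical_set_scope.
Local Open Scope ring_scope.

(* Cell counts of n trials are at most n, so a vector of counts
   (eta_1, ..., eta_N) is a finite function into 'I_n.+1. *)
Notation counts N n := {ffun 'I_N -> 'I_n.+1}.

Definition multinomial_pmf {R : realType} (N n : nat) (p : 'I_N -> R)
    (k : counts N n) : R :=
  if (\sum_(m < N) k m == n)%N
  then n`!%:R / \prod_(m < N) (k m)`!%:R * \prod_(m < N) p m ^+ k m
  else 0.

Definition multinomial_prob {R : realType} (N n : nat) (p : 'I_N -> R)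
    (A : pred (counts N n)) : R :=
  \sum_(k | A k) multinomial_pmf p k.

Definition uniform_cells {R : realType} (N : nat) : 'I_N -> R :=
  fun=> N%:R^-1.

(* The second argument of the library's poisson_prob is a dummy, on which the
   measure does not depend; it is instantiated with 0. *)
Definition poisson {R : realType} (r : R) : probability nat R :=
  poisson_prob r 0%N.

Definition corr {d} {T : measurableType d} {R : realType}
    (P : probability T R) (X Y : T -> R) : R :=
  fine (covariance P X Y) /
    (Num.sqrt (fine (variance P X)) * Num.sqrt (fine (variance P Y))).

(* The arguments h : nat -> R below stand for h at the current value of
   lambda_n. *)

Definition rho {R : realType} (h : nat -> R) (lam : R) : R :=
  let xi := fun x : nat => x%:R : R in
  let tau := lam^-1 * fine (covariance (poisson lam) h xi) in
  corr (poisson lam)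
    (fun x => h x - tau * xi x)
    (fun x => xi x ^+ 2 - (2 * lam + 1) * xi x).

Definition sym_stat {R : realType} (N n : nat) (h : nat -> R)
    (k : counts N n) : R :=
  \sum_(m < N) h (k m).

Definition A1 {R : realType} (N n : nat) (p : 'I_N -> R) (h : nat -> R) : R :=
  N%:R^-1 * \sum_(m < N) fine ('E_(poisson (n%:R * p m))[h])%E.

(* Extended-real valued: it is +oo when the probability is 0. *)
Definition alpha_slope {R : realType} (N n : nat) (p : 'I_N -> R)
    (h : nat -> R) : \bar R :=
  (- lne (multinomial_prob (@uniform_cells R N)
            [pred k : counts N n | N%:R * A1 n p h < sym_stat h k])%:E)%E.

(* h_d(0) = 0 comes from the factor x%:R. *)
Definition power_div {R : realType} (d lam : R) (x : nat) : R :=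
  if d == 0 then 2 * x%:R * ln (x%:R / lam)
  else 2 / (d * (d + 1)) * x%:R * ((x%:R / lam) `^ d - 1).

Definition lambda {R : realType} (N : nat -> nat) (n : nat) : R :=
  n%:R / (N n)%:R.

Definition eps_cell {R : realType} (N : nat) (p : 'I_N -> R) (m : 'I_N) : R :=
  N%:R * p m - 1.

Definition eps {R : realType} (N : nat) (p : 'I_N -> R) : R :=
  N%:R^-1 * \sum_(m < N) (N%:R * p m - 1) ^+ 2.

(* Only n >= 1 is a number of trials; nothing is required at n = 0. *)
Definition alternatives {R : realType} (N : nat -> nat)
    (p : forall n, 'I_(N n) -> R) : Prop :=
  [/\ forall n m, (0 < n)%N -> 0 < p n m,
      forall n, (0 < n)%N -> \sum_(m < N n) p n m = 1,
      forall n, (0 < n)%N -> exists m, p n m != uniform_cells m &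
      (\big[Num.max/0]_(m < N n) `|eps_cell (p n) m|) @[n --> \oo] --> (0 : R)].

Definition intermediate_alternatives {R : realType} (N : nat -> nat)
    (p : forall n, 'I_(N n) -> R) : Prop :=
  [/\ alternatives p,
      Num.sqrt (n%:R * lambda N n) * eps (p n) @[n --> \oo] --> +oo &
      (fun n => eps (p n) : R) =o_\oo (fun n => (lambda N n)^-1 : R)].

(* Main.v *)
Require Import Defs.
From HB Require Import structures.
From mathcomp Require Import all_boot all_order all_algebra.
From mathcomp Require Import all_classical all_reals all_analysis.
From mathcomp Require Import ring lra zify.
Import Order.TTheory GRing.Theory Num.Theory.
Import numFieldNormedType.Exports.
Local Open Scope classical_set_scope.
Local Open Scope ring_scope.

(** Let r = n / N, let h be the power divergence function at r and xi a
    Poisson variable with mean r. An alternative raises the normalized mean of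
    the statistic from E h(xi) to E h(xi) + u. The cells contribute Poisson
    averages at the rates r (1 + e_m), and as the e_m sum to 0 the linear terms
    of their Taylor expansions cancel; what is left is u = eps p / 2 * kappa up
    to a factor close to 1, where kappa = E[h(xi) ((xi - r)^2 - xi)] is r^2
    times the average second difference of h, which is bounded away from 0
    because h is convex ([A1_expansion], [curv_ge]). If sigma^2 is the variance
    of the residual of h(xi) after linear regression on xi, then
    rho^2 = kappa^2 / (2 r^2 sigma^2) ([rho_sq]). So the theorem says that the
    probability under the hypothesis of exceeding N (E h(xi) + u) is
    exp (- (1 + o(1)) N u^2 / (2 sigma^2)), a moderate deviation estimate with
    Gaussian exponent, in the range where u tends to 0 and N u^2 to infinity
    ([truncated_deviation], [slope_ratio]).

    Multinomial counts are independent Poisson counts conditioned on their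
    total. Instead of a local limit theorem, the proof uses monotonicity: if h
    is nondecreasing, then adding a ball preserves the event that the
    statistic exceeds a level, so its probability increases with the number of
    balls ([urn_mean_le]). Restricting the Poisson model to totals between n
    and n + sqrt n, which have probability at least e^-2, gives an upper bound;
    restricting it to totals at most n gives a lower bound. In the Poisson
    model the cells are independent: Chernoff's inequality and an exponential
    change of measure yield the exponent ([core_upper], [core_lower]). That h
    decreases near 0 is harmless. Its decrements are bounded, and adding a
    multiple of the count to h changes the statistic by a constant, as the
    total is n, and leaves the residual of the regression unchanged.

    For d > 0 the variable h(xi) has no exponential moments, because x^(1+d)
    grows faster than x ln x. The function h(k) is then replaced by
    min (h k, k / u), which agrees with it up to a level of order u^(-1/d).
    That some of the N cells exceeds the level has probability of order
    N exp (- level), which is negligible if the level dominates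
    N u^2 + ln N. This is the meaning of the condition
    eps << n^(-d/(1+2d)) ([cutoff_level_large]). For d <= 0 the function grows
    at most like x ln x, and its small multiples have exponential moments
    ([power_div_dom_le0]). *)

Set Implicit Arguments.
Unset Strict Implicit.
Unset Printing Implicit Defensive.

(** * Poisson averages of functions of exponential growth *)


Definition pois {R : realType} (r : R) (k : nat) : R :=
  r ^+ k * k`!%:R^-1 * expR (- r).

(** Averages are handled as a relation between g and its average v, closed
    under linear combinations and shifts, so that moments are computed without
    convergence side conditions. The record keeps unification from unfolding
    the limit. *)
Record ispm {R : realType} (r : R) (g : nat -> R) (v : R) : Prop := IsPmean {
  ispm_cvg : series (fun k => pois r k * g k) @ \oo --> v }.

Definition pmean {R : realType} (r : R) (g : nat -> R) : R :=
  limn (series (fun k => pois r k * g k)).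

(** The shape D ^+ k.+1 needs one constant, and sums and products of functions
    add and multiply their constants. It makes Poisson averages exist, with
    bounds that are uniform over bounded rates. *)
Definition tame {R : realType} (D : R) (g : nat -> R) : Prop :=
  1 <= D /\ forall k, `|g k| <= D ^+ k.+1.

Section Tame.
Context {R : realType}.
Implicit Types (D E c : R) (g h : nat -> R).

Lemma tame_ge1 D g : tame D g -> 1 <= D. Proof. by case. Qed.

Lemma tame_le D E g : D <= E -> tame D g -> tame E g.
Proof.
move=> DE [D1 Dg]; split; first exact: le_trans DE.
by move=> k; apply: le_trans (Dg k) _; rewrite lerXn2r ?nnegrE//; lra.
Qed.

Lemma eq_tame D g h : g =1 h -> tame D g -> tame D h.
Proof. by move=> gh [D1 Dg]; split => // k; rewrite -gh. Qed.

Lemma tame_bound D g h : (forall k, `|h k| <= `|g k|) -> tame D g -> tame D h.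
Proof. by move=> hg [D1 Dg]; split => // k; apply: le_trans (hg k) (Dg k). Qed.

Lemma tame_cst c : tame (1 + `|c|) (fun=> c).
Proof.
split=> [|k]; first by rewrite lerDl.
apply: (@le_trans _ _ (1 + `|c|)); first by rewrite lerDr.
by rewrite -[leLHS]expr1 ler_weXn2l// lerDl.
Qed.

Lemma tame_nat : tame 2 (fun k => k%:R : R).
Proof.
split=> [|k]; first lra.
rewrite normr_nat -natrX ler_nat; apply: leq_trans (ltnW (ltn_expl k.+1 _)) => //.
Qed.

Lemma tameN D g : tame D g -> tame D (fun k => - g k).
Proof. by move=> [D1 Dg]; split=> // k; rewrite normrN. Qed.

Lemma tame_norm D g : tame D g -> tame D (fun k => `|g k|).
Proof. by move=> [D1 Dg]; split=> // k; rewrite normr_id. Qed.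

Lemma tameD D E g h : tame D g -> tame E h -> tame (D + E) (fun k => g k + h k).
Proof.
move=> [D1 Dg] [E1 Eh]; split=> [|k]; first lra.
apply: le_trans (ler_normD _ _) _; apply: le_trans (lerD (Dg k) (Eh k)) _.
elim: k => [|k IH]; first by rewrite !expr1.
rewrite !(exprS _ k.+1) mulrDl.
have d0 : 0 <= D ^+ k.+1 by rewrite exprn_ge0//; lra.
have e0 : 0 <= E ^+ k.+1 by rewrite exprn_ge0//; lra.
by apply: lerD; rewrite ler_wpM2l//; lra.
Qed.

Lemma tameB D E g h : tame D g -> tame E h -> tame (D + E) (fun k => g k - h k).
Proof. by move=> tg th; apply: tameD tg (tameN th). Qed.

Lemma tameM D E g h : tame D g -> tame E h -> tame (D * E) (fun k => g k * h k).
Proof.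
move=> [D1 Dg] [E1 Eh]; split=> [|k]; first by rewrite mulr_ege1.
by rewrite normrM exprMn ler_pM.
Qed.

Lemma tameZ c E h : tame E h -> tame ((1 + `|c|) * E) (fun k => c * h k).
Proof. exact: tameM (tame_cst c). Qed.

Lemma tameX D g n : tame D g -> tame (D ^+ n) (fun k => g k ^+ n).
Proof.
move=> tg; elim: n => [|n IH].
  split=> [|k]; first by rewrite expr0.
  by rewrite expr0 normr1 expr1n.
by rewrite exprS; apply: eq_tame (tameM tg IH) => k; rewrite exprS.
Qed.

Lemma tameS D g : tame D g -> tame (D ^+ 2) (fun k => g k.+1).
Proof.
move=> [D1 Dg]; split=> [|k]; first by rewrite exprn_ege1.
apply: le_trans (Dg _) _; rewrite -exprM ler_weXn2l//.
by rewrite mul2n -addnn addnS ltnS leq_addr.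
Qed.

End Tame.

Section Pmean.
Context {R : realType}.
Implicit Types (D E r c v w : R) (g h : nat -> R).

Lemma pois_ge0 r k : 0 <= r -> 0 <= pois r k.
Proof. by move=> r0; rewrite /pois !mulr_ge0 ?expR_ge0 ?invr_ge0 ?exprn_ge0. Qed.

Lemma poisS r k : k.+1%:R * pois r k.+1 = r * pois r k.
Proof.
rewrite /pois factS natrM exprS invfM.
have k0 : (k.+1%:R : R) != 0 by rewrite pnatr_eq0.
by move: k0; move: (k.+1%:R : R) (k`!%:R^-1 : R) => a b a0; field.
Qed.

Lemma exp_sum_le (x : R) n : 0 <= x ->
  \sum_(0 <= k < n) x ^+ k / k`!%:R <= expR x.
Proof.
move=> x0.
have := @nondecreasing_cvgn_le R (series (exp_coeff x)) _ (is_cvg_series_exp_coeff x) n.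
apply.
by apply: nondecreasing_series => k _ _; rewrite /exp_coeff/= divr_ge0// exprn_ge0.
Qed.

(** A geometric factor D ^+ k is absorbed by the weights: it only replaces the
    exponential series at r by the one at r * D. *)
Lemma pois_sum_le r D n : 0 <= r -> 0 <= D ->
  \sum_(0 <= k < n) pois r k * D ^+ k.+1 <= D * expR (r * D).
Proof.
move=> r0 D0.
have -> : \sum_(0 <= k < n) pois r k * D ^+ k.+1 =
   (D * expR (- r)) * \sum_(0 <= k < n) (r * D) ^+ k / k`!%:R.
  rewrite big_distrr/=; apply: eq_bigr => k _.
  by rewrite /pois exprMn exprS; ring.
have e1 : expR (- r) <= 1 by rewrite expR_le1 oppr_le0.
apply: (@le_trans _ _ (D * expR (- r) * expR (r * D))).
  by apply: ler_wpM2l; rewrite ?mulr_ge0 ?expR_ge0 ?exp_sum_le ?mulr_ge0.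
rewrite ler_wpM2r ?expR_ge0//; nra.
Qed.

Lemma pmean_cvg r D g : 0 <= r -> tame D g -> ispm r g (pmean r g).
Proof.
move=> r0 [D1 Dg].
have : cvgn [normed series (fun k => pois r k * g k)].
  apply: nondecreasing_is_cvgn.
    by apply/nondecreasing_seqP => n; rewrite /= !seriesEnat/= big_nat_recr//= lerDl.
  exists (D * expR (r * D)) => _ [n _ <-].
  apply: le_trans (pois_sum_le n r0 (_ : 0 <= D)); last lra.
  rewrite /= /series/=; apply: ler_sum => k _; rewrite normrM ger0_norm ?pois_ge0//.
  by rewrite ler_wpM2l ?pois_ge0.
by move=> /normed_cvg gc; split.
Qed.

Lemma ispmE r g v : ispm r g v -> pmean r g = v.
Proof. by move=> [H]; apply: cvg_lim. Qed.

Lemma eq_ispm r g h v w : ispm r g v -> g =1 h -> v = w -> ispm r h w.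
Proof.
by move=> + /funext <- <-.
Qed.

Lemma ispmD r g h v w : ispm r g v -> ispm r h w ->
  ispm r (fun k => g k + h k) (v + w).
Proof.
move=> [gv] [hw]; split.
have -> : series (fun k => pois r k * (g k + h k)) =
    (series (fun k => pois r k * g k)) \+ (series (fun k => pois r k * h k)).
  apply/funext => n; rewrite /series/= -big_split/=.
  by apply: eq_bigr => k _; rewrite mulrDr.
exact: cvgD.
Qed.

Lemma ispmZ r c g v : ispm r g v -> ispm r (fun k => c * g k) (c * v).
Proof.
move=> [gv]; split.
have -> : series (fun k => pois r k * (c * g k)) =
    (fun n => c * series (fun k => pois r k * g k) n).
  apply/funext => n; rewrite /series/= big_distrr/=.
  by apply: eq_bigr => k _; rewrite mulrCA.
exact: cvgMr.
Qed.

Lemma ispmN r g v : ispm r g v -> ispm r (fun k => - g k) (- v).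
Proof. by move=> H; apply: eq_ispm (ispmZ (-1) H) _ _ => [k|]; rewrite mulN1r. Qed.

Lemma ispmB r g h v w : ispm r g v -> ispm r h w ->
  ispm r (fun k => g k - h k) (v - w).
Proof. by move=> gv hw; apply: ispmD gv (ispmN hw). Qed.

Lemma ispm1 r : ispm r (fun=> 1) 1.
Proof.
split.
have -> : series (fun k => pois r k * 1) =
    (fun n => expR (- r) * series (exp_coeff r) n).
  apply/funext => n; rewrite /series/= big_distrr/=.
  by apply: eq_bigr => k _; rewrite mulr1 /pois /exp_coeff mulrC.
have -> : 1 = expR (- r) * expR r by rewrite mulrC expRxMexpNx_1.
apply: cvgMr; exact: is_cvg_series_exp_coeff.
Qed.

Lemma ispm_cst r c : ispm r (fun=> c) c.
Proof. by apply: eq_ispm (ispmZ (c) (ispm1 r)) _ _ => [k|]; rewrite mulr1. Qed.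

(** The identity k * pois r k = r * pois r (k - 1) turns multiplication by the
    variable into a shift; every moment computed below comes from it. *)
Lemma ispmS r g v : ispm r (fun k => g k.+1) v ->
  ispm r (fun k => k%:R * g k) (r * v).
Proof.
move=> [gv]; split.
rewrite -(@cvg_shiftS _ (series (fun k => pois r k * (k%:R * g k)))).
have -> : [sequence series (fun k => pois r k * (k%:R * g k)) n.+1]_n =
    (fun n => r * series (fun k => pois r k * g k.+1) n).
  apply/funext => n /=; rewrite /series/= big_nat_recl//= mul0r mulr0 add0r.
  rewrite big_distrr/=; apply: eq_bigr => k _.
  by rewrite mulrA (mulrC (pois _ _)) poisS; ring.
exact: cvgMr.
Qed.

Lemma ispm_ge0 r g v : 0 <= r -> ispm r g v -> (forall k, 0 <= g k) -> 0 <= v.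
Proof.
move=> r0 gv g0; apply: (cvgr_to_ge (ispm_cvg gv)); apply: nearW => n.
by rewrite /series/= sumr_ge0// => k _; rewrite mulr_ge0 ?pois_ge0.
Qed.

Lemma ispm_le r g h v w : 0 <= r -> ispm r g v -> ispm r h w ->
  (forall k, g k <= h k) -> v <= w.
Proof.
move=> r0 gv hw gh; rewrite -subr_ge0; apply: (ispm_ge0 r0 (ispmB hw gv)) => k.
by rewrite subr_ge0.
Qed.

Lemma ispm_psum_le r g v n : 0 <= r -> ispm r g v -> (forall k, 0 <= g k) ->
  \sum_(0 <= k < n) pois r k * g k <= v.
Proof.
move=> r0 gv g0; rewrite -(ispmE gv).
apply: (@nondecreasing_cvgn_le R (series (fun k => pois r k * g k))).
  by apply/nondecreasing_seqP => m; rewrite seriesSr lerDl mulr_ge0 ?pois_ge0.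
by apply/cvg_ex; exists v; apply: ispm_cvg.
Qed.

Lemma ispm_norm_le r D g v : 0 <= r -> tame D g -> ispm r g v ->
  `|v| <= D * expR (r * D).
Proof.
move=> r0 tg gv; have D1 := tame_ge1 tg.
have nv := pmean_cvg r0 (tame_norm tg).
apply: (@le_trans _ _ (pmean r (fun k => `|g k|))).
  rewrite ler_norml; apply/andP; split.
    by apply: (ispm_le r0 (ispmN nv) gv) => k; rewrite lerNl -normrN ler_norm.
  by apply: (ispm_le r0 gv nv) => k; rewrite ler_norm.
apply: (cvgr_to_le (ispm_cvg nv)); apply: nearW => n.
apply: le_trans (pois_sum_le n r0 (_ : 0 <= D)); last lra.
by apply: ler_sum => k _; rewrite ler_wpM2l ?pois_ge0//; apply: tg.2.
Qed.

(** Exponential Markov inequality: where g does not vanish the factor expR K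
    is at most e ^ k, so multiplying by it keeps g tame. *)
Lemma ispm_tail r D (K : R) g v : 0 <= r -> tame D g -> ispm r g v ->
  (forall k, k%:R <= K -> g k = 0) ->
  `|v| <= expR (- K) * (D * expR 1 * expR (r * (D * expR 1))).
Proof.
move=> r0 [D1 Dg] gv gK.
have e1 : 1 <= expR (1 : R) by rewrite -expR0 ler_expR.
have tg : tame (D * expR 1) (fun k => expR K * g k).
  split=> [|k]; first by rewrite mulr_ege1.
  have [kK|Kk] := lerP k%:R K.
    by rewrite gK// mulr0 normr0 exprn_ge0// mulr_ge0 ?expR_ge0//; lra.
  rewrite normrM exprMn mulrC ler_pM//.
  rewrite ger0_norm ?expR_ge0// -expRM_natl ler_expR mulr1.
  by rewrite (le_trans (ltW Kk))// ler_nat.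
have := ispm_norm_le r0 tg (ispmZ (expR K) gv).
rewrite normrM ger0_norm ?expR_ge0// => H.
rewrite -(ler_pM2l (expR_gt0 K)) [leRHS]mulrA expRxMexpNx_1 mul1r.
exact: H.
Qed.

End Pmean.

Section Bridge.
Context {R : realType}.

Let wdirac (r : R) (r0 : 0 <= r) (k : nat) : {measure set nat -> \bar R} :=
  mscale (NngNum (pois_ge0 k r0)) \d_k.

(** The Poisson measure is a countable sum of weighted Dirac masses, which
    turns its integrals into series. *)
Lemma poisson_mseries (r : R) (r0 : 0 < r) (A : set nat) :
  poisson r A = mseries (wdirac (ltW r0)) 0 A.
Proof.
change (poisson_prob r 0%N A = mseries (wdirac (ltW r0)) 0 A).
rewrite /poisson_prob r0 /mseries.
rewrite esum_mkcond -nneseries_esumT; last first.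
  by move=> k; case: ifP => // _; rewrite lee_fin poisson_pmf_ge0.
apply: eq_eseriesr => k _.
change ((if k \in A then (poisson_pmf r k)%:E else 0%E) = ((pois r k)%:E * \d_k A)%E).
rewrite diracE /poisson_pmf r0 /pois.
by case: (k \in A); rewrite ?mule1 ?mule0.
Qed.

Lemma ge0_expectation_poisson (r : R) (g : nat -> R) (v : R) : 0 < r ->
  (forall k, 0 <= g k) -> ispm r g v ->
  (\int[poisson r]_k (g k)%:E = v%:E)%E.
Proof.
move=> r0 g0 gv.
rewrite (@eq_measure_integral _ _ _ _ (mseries (wdirac (ltW r0)) 0)); last first.
  by move=> A _ _; apply: poisson_mseries.
rewrite ge0_integral_measure_series//; last by move=> k _; rewrite lee_fin.
rewrite (@eq_eseriesr _ _ (fun k => (pois r k * g k)%:E)); last first.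
  move=> k _; rewrite ge0_integral_mscale//; last by move=> i _; rewrite lee_fin.
  by rewrite integral_dirac//= diracT mul1e EFinM.
rewrite -(ispmE gv) /pmean -EFin_lim; last by apply/cvg_ex; exists v; apply: ispm_cvg.
by apply/congr_lim/funext => n /=; rewrite /series/= -sumEFin.
Qed.

Lemma expectation_poisson (r D : R) (g : nat -> R) : 0 < r -> tame D g ->
  ('E_(poisson r)[g] = (pmean r g)%:E)%E.
Proof.
move=> r0 tg; rewrite unlock integralE.
have tp : tame D (fun k => Num.max (g k) 0).
  apply: tame_bound tg => k; case: (lerP (g k) 0) => h.
    by rewrite normr0.
  by [].
have tn : tame D (fun k => Num.max (- g k) 0).
  apply: tame_bound tg => k; case: (lerP (- g k) 0) => h.
    by rewrite normr0.
  by rewrite normrN.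
have mp := pmean_cvg (ltW r0) tp; have mn := pmean_cvg (ltW r0) tn.
have -> : (\int[poisson r]_x ((fun k => (g k)%:E)^\+ x) =
     (pmean r (fun k => Num.max (g k) 0))%:E)%E.
  rewrite -(ge0_expectation_poisson r0 _ mp); last by move=> k; rewrite le_max lexx orbT.
  by apply: eq_integral => k _; rewrite funeposE EFin_max.
have -> : (\int[poisson r]_x ((fun k => (g k)%:E)^\- x) =
     (pmean r (fun k => Num.max (- g k) 0))%:E)%E.
  rewrite -(ge0_expectation_poisson r0 _ mn); last by move=> k; rewrite le_max lexx orbT.
  by apply: eq_integral => k _; rewrite funenegE EFin_max.
rewrite -EFinB; congr (_%:E); apply/esym; apply: ispmE.
apply: eq_ispm (ispmB mp mn) _ _ => // k.
by case: (lerP (g k) 0) => h; case: (lerP (- g k) 0) => h'; lra.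
Qed.

Lemma covariance_poisson (r D E : R) (g h : nat -> R) : 0 < r ->
  tame D g -> tame E h ->
  fine (covariance (poisson r) g h) =
  pmean r (fun k => (g k - pmean r g) * (h k - pmean r h)).
Proof.
move=> r0 tg th; rewrite unlock.
rewrite (expectation_poisson r0 tg) (expectation_poisson r0 th) /=.
rewrite (expectation_poisson r0 (tameM (tameB tg (tame_cst _)) (tameB th (tame_cst _)))).
by [].
Qed.

End Bridge.

(** * Urns: adding balls and Poissonization *)


(** Occupancy vectors carry a bound B on each cell so that they form a finite
    type. Only their values matter, and B may be taken as large as convenient. *)
Definition vals N B (k : {ffun 'I_N -> 'I_B.+1}) : 'I_N -> nat := fun m => k m.

Definition incr N (x : 'I_N -> nat) (m : 'I_N) : 'I_N -> nat :=
  fun i => (x i + (i == m))%N.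

Section Occupancy.
Context {R : realType} (N B : nat).
Local Notation K := {ffun 'I_N -> 'I_B.+1}.
Implicit Types (k : K) (x : 'I_N -> nat) (m : 'I_N) (F : ('I_N -> nat) -> R).

Definition tot x : nat := (\sum_(i < N) x i)%N.
Definition rfac x : R := \prod_(i < N) ((x i)`!%:R)^-1.

(** The expectation of F after M balls have been thrown independently and
    uniformly into the N cells, as long as M is at most B. *)
Definition urn_mean (M : nat) F : R :=
  M`!%:R / N%:R ^+ M * \sum_(k : K | tot (vals k) == M) rfac (vals k) * F (vals k).

Definition addball m (k : K) : K :=
  [ffun i => if i == m then inord (k i).+1 else k i].
Definition delball m (k : K) : K :=
  [ffun i => if i == m then inord (k i).-1 else k i].

Lemma tot_incr x m : tot (incr x m) = (tot x).+1.
Proof.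
rewrite /tot /incr big_split/= -addn1; congr addn.
by rewrite (bigD1 m)//= eqxx big1 ?addn0// => i /negbTE ->.
Qed.

Lemma le_tot x m : (x m <= tot x)%N.
Proof. by rewrite /tot (bigD1 m)//= leq_addr. Qed.

Lemma vals_addball m k : (k m < B)%N -> vals (addball m k) = incr (vals k) m.
Proof.
move=> kB; apply/funext => i; rewrite /vals /addball /incr ffunE.
by case: eqP => [->|_]; rewrite ?addn0// inordK ?addn1.
Qed.

Lemma addballK m k : (k m < B)%N -> delball m (addball m k) = k.
Proof.
move=> kB; apply/ffunP => i; rewrite !ffunE; case: eqP => [->|//].
apply: val_inj => /=; have -> : (inord (k m).+1 : 'I_B.+1) = (k m).+1 :> nat.
  by rewrite inordK.
by rewrite inordK/=.
Qed.

Lemma delballK m k : (0 < k m)%N -> addball m (delball m k) = k.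
Proof.
move=> k0; apply/ffunP => i; rewrite !ffunE; case: eqP => [->|//].
have kB : ((k m).-1 < B.+1)%N by rewrite (leq_ltn_trans (leq_pred _)).
by apply: val_inj; rewrite /= inordK (inordK kB) prednK.
Qed.

Lemma addball_gt0 m k : (0 < addball m k m)%N = (k m < B)%N.
Proof.
rewrite ffunE eqxx; have [kB|Bk] := ltnP (k m) B; first by rewrite inordK.
by rewrite /inord /insubd insubN//= -leqNgt ltnS.
Qed.

Lemma rfac_incr x m : (incr x m m)%:R * rfac (incr x m) = rfac x.
Proof.
rewrite /rfac (bigD1 m)//= [in RHS](bigD1 m)//= mulrA; congr (_ * _).
  rewrite /incr eqxx addn1 factS natrM invfM mulrA divff ?mul1r//.
by apply: eq_bigr => i /negbTE im; rewrite /incr im addn0.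
Qed.

(** Adding a ball to cell m is a bijection onto the vectors in which m is
    occupied, and the factor k m compensates the change of the factorials. *)
Lemma incr_sum m M F : (M < B)%N ->
  \sum_(k : K | tot (vals k) == M) rfac (vals k) * F (incr (vals k) m) =
  \sum_(k : K | tot (vals k) == M.+1) (k m)%:R * rfac (vals k) * F (vals k).
Proof.
move=> MB; rewrite [RHS](bigID (fun k : K => (0 < k m)%N))/=.
rewrite [X in _ = _ + X]big1 ?addr0; last first.
  by move=> k /andP[_]; rewrite -eqn0Ngt => /eqP ->; rewrite !mul0r.
rewrite [RHS](reindex_onto (addball m) (delball m))/=; last first.
  by move=> k /andP[_ k0]; apply: delballK.
apply: esym; apply: eq_big => [k|k]; last first.
  move=> /andP[/andP[_]]; rewrite addball_gt0 => kB _.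
  have := vals_addball kB; rewrite {1}/vals => /(congr1 (fun f => f m)) ->.
  by rewrite vals_addball// rfac_incr.
rewrite addball_gt0; apply/idP/idP => [/andP[/andP[+ kB] _]|/eqP kM].
  by rewrite vals_addball// tot_incr.
have kB : (k m < B)%N.
  by rewrite (leq_ltn_trans (le_tot (vals k) m))// kM.
by rewrite vals_addball// tot_incr kM eqxx kB addballK ?eqxx.
Qed.

(** Throwing M.+1 balls is throwing M of them and then one more into a
    uniformly chosen cell. *)
Lemma urn_mean_step M F : (0 < N)%N -> (M < B)%N ->
  urn_mean M.+1 F =
  M`!%:R / N%:R ^+ M * \sum_(k : K | tot (vals k) == M)
     rfac (vals k) * (N%:R^-1 * \sum_(m < N) F (incr (vals k) m)).
Proof.
move=> N0 MB.
have Nn0 : (N%:R : R) != 0 by rewrite pnatr_eq0 -lt0n.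
have -> : \sum_(k : K | tot (vals k) == M)
     rfac (vals k) * (N%:R^-1 * \sum_(m < N) F (incr (vals k) m)) =
   N%:R^-1 * \sum_(m < N) \sum_(k : K | tot (vals k) == M)
     rfac (vals k) * F (incr (vals k) m).
  rewrite exchange_big/= big_distrr/=; apply: eq_bigr => k _.
  by rewrite mulrCA -mulr_sumr.
under eq_bigr do rewrite incr_sum//.
rewrite exchange_big/=.
have -> : \sum_(k : K | tot (vals k) == M.+1) \sum_(m < N)
    (k m)%:R * rfac (vals k) * F (vals k) =
  M.+1%:R * \sum_(k : K | tot (vals k) == M.+1) rfac (vals k) * F (vals k).
  rewrite big_distrr/=; apply: eq_bigr => k /eqP kM.
  by rewrite -!mulr_suml -natr_sum -mulrA -kM.
rewrite /urn_mean factS natrM exprS invfM.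
move: (N%:R^-1 : R) ((N%:R ^+ M)^-1 : R) (M`!%:R : R) (M.+1%:R : R) => a b c e.
by move: (\sum_(_ | _) _) => z; ring.
Qed.

Definition ball_monotone F := forall x m, F x <= F (incr x m).

Lemma rfac_ge0 x : 0 <= rfac x.
Proof. by apply: prodr_ge0 => i _; rewrite invr_ge0. Qed.

Lemma urn_coef_ge0 M : 0 <= M`!%:R / N%:R ^+ M :> R.
Proof. by rewrite divr_ge0// exprn_ge0. Qed.

(** If no added ball decreases F, neither does it decrease the average of F.
    This monotonicity in the number of balls is what replaces a local limit
    theorem for the total. *)
Lemma urn_mean_le M F : (0 < N)%N -> (M < B)%N -> ball_monotone F ->
  urn_mean M F <= urn_mean M.+1 F.
Proof.
move=> N0 MB mF; rewrite urn_mean_step// ler_wpM2l ?urn_coef_ge0//.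
apply: ler_sum => k _; rewrite ler_wpM2l ?rfac_ge0//.
have Np : 0 < N%:R :> R by rewrite ltr0n.
rewrite -(ler_pM2l Np) mulrA divff ?mul1r ?gt_eqF//.
have -> : N%:R * F (vals k) = \sum_(m < N) F (vals k).
  by rewrite sumr_const card_ord mulr_natl.
by apply: ler_sum => m _; apply: mF.
Qed.

Lemma urn_mean_homo M M' F : (0 < N)%N -> (M <= M')%N -> (M' <= B)%N ->
  ball_monotone F -> urn_mean M F <= urn_mean M' F.
Proof.
move=> N0 /subnK <-; elim: (M' - M)%N => [|j IH] // jB mF.
by apply: le_trans (IH (ltnW jB) mF) _; apply: urn_mean_le.
Qed.

Lemma urn_mean_ge0 M F : (forall x, 0 <= F x) -> 0 <= urn_mean M F.
Proof.
move=> F0; rewrite mulr_ge0 ?urn_coef_ge0// sumr_ge0// => k _.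
by rewrite mulr_ge0 ?rfac_ge0.
Qed.

(** Independent Poisson counts have a Poisson total, given which they are
    multinomial. *)
Lemma poissonization r M F : (0 < N)%N ->
  \sum_(k : K | tot (vals k) == M) (\prod_(i < N) pois r (k i)) * F (vals k) =
  pois (N%:R * r) M * urn_mean M F.
Proof.
move=> N0; have Nn0 : (N%:R : R) != 0 by rewrite pnatr_eq0 -lt0n.
rewrite /urn_mean mulrA big_distrr/=; apply: eq_bigr => k /eqP kM.
rewrite mulrA; congr (_ * _).
have -> : \prod_(i < N) pois r (k i) = r ^+ M * rfac (vals k) * expR (- (N%:R * r)).
  rewrite /pois !big_split/= prodrXr -kM; congr (_ * _ * _).
  by rewrite prodr_const card_ord -mulrN expRM_natl.
rewrite /pois exprMn.
have f0 : (M`!%:R : R) != 0 by rewrite pnatr_eq0 -lt0n fact_gt0.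
have nM0 : (N%:R ^+ M : R) != 0 by rewrite expf_neq0.
by move: f0 nM0; move: (M`!%:R : R) (N%:R ^+ M : R) => a b a0 b0; field; rewrite a0 b0.
Qed.

Lemma prod_pois_ge0 (r : R) k : 0 <= r -> 0 <= \prod_(i < N) pois r (k i).
Proof. by move=> r0; apply: prodr_ge0 => i _; apply: pois_ge0. Qed.

Lemma big_tot_lt (G : K -> R) M :
  \sum_(k : K | (tot (vals k) < M)%N) G k =
  \sum_(0 <= j < M) \sum_(k : K | tot (vals k) == j) G k.
Proof.
elim: M => [|M IH]; first by rewrite big_nil big_pred0.
rewrite big_nat_recr//= -IH (bigID (fun k : K => (tot (vals k) == M)))/= addrC.
congr (_ + _); apply: eq_bigl => k; rewrite ltnS leq_eqVlt.
  by case: ltngtP.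
by case: ltngtP.
Qed.

(** While its total is at most n, the Poisson model has thrown no more balls
    than the urn, which can only make F smaller on average. *)
Lemma urn_mean_ge_poisson r n F : (0 < N)%N -> (n <= B)%N -> 0 <= r ->
  ball_monotone F -> (forall x, 0 <= F x) ->
  \sum_(k : K | (tot (vals k) <= n)%N) (\prod_(i < N) pois r (k i)) * F (vals k)
  <= urn_mean n F.
Proof.
move=> N0 nB r0 mF F0; rewrite (big_tot_lt _ n.+1).
under eq_bigr do rewrite poissonization//.
have Nr0 : 0 <= N%:R * r by rewrite mulr_ge0.
apply: (@le_trans _ _ (\sum_(0 <= j < n.+1) pois (N%:R * r) j * urn_mean n F)).
  rewrite !big_nat; apply: ler_sum => j /andP[_ jn].
  by rewrite ler_wpM2l ?pois_ge0// urn_mean_homo.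
rewrite -mulr_suml -[leRHS]mul1r ler_wpM2r ?urn_mean_ge0//.
have := @ispm_psum_le R _ _ _ n.+1 Nr0 (ispm1 _) (fun=> ler01).
by under eq_bigr do rewrite mulr1.
Qed.

(** Conversely, totals between n and n + L only make F larger; the price is
    the probability of this window of totals. *)
Lemma urn_mean_le_poisson r n L F : (0 < N)%N -> (n + L <= B)%N -> 0 <= r ->
  ball_monotone F -> (forall x, 0 <= F x) ->
  (\sum_(n <= j < (n + L).+1) pois (N%:R * r) j) * urn_mean n F <=
  \sum_(k : K | (n <= tot (vals k) <= n + L)%N)
     (\prod_(i < N) pois r (k i)) * F (vals k).
Proof.
move=> N0 nB r0 mF F0.
have Nr0 : 0 <= N%:R * r by rewrite mulr_ge0.
have -> : \sum_(k : K | (n <= tot (vals k) <= n + L)%N)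
     (\prod_(i < N) pois r (k i)) * F (vals k) =
   \sum_(n <= j < (n + L).+1) pois (N%:R * r) j * urn_mean j F.
  under [in RHS]eq_bigr do rewrite -poissonization//.
  have := big_tot_lt (fun k => (\prod_(i < N) pois r (k i)) * F (vals k)) (n + L).+1.
  rewrite (bigID (fun k : K => (tot (vals k) < n)%N))/=.
  rewrite (@big_cat_nat _ _ _ n)//=; last by rewrite -addnS leq_addr.
  have -> : \sum_(k : K | (tot (vals k) < (n + L).+1)%N && (tot (vals k) < n)%N)
      (\prod_(i < N) pois r (k i)) * F (vals k) =
     \sum_(k : K | (tot (vals k) < n)%N) (\prod_(i < N) pois r (k i)) * F (vals k).
    apply: eq_bigl => k; apply/andP/idP => [[]//|kn]; split=> //.
    by rewrite (ltn_trans kn)// ltnS leq_addr.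
  rewrite big_tot_lt => /addrI <-; apply: eq_bigl => k.
  by rewrite -leqNgt ltnS andbC.
rewrite mulr_suml !big_nat; apply: ler_sum => j /andP[nj jL].
rewrite ler_wpM2l ?pois_ge0// urn_mean_homo//.
by rewrite (leq_trans _ nB)// -ltnS.
Qed.

Lemma sum_prod_cells (b : nat -> R) :
  \sum_(k : K) \prod_(i < N) b (k i) = (\sum_(0 <= j < B.+1) b j) ^+ N.
Proof.
have -> : (\sum_(0 <= j < B.+1) b j) ^+ N = \prod_(i < N) \sum_(j < B.+1) b j.
  by rewrite prodr_const card_ord big_mkord.
by rewrite bigA_distr_bigA/=.
Qed.

End Occupancy.

Lemma multinomial_uniform {R : realType} (N n B : nat) (P : ('I_N -> nat) -> bool) :
  (0 < N)%N -> (n <= B)%N ->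
  multinomial_prob (@uniform_cells R N) [pred k : counts N n | P (vals k)] =
  urn_mean B n (fun x => (P x)%:R : R).
Proof.
move=> N0 nB; have Nn0 : (N%:R : R) != 0 by rewrite pnatr_eq0 -lt0n.
rewrite /multinomial_prob /urn_mean big_distrr/=.
(* A total equal to n bounds every cell by n, so bounding the cells by n or by
   B selects the same vectors. *)
pose up (k : counts N n) : {ffun 'I_N -> 'I_B.+1} := [ffun i => inord (k i)].
pose dn (k : {ffun 'I_N -> 'I_B.+1}) : counts N n := [ffun i => inord (k i)].
have vup k : vals (up k) = vals k.
  apply/funext => i; rewrite /vals ffunE inordK// (leq_trans (ltn_ord _))//.
have vdn k : (tot (vals k) == n) -> vals (dn k) = vals k.
  move=> /eqP kn; apply/funext => i; rewrite /vals ffunE inordK// ltnS -kn.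
  exact: le_tot (vals k) i.
have vinj C (k k' : {ffun 'I_N -> 'I_C.+1}) : vals k = vals k' -> k = k'.
  move=> kk; apply/ffunP => i; apply: val_inj.
  exact: (congr1 (fun f => f i) kk).
rewrite (reindex_onto up dn)/=; last first.
  by move=> k kn; apply: vinj; rewrite vup vdn.
under [RHS]eq_bigl => k.
  rewrite vup (_ : dn (up k) == k); last first.
    apply/eqP/ffunP => i; rewrite !ffunE; apply: val_inj => /=.
    have ki : (k i < B.+1)%N by rewrite (leq_trans (ltn_ord _)).
    by rewrite (inordK ki) inordK.
  rewrite andbT; over.
rewrite big_mkcond/= [RHS]big_mkcond/=; apply: eq_bigr => k _.
rewrite vup /multinomial_pmf -[(\sum_(m < N) k m)%N]/(tot (vals k)).
case: eqP => kn; last by case: ifP.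
case: ifP => _; last by rewrite !mulr0.
rewrite mulr1 /uniform_cells prodrXr -[(\sum_(m < N) k m)%N]/(tot (vals k)) kn.
rewrite /rfac exprVn -prodfV; rewrite /vals; move: (\prod_(i < N) _) => b.
by move: b (n`!%:R : R) (N%:R ^- n : R) => x y z; ring.
Qed.

(** * Exponential estimates *)


Section Analysis.
Context {R : realType}.

Lemma expR_taylor2 (x : R) :
  `|expR x - (1 + x + x ^+ 2 / 2)| <= `|x| ^+ 3 * expR `|x|.
Proof.
have cv : (fun n => series (exp_coeff x) n.+3 - (1 + x + x ^+ 2 / 2)) @ \oo -->
    expR x - (1 + x + x ^+ 2 / 2).
  apply: cvgB; last exact: cvg_cst.
  have -> : (fun n => series (exp_coeff x) n.+3) =
      [sequence series (exp_coeff x) (n + 3)%N]_n.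
    by apply/funext => n /=; rewrite addn3.
  rewrite (@cvg_shiftn 3 _ (series (exp_coeff x))).
  exact: is_cvg_series_exp_coeff.
have cn : (fun n => `|series (exp_coeff x) n.+3 - (1 + x + x ^+ 2 / 2)|) @ \oo -->
    `|expR x - (1 + x + x ^+ 2 / 2)| by apply: cvg_norm.
apply: (cvgr_to_le cn); apply: nearW => n.
rewrite /series/= !big_nat_recl//=.
have -> : exp_coeff x 0%N = 1 by rewrite /exp_coeff/= fact0 expr0 divr1.
have -> : exp_coeff x 1%N = x.
  by rewrite /exp_coeff/= expr1 (_ : 1`! = 1)%N// divr1.
have -> : exp_coeff x 2%N = x ^+ 2 / 2 by [].
set S := \sum_(_ <= _ < _) _.
have -> : 1 + (x + (x ^+ 2 / 2 + S)) - (1 + x + x ^+ 2 / 2) = S by ring.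
rewrite {}/S.
apply: (@le_trans _ _ (\sum_(0 <= i < n) `|x| ^+ 3 * (`|x| ^+ i / i`!%:R))).
  apply: le_trans (ler_norm_sum _ _ _) _; apply: ler_sum => i _.
  rewrite normrM normrX normfV normr_nat (_ : i.+3 = (3 + i)%N)// exprD -mulrA.
  rewrite ler_wpM2l ?exprn_ge0// ler_wpM2l ?exprn_ge0//.
  rewrite lef_pV2 ?posrE ?ltr0n ?fact_gt0// ler_nat.
  by rewrite !addSn add0n !factS -[leqLHS]mul1n !mulnA leq_mul2r muln_gt0 orbT.
by rewrite -big_distrr/= ler_wpM2l ?exprn_ge0// exp_sum_le.
Qed.

(** At z = 1 / (2 m + 1) this reads e ^ (2 / (2 m + 1)) <= (m + 1) / m, the
    induction step in the bound for the factorial. *)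
Lemma expR_mobius (z : R) : 0 < z < 1 -> expR (2 * z) * (1 - z) <= 1 + z.
Proof.
move=> /andP[z0 z1].
pose F (x : R) := (1 + x) - expR (2 * x) * (1 - x).
pose dF (x : R) := 1 - expR (2 * x) * (1 - 2 * x).
have dFE (x : R) : is_derive x 1 F (dF x).
  rewrite /F /dF; apply: is_derive_eq.
  rewrite /GRing.scale/=; ring.
have [c _] : exists2 c : R, c \in `]0, z[%R & F z - F 0 = dF c * (z - 0).
  apply: MVT => //; apply: derivable_within_continuous => x _.
  exact: ex_derive.
have F0 : F 0 = 0 by rewrite /F mulr0 expR0; ring.
rewrite F0 !subr0 => Fz.
have dc : 0 <= dF c.
  have := ler_wpM2l (expR_ge0 (2 * c)) (expR_ge1Dx (- (2 * c))).
  by rewrite expRxMexpNx_1 /dF; lra.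
by rewrite -subr_ge0 -/(F z) Fz mulr_ge0// ltW.
Qed.

(** The upper half of Stirling's formula, up to a constant; it bounds the
    central Poisson weight from below by a multiple of 1 / sqrt n. *)
Lemma fact_le_stirling n : (0 < n)%N ->
  n`!%:R <= expR (1 - n%:R) * Num.sqrt n%:R * n%:R ^+ n :> R.
Proof.
elim: n => // -[|n] IH _.
  by rewrite (_ : 1`! = 1)%N// subrr expR0 sqrtr1 expr1 !mulr1.
have {}IH := IH isT; rewrite factS natrM.
set m := n.+1 in IH *.
have m0 : 0 < m%:R :> R by rewrite ltr0n.
have mS : m.+1%:R = m%:R + 1 :> R by rewrite -natr1.
apply: (@le_trans _ _ (m.+1%:R * (expR (1 - m%:R) * Num.sqrt m%:R * m%:R ^+ m))).
  by rewrite ler_wpM2l.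
have -> : expR (1 - m%:R) = expR (1 - m.+1%:R) * expR 1 :> R.
  by rewrite -expRD; congr expR; rewrite mS; ring.
rewrite (exprS _ m).
suff H : expR 1 * (Num.sqrt m%:R * m%:R ^+ m) <= Num.sqrt m.+1%:R * m.+1%:R ^+ m :> R.
  have e0 : 0 <= m.+1%:R * expR (1 - m.+1%:R) :> R by rewrite mulr_ge0 ?expR_ge0.
  have := ler_wpM2l e0 H.
  by rewrite !mulrA => HH; apply: le_trans (le_trans HH _); rewrite le_eqVlt;
     apply/orP; left; apply/eqP; ring.
rewrite -(@ler_pXn2r _ 2)// ?nnegrE ?mulr_ge0 ?expR_ge0 ?sqrtr_ge0 ?exprn_ge0//.
rewrite !exprMn !sqr_sqrtr// -!exprM -!exprS.
rewrite -expRM_natl mulr1.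
pose z : R := (2 * m%:R + 1)^-1.
have z0 : 0 < 2 * m%:R + 1 :> R by lra.
have zb : 0 < z < 1 by rewrite /z invr_gt0 z0/= invf_lt1//; lra.
have := expR_mobius zb.
have z1 : 0 < 1 - z by lra.
rewrite -ler_pdivlMr// => H.
have E : (1 + z) / (1 - z) = m.+1%:R / m%:R.
  by rewrite mS /z; field; rewrite !gt_eqF//; lra.
have z2 : 0 <= expR (2 * z) by apply: expR_ge0.
have := lerXn2r (m * 2).+1 z2 _ H.
rewrite nnegrE E divr_ge0// => /(_ isT).
rewrite -expRM_natl exprMn exprVn ler_pdivlMr ?exprn_gt0//.
have -> : (m * 2).+1%:R * (2 * z) = 2%:R.
  by rewrite -natr1 natrM /z; field; rewrite gt_eqF//; lra.
by [].
Qed.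

Lemma nat_sqrt_ex n : exists L, (L * L <= n < L.+1 * L.+1)%N.
Proof.
elim: n => [|n [L /andP[l1 l2]]]; first by exists 0%N.
have [h|h] := ltnP n.+1 (L.+1 * L.+1)%N.
  by exists L; rewrite h (leq_trans l1).
exists L.+1; rewrite h/=; nia.
Qed.

(** The weight at n is at least e ^ -1 / (L + 1) by Stirling, and over the
    next L values it decreases by at most the factor (1 + L / n) ^ L <= e. So
    the window of length sqrt n above the mean n has probability bounded
    below, uniformly in n. *)
Lemma poisson_window n : (0 < n)%N ->
  exists2 L, (L * L <= n)%N &
    expR (- 2) <= \sum_(n <= j < (n + L).+1) pois (n%:R : R) j.
Proof.
move=> n0; have [L /andP[L1 L2]] := nat_sqrt_ex n; exists L => //.
have nR : 0 < n%:R :> R by rewrite ltr0n.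
have sn : Num.sqrt n%:R <= L.+1%:R :> R.
  rewrite -(@ler_pXn2r _ 2)// ?nnegrE ?sqrtr_ge0// sqr_sqrtr// -natrX ler_nat.
  by rewrite expnS expn1 ltnW.
have fp (j : nat) : 0 < j`!%:R :> R by rewrite ltr0n fact_gt0.
have lb j : (j <= L)%N -> expR (- 2) / L.+1%:R <= pois (n%:R : R) (n + j).
  move=> jL.
  have step i : pois n%:R n / (1 + L%:R / n%:R) ^+ i <= pois (n%:R : R) (n + i) \/ (L < i)%N.
    elim: i => [|i IH]; first by left; rewrite expr0 divr1 addn0.
    have [h|h] := leqP i.+1 L; [left|by right].
    have {}IH : pois n%:R n / (1 + L%:R / n%:R) ^+ i <= pois (n%:R : R) (n + i).
      by case: IH => //; lia.
    have ni0 : 0 < (n + i).+1%:R :> R by rewrite ltr0n.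
    have -> : pois (n%:R : R) (n + i.+1) = n%:R / (n + i).+1%:R * pois n%:R (n + i).
      by rewrite addnS -mulrAC -poisS mulrAC divff ?mul1r// gt_eqF.
    have q0 : 0 < 1 + L%:R / n%:R :> R by rewrite ltr_pwDl// divr_ge0.
    rewrite exprS invfM mulrCA ler_pM// ?invr_ge0 ?(ltW q0)//.
      by rewrite divr_ge0 ?pois_ge0 ?exprn_ge0 ?(ltW q0).
    rewrite -[leRHS]invf_div lef_pV2 ?posrE ?divr_gt0//.
    rewrite ler_pdivrMr// mulrDl mul1r divfK ?gt_eqF//.
    by rewrite -natrD ler_nat; lia.
  have {step} : pois n%:R n / (1 + L%:R / n%:R) ^+ j <= pois (n%:R : R) (n + j).
    by case: (step j) => //; lia.
  apply: le_trans.
  have q1 : 1 <= 1 + L%:R / n%:R :> R by rewrite lerDl divr_ge0.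
  have qe : (1 + L%:R / n%:R) ^+ j <= expR 1 :> R.
    apply: (@le_trans _ _ (expR (L%:R / n%:R) ^+ L)).
      apply: (@le_trans _ _ ((1 + L%:R / n%:R) ^+ L)); first by rewrite ler_weXn2l.
      by rewrite lerXn2r ?nnegrE ?expR_ge0 ?expR_ge1Dx//; lra.
    rewrite -expRM_natl ler_expR mulrA ler_pdivrMr// mul1r -natrM ler_nat.
    by [].
  have pn : expR (- 1) / L.+1%:R <= pois (n%:R : R) n.
    rewrite ler_pdivrMr// /pois.
    have := fact_le_stirling n0 => H.
    have H2 : n`!%:R <= expR (1 - n%:R) * L.+1%:R * n%:R ^+ n :> R.
      apply: le_trans H _; rewrite ler_wpM2r ?exprn_ge0// ler_wpM2l ?expR_ge0//.
    have e0 : 0 <= expR (-1) / n`!%:R :> R by rewrite divr_ge0 ?expR_ge0.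
    have := ler_wpM2l e0 H2.
    rewrite divfK ?gt_eqF// => H3; apply: le_trans H3 _.
    rewrite expRD; rewrite le_eqVlt; apply/orP; left; apply/eqP.
    transitivity (expR 1 * expR (-1) * (expR (- n%:R) * L.+1%:R * n%:R ^+ n / n`!%:R) : R).
      ring.
    by rewrite expRxMexpNx_1; ring.
  have -> : expR (- 2) / L.+1%:R = expR (-1) / L.+1%:R * expR (-1) :> R.
    by rewrite mulrAC -expRD; congr (expR _ / _); ring.
  rewrite ler_pM ?expR_ge0 ?divr_ge0 ?expR_ge0//.
  by rewrite expRN lef_pV2 ?posrE ?expR_gt0 ?exprn_gt0//; lra.
have -> : \sum_(n <= j < (n + L).+1) pois n%:R j =
    \sum_(0 <= i < L.+1) pois (n%:R : R) (i + n).
  by rewrite -{1}[n]add0n big_addn -addnS addKn.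
have -> : expR (- 2) = \sum_(0 <= i < L.+1) expR (- 2) / L.+1%:R :> R.
  by rewrite sumr_const_nat subn0 -[RHS]mulr_natr divfK// pnatr_eq0.
rewrite !big_nat; apply: ler_sum => i /andP[_ iL].
by rewrite addnC; apply: lb.
Qed.

(** A bound for the Poisson average of D ^+ k.+1 * sqrt (k!), uniform over
    rates up to r. *)
Definition sqrt_fact_cst (r D : R) : R := D * (1 + expR (4 * (r * D) ^+ 2)).

(** Poisson weights absorb even a factor sqrt (k!): the term x ^ k / sqrt (k!)
    is at most half the sum of 2 ^ -k and of (4 x ^ 2) ^ k / k!. This leaves
    room for the exponential of a function of order k ln k. *)
Lemma pois_sqrt_fact_sum (r D : R) n : 0 <= r -> 0 <= D ->
  \sum_(0 <= k < n) pois r k * (D ^+ k.+1 * Num.sqrt k`!%:R) <= sqrt_fact_cst r D.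
Proof.
move=> r0 D0; set x : R := r * D.
have x0 : 0 <= x by rewrite mulr_ge0.
have term k : pois r k * (D ^+ k.+1 * Num.sqrt k`!%:R) <=
   D * (2^-1 ^+ k / 2 + (4 * x ^+ 2) ^+ k / k`!%:R / 2).
  have fp : 0 < k`!%:R :> R by rewrite ltr0n fact_gt0.
  set s : R := Num.sqrt k`!%:R.
  have s0 : 0 < s by rewrite sqrtr_gt0.
  have ss : s ^+ 2 = k`!%:R by rewrite sqr_sqrtr// ltW.
  have e1 : expR (- r) <= 1 by rewrite expR_le1 oppr_le0.
  apply: (@le_trans _ _ (D * (x ^+ k / s))).
    have -> : pois r k * (D ^+ k.+1 * s) = expR (- r) * (D * (x ^+ k / s)).
      rewrite /pois /x -ss (exprS D) exprMn; field; rewrite gt_eqF//.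
    by rewrite ler_piMl// mulr_ge0// divr_ge0 ?exprn_ge0// ltW.
  rewrite ler_wpM2l//.
  have h1 : 0 <= (2^-1 : R) ^+ k <= 1.
    by rewrite exprn_ge0//= exprn_ile1//; lra.
  pose y := (2 * x) ^+ k / s.
  have -> : x ^+ k / s = 2^-1 ^+ k * y.
    rewrite /y mulrA -exprMn mulKf//.
  have -> : (4 * x ^+ 2) ^+ k / k`!%:R = y ^+ 2.
    by rewrite /y expr_div_n ss -exprM mulnC exprM; congr (_ ^+ _ / _); ring.
  move: (2^-1 ^+ k : R) h1 => b; have := sqr_ge0 (y - 1).
  have := sqr_ge0 y; nra.
apply: le_trans (ler_sum _ (fun k _ => term k)) _.
rewrite -big_distrr/= ler_wpM2l// big_split/= lerD//.
  have h : (2^-1 : R) != 1 by apply/eqP; lra.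
  have := geometric_seriesE (1 : R) h => /(congr1 (fun f => f n)).
  rewrite /series/= /geometric/= => E.
  rewrite -mulr_suml; under eq_bigr do rewrite -[_ ^+ _]mul1r.
  rewrite E; have : 0 <= (2^-1 : R) ^+ n by rewrite exprn_ge0.
  by move=> ?; rewrite mul1r (_ : (1 - 2^-1) = 2^-1 :> R); lra.
rewrite -mulr_suml; apply: (@le_trans _ _ (expR (4 * x ^+ 2) / 2)).
  by rewrite ler_wpM2r// exp_sum_le// mulr_ge0// exprn_ge0.
have := expR_ge0 (4 * x ^+ 2); lra.
Qed.

Definition mgf_cst (r E D : R) : R := sqrt_fact_cst r (E ^+ 3 * D).

(** For a centered psi of size s the average of expR psi is 1 + v / 2 up to s
    ^ 3, by Taylor's formula. Both bounds concern partial sums, since bounded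
    occupancy vectors only see finitely many values. *)
Section Mgf.
Variables (r s E D v : R) (psi : nat -> R).
Hypotheses (r0 : 0 <= r) (s0 : 0 <= s) (E1 : 1 <= E) (D1 : 1 <= D).
Hypothesis psiE : forall k, `|psi k| <= s * E ^+ k.+1.
Hypothesis psiD : forall k, expR `|psi k| <= D ^+ k.+1 * Num.sqrt k`!%:R.
Hypothesis psi1 : ispm r psi 0.
Hypothesis psi2 : ispm r (fun k => psi k ^+ 2) v.

Let C := mgf_cst r E D.

Lemma mgf_rest n :
  \sum_(0 <= k < n) pois r k * (`|psi k| ^+ 3 * expR `|psi k|) <= s ^+ 3 * C.
Proof.
apply: (@le_trans _ _ (\sum_(0 <= k < n)
   s ^+ 3 * (pois r k * ((E ^+ 3 * D) ^+ k.+1 * Num.sqrt k`!%:R)))).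
  apply: ler_sum => k _.
  rewrite [leRHS]mulrCA ler_wpM2l ?pois_ge0//.
  have h : `|psi k| ^+ 3 <= s ^+ 3 * (E ^+ 3) ^+ k.+1.
    rewrite -exprM mulnC exprM -exprMn lerXn2r ?nnegrE//.
    by apply: mulr_ge0 => //; apply: exprn_ge0; exact: le_trans ler01 E1.
  rewrite [(E ^+ 3 * D) ^+ _]exprMn.
  apply: le_trans (ler_pM _ (expR_ge0 _) h (psiD k)) _; first by rewrite exprn_ge0.
  by rewrite !mulrA.
rewrite -big_distrr/= ler_wpM2l ?exprn_ge0// pois_sqrt_fact_sum//.
by apply: mulr_ge0; [apply: exprn_ge0; exact: le_trans ler01 E1|exact: le_trans ler01 D1].
Qed.

Let q k : R := 1 + psi k + psi k ^+ 2 / 2.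

Let ispm_q : ispm r q (1 + v / 2).
Proof.
apply: eq_ispm (ispmD (ispmD (ispm1 r) psi1) (ispmZ 2^-1 psi2)) _ _.
  by move=> k; rewrite /q mulrC.
by rewrite addr0 mulrC.
Qed.

Let q0 k : 0 <= q k.
Proof. by rewrite /q; have := sqr_ge0 (1 + psi k); nra. Qed.

Lemma mgf_le n : \sum_(0 <= k < n) pois r k * expR (psi k) <= expR (v / 2 + s ^+ 3 * C).
Proof.
apply: (@le_trans _ _ (1 + v / 2 + s ^+ 3 * C)); last first.
  by rewrite -addrA expR_ge1Dx.
apply: le_trans (lerD (ispm_psum_le n r0 ispm_q q0) (mgf_rest n)).
rewrite -big_split/=; apply: ler_sum => k _; rewrite -mulrDr ler_wpM2l ?pois_ge0//.
by have := expR_taylor2 (psi k); rewrite ler_norml /q => /andP[_]; lra.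
Qed.

Lemma mgf_ge (e : R) : 0 < e -> \forall n \near \oo,
  1 + v / 2 - s ^+ 3 * C - e <= \sum_(0 <= k < n) pois r k * expR (psi k).
Proof.
move=> e0; have /cvgrPdist_le /(_ e e0) := ispm_cvg ispm_q; apply: filterS => n.
rewrite /series/= ler_distl => /andP[_ h].
apply: (@le_trans _ _ (\sum_(0 <= k < n) pois r k * q k - s ^+ 3 * C)).
  lra.
rewrite lerBlDr; apply: le_trans _ (lerD (lexx _) (mgf_rest n)).
rewrite -big_split/=; apply: ler_sum => k _; rewrite -mulrDr ler_wpM2l ?pois_ge0//.
by have := expR_taylor2 (psi k); rewrite ler_norml /q => /andP[+ _]; lra.
Qed.

End Mgf.
End Analysis.

(** * Tail probabilities of the urn through the Poisson model *)


Definition urn_prob (R : realType) (N n : nat) (P : ('I_N -> nat) -> bool) : R :=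
  multinomial_prob (@uniform_cells R N) [pred k : counts N n | P (vals k)].
Arguments urn_prob R {N} n P.

Section Bounds.
Context {R : realType}.

Lemma nat_homo_le (f : nat -> R) : (forall k, f k <= f k.+1) ->
  forall i j, (i <= j)%N -> f i <= f j.
Proof.
by move=> fS i j ij; apply: (@homo_leq R f (fun a b => a <= b)) => // a b c; apply: le_trans.
Qed.

Lemma sum_cells_incr N (f : nat -> R) (x : 'I_N -> nat) m :
  (forall k, f k <= f k.+1) -> \sum_(i < N) f (x i) <= \sum_(i < N) f (incr x m i).
Proof.
move=> fS; apply: ler_sum => i _; apply: nat_homo_le => //.
by rewrite /incr leq_addr.
Qed.

Lemma prod_pois_expR N B (r : R) (psi : nat -> R) (k : {ffun 'I_N -> 'I_B.+1}) :
  \prod_(i < N) (pois r (k i) * expR (psi (k i))) =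
  (\prod_(i < N) pois r (k i)) * expR (\sum_(i < N) psi (k i)).
Proof. by rewrite big_split/= expR_sum. Qed.

Lemma tot_real N (x : 'I_N -> nat) (r : R) :
  \sum_(i < N) ((x i)%:R - r) = (tot x)%:R - N%:R * r.
Proof.
by rewrite big_split/= -natr_sum sumr_const card_ord mulNrn mulr_natl.
Qed.

Lemma pois_psum_le1 (r : R) n : 0 <= r -> \sum_(0 <= j < n) pois r j <= 1.
Proof.
move=> r0; have := @ispm_psum_le R _ _ _ n r0 (ispm1 _) (fun=> ler01).
by under eq_bigr do rewrite mulr1.
Qed.

Lemma sum_prod_one_cell N B (r T : R) (g : nat -> R) (m : 'I_N) : 0 <= r ->
  (forall j, 0 <= g j) -> \sum_(0 <= j < B.+1) pois r j * g j <= T ->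
  \sum_(k : {ffun 'I_N -> 'I_B.+1}) (\prod_(i < N) pois r (k i)) * g (k m) <= T.
Proof.
move=> r0 g0 gT.
pose b (i : 'I_N) (j : 'I_B.+1) : R := pois r j * (if i == m then g j else 1).
have -> : \sum_(k : {ffun 'I_N -> 'I_B.+1}) (\prod_(i < N) pois r (k i)) * g (k m) =
   \sum_(k : {ffun 'I_N -> 'I_B.+1}) \prod_(i < N) b i (k i).
  apply: eq_bigr => k _; rewrite /b [RHS]big_split/=; congr (_ * _).
  by rewrite -big_mkcond/= big_pred1_eq.
rewrite -bigA_distr_bigA/= (bigD1 m)//=.
have b0 i j : 0 <= b i j.
  by rewrite mulr_ge0 ?pois_ge0//; case: ifP.
apply: (@le_trans _ _ (\sum_(j < B.+1) b m j)).
  apply: ler_piMr; first exact: sumr_ge0.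
  apply: prodr_ile1 => i /negbTE im; rewrite sumr_ge0//=.
  rewrite /b im; under eq_bigr do rewrite mulr1.
  by rewrite -(big_mkord xpredT) pois_psum_le1.
apply: le_trans gT; rewrite big_mkord; apply: ler_sum => j _.
by rewrite /b eqxx.
Qed.

(** Chernoff's inequality in the Poisson model, on the window of totals
    between n and n + sqrt n, where the correction tau * (total - n) costs at
    most |tau| * sqrt n. The event that a cell exceeds K also survives the
    addition of a ball; a union bound accounts for it. *)
Lemma urn_prob_upper (N n : nat) (r a u tau t K T Z : R) (f : nat -> R) :
  (0 < N)%N -> (0 < n)%N -> N%:R * r = n%:R -> 0 <= t ->
  (forall k, f k <= f k.+1) ->
  (forall B, \sum_(0 <= j < B) pois r j * expR (t * (f j - a - tau * (j%:R - r))) <= Z) ->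
  (forall B, \sum_(0 <= j < B) pois r j * (K < j%:R)%R%:R <= T) ->
  expR (- 2) * urn_prob R n (fun x : 'I_N -> nat =>
      (N%:R * (a + u) < \sum_(m < N) f (x m)) || [exists m, K < (x m)%:R])
    <= expR (t * (`|tau| * Num.sqrt n%:R) - t * (N%:R * u)) * Z ^+ N + N%:R * T.
Proof.
move=> N0 n0 Nr t0 fS ZB TB.
have r0 : 0 <= r.
  have : 0 <= N%:R * r by rewrite Nr.
  by rewrite pmulr_rge0// ltr0n.
set Q := (fun x : 'I_N -> nat => _).
have [L LL Lw] := @poisson_window R n n0.
have sL : L%:R <= Num.sqrt n%:R :> R.
  rewrite -(@ler_pXn2r _ 2)// ?nnegrE ?sqrtr_ge0// sqr_sqrtr// -natrX ler_nat.
  by rewrite expnS expn1.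
pose B := (n + L)%N.
rewrite /urn_prob (multinomial_uniform Q N0 (leq_addr L n)) -/B.
pose F (x : 'I_N -> nat) : R := (Q x)%:R.
have F0 x : 0 <= F x by rewrite ler0n.
have mF : ball_monotone F.
  move=> x m; rewrite /F ler_nat; rewrite /Q.
  case: ltP => [h|_] /=.
    by rewrite (lt_le_trans h (sum_cells_incr _ _ fS)).
  have [/existsP[i Ki]|] := boolP [exists m0, K < (x m0)%:R] => //.
  suff -> : [exists m0, K < (incr x m m0)%:R] by rewrite orbT.
  by apply/existsP; exists i; rewrite (lt_le_trans Ki)// ler_nat /incr leq_addr.
have := urn_mean_le_poisson N0 (leqnn B) r0 mF F0.
rewrite Nr => H; apply: le_trans (le_trans _ H) _.
  by rewrite ler_wpM2r ?urn_mean_ge0.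
pose psi j := t * (f j - a - tau * (j%:R - r)).
set e0 := expR (t * _ - _).
apply: (@le_trans _ _ (\sum_(k : {ffun 'I_N -> 'I_B.+1})
   (e0 * (\prod_(i < N) (pois r (k i) * expR (psi (k i)))) +
    \sum_(m < N) (\prod_(i < N) pois r (k i)) * (K < (k m)%:R)%R%:R))).
  rewrite big_mkcond/=; apply: ler_sum => k _.
  have p0 : 0 <= \prod_(i < N) pois r (k i) by apply: prod_pois_ge0.
  have s0 : 0 <= \sum_(m < N) (\prod_(i < N) pois r (k i)) * (K < (k m)%:R)%R%:R :> R.
    by apply: sumr_ge0 => m _; rewrite mulr_ge0.
  rewrite prod_pois_expR.
  have t1 : 0 <= e0 * (\prod_(i < N) pois r (k i) * expR (\sum_(i < N) psi (k i))).
    by rewrite !mulr_ge0 ?expR_ge0.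
  case: ifP => [/andP[nk kL]|_]; last by rewrite addr_ge0.
  rewrite /F /Q; case: ltP => [h|_] /=; last first.
    case: existsP => [[m Km]|_]; last by rewrite mulr0 addr_ge0.
    rewrite mulr1 -[leLHS]add0r lerD// [leRHS](bigD1 m)//=.
    have -> : (K < (k m)%:R) = true := Km.
    rewrite mulr1 lerDl.
    by apply: sumr_ge0 => i _; rewrite mulr_ge0.
  rewrite mulr1 -[leLHS]addr0 lerD// mulrCA ler_peMr// -expRD -[leLHS]expR0 ler_expR.
  have -> : \sum_(i < N) psi (k i) =
     t * (\sum_(i < N) f (k i) - N%:R * a - tau * ((tot (vals k))%:R - n%:R)).
    rewrite -mulr_sumr; congr (t * _).
    rewrite !sumrB -Nr -(tot_real (vals k)) mulr_sumr; congr (_ - _ - _).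
    by rewrite sumr_const card_ord mulr_natl.
  set S := \sum_(i < N) f (k i) in h *.
  have d0 : 0 <= (tot (vals k))%:R - n%:R :> R by rewrite subr_ge0 ler_nat.
  have dL : (tot (vals k))%:R - n%:R <= L%:R :> R.
    by rewrite lerBlDl -natrD ler_nat.
  have h2 : tau * ((tot (vals k))%:R - n%:R) <= `|tau| * Num.sqrt n%:R.
    apply: (@le_trans _ _ (`|tau| * ((tot (vals k))%:R - n%:R))).
      by rewrite ler_wpM2r// ler_norm.
    by rewrite ler_wpM2l// (le_trans dL).
  have h3 : N%:R * (a + u) < S := h.
  rewrite -mulrBr -mulrDr mulr_ge0//; lra.
rewrite big_split/= lerD//.
  rewrite -mulr_sumr (@sum_prod_cells R N B (fun j => pois r j * expR (psi j))).
  rewrite ler_wpM2l ?expR_ge0// lerXn2r ?nnegrE ?ZB//.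
    by apply: sumr_ge0 => j _; rewrite mulr_ge0 ?pois_ge0 ?expR_ge0.
  by apply: le_trans (ZB 0%N); rewrite big_nil.
rewrite exchange_big/=.
have -> : N%:R * T = \sum_(m < N) T by rewrite sumr_const card_ord mulr_natl.
apply: ler_sum => m _; apply: (@sum_prod_one_cell _ _ _ _ (fun j => (K < j%:R)%R%:R)) => //.
Qed.

(** Change of measure with density proportional to expR psi in the Poisson
    model. Each index i stands for an exceptional event, where c i plus the
    sum of g i is nonnegative; its tilted mass is at most expR (c i) * W i ^+
    N by the exponential Markov inequality. Off these events the total is at
    most n, the statistic exceeds y, and the density costs at most expR Y. *)
Lemma urn_prob_lower (N n : nat) (r y Y z : R) (f psi : nat -> R)
    (I : finType) (c W : I -> R) (g : I -> nat -> R) :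
  (0 < N)%N -> 0 <= r -> (forall k, f k <= f k.+1) -> 0 <= z ->
  (\forall B \near \oo, z <= \sum_(0 <= j < B) pois r j * expR (psi j)) ->
  (forall i B, \sum_(0 <= j < B) pois r j * expR (psi j + g i j) <= W i) ->
  (forall x : 'I_N -> nat, (forall i, c i + \sum_(m < N) g i (x m) < 0) ->
    [/\ (tot x <= n)%N, y < \sum_(m < N) f (x m) & \sum_(m < N) psi (x m) <= Y]) ->
  z ^+ N - \sum_i expR (c i) * W i ^+ N <=
  expR Y * urn_prob R n (fun x : 'I_N -> nat => y < \sum_(m < N) f (x m)).
Proof.
move=> N0 r0 fS z0 zB WB good.
set Q := (fun x : 'I_N -> nat => _).
have [B nB {}zB] : exists2 B, (n <= B)%N & z <= \sum_(0 <= j < B.+1) pois r j * expR (psi j).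
  case: zB => M _ MB; exists (n + M)%N; first exact: leq_addr.
  by apply: MB => /=; rewrite -addnS; lia.
rewrite /urn_prob (multinomial_uniform Q N0 nB).
pose F (x : 'I_N -> nat) : R := (Q x)%:R.
have F0 x : 0 <= F x by rewrite ler0n.
have mF : ball_monotone F.
  move=> x m; rewrite /F ler_nat /Q.
  case: ltP => [h|_] //=.
  by rewrite (lt_le_trans h (sum_cells_incr _ _ fS)).
have := urn_mean_ge_poisson N0 nB r0 mF F0.
rewrite -(ler_pM2l (expR_gt0 Y)); apply: le_trans.
rewrite mulr_sumr [leRHS]big_mkcond/=.
pose b j := pois r j * expR (psi j).
(* The indicator of the complement of the exceptional events is at least 1
   minus the sum of their exponential Markov bounds. *)
apply: (@le_trans _ _ (\sum_(k : {ffun 'I_N -> 'I_B.+1})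
   (\prod_(m < N) b (k m)) * (1 - \sum_i expR (c i + \sum_(m < N) g i (k m))))).
  have -> : \sum_(k : {ffun 'I_N -> 'I_B.+1})
   (\prod_(m < N) b (k m)) * (1 - \sum_i expR (c i + \sum_(m < N) g i (k m))) =
   (\sum_(0 <= j < B.+1) b j) ^+ N -
     \sum_i expR (c i) * (\sum_(0 <= j < B.+1) pois r j * expR (psi j + g i j)) ^+ N.
    under eq_bigr do rewrite mulrBr mulr1.
    rewrite sumrB sum_prod_cells; congr (_ - _).
    under eq_bigr do rewrite mulr_sumr.
    rewrite exchange_big/=; apply: eq_bigr => i _.
    rewrite -(sum_prod_cells N B (fun j => pois r j * expR (psi j + g i j))) mulr_sumr.
    apply: eq_bigr => k _; rewrite expRD expR_sum mulrCA -big_split/=.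
    by congr (_ * _); apply: eq_bigr => m _; rewrite /b expRD mulrA.
  apply: lerB; first by rewrite lerXn2r// nnegrE// (le_trans z0).
  apply: ler_sum => i _; rewrite ler_wpM2l ?expR_ge0// lerXn2r ?nnegrE ?WB//.
    by apply: sumr_ge0 => j _; rewrite mulr_ge0 ?pois_ge0 ?expR_ge0.
  by apply: le_trans (WB i 0%N); rewrite big_nil.
apply: ler_sum => k _.
have p0 : 0 <= \prod_(i < N) pois r (k i) by apply: prod_pois_ge0.
have rhs0 : 0 <= (if (tot (vals k) <= n)%N then
    expR Y * (\prod_(i < N) pois r (k i) * F (vals k)) else 0).
  by case: ifP => // _; rewrite mulr_ge0 ?expR_ge0// mulr_ge0.
have b0 : 0 <= \prod_(m < N) b (k m).
  by apply: prodr_ge0 => m _; rewrite mulr_ge0 ?pois_ge0 ?expR_ge0.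
have [/forallP h|] := boolP [forall i, c i + \sum_(m < N) g i (k m) < 0].
  have [h1 h2 h3] := good (vals k) h.
  rewrite h1 /F /Q h2 mulr1.
  apply: (@le_trans _ _ (\prod_(m < N) b (k m))).
    by rewrite ler_piMr// lerBlDr lerDl sumr_ge0// => i _; rewrite expR_ge0.
  by rewrite prod_pois_expR mulrC ler_wpM2r// ler_expR.
rewrite negb_forall => /existsP[i]; rewrite -leNgt => ci.
apply: le_trans rhs0; apply: mulr_ge0_le0 => //.
rewrite subr_le0 (bigD1 i)//= -[leLHS]addr0 lerD//.
  by rewrite -expR0 ler_expR.
by rewrite sumr_ge0// => j _; rewrite expR_ge0.
Qed.

End Bounds.

(** * Linear regression on the count *)


Section Residual.
Context {R : realType}.
Implicit Types (r : R) (f : nat -> R).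

(** The best affine approximation of f by the count is subtracted, because in
    the urn the total of the counts is fixed: only the residual fluctuates,
    and its variance gives the exponent. *)
Definition regr r f : R :=
  r^-1 * pmean r (fun k => (f k - pmean r f) * (k%:R - r)).
Definition resid r f k : R := f k - pmean r f - regr r f * (k%:R - r).
Definition resid_var r f : R := pmean r (fun k => resid r f k ^+ 2).

Lemma ispm_nat r : ispm r (fun k => k%:R) r.
Proof.
by apply: eq_ispm (ispmS (g := fun=> 1) (ispm1 r)) _ _ => [k|]; rewrite mulr1.
Qed.

Lemma ispm_centered r : ispm r (fun k => k%:R - r) 0.
Proof.
by apply: eq_ispm (ispmB (ispm_nat r) (ispm_cst r r)) _ _ => //; rewrite subrr.
Qed.

Lemma ispm_nat2 r : ispm r (fun k => k%:R * k%:R) (r * (r + 1)).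
Proof.
apply: ispmS; apply: eq_ispm (ispmD (ispm_nat r) (ispm1 r)) _ _ => // k.
by rewrite natr1.
Qed.

Lemma ispm_centered2 r : ispm r (fun k => (k%:R - r) ^+ 2) r.
Proof.
apply: eq_ispm (ispmD (ispmD (ispm_nat2 r) (ispmZ (- (2 * r)) (ispm_nat r)))
  (ispm_cst r (r ^+ 2))) _ _ => [k|]; ring.
Qed.

Lemma tame_centered r l : 0 <= r <= l -> tame (3 + l) (fun k => k%:R - r).
Proof.
move=> /andP[r0 rl]; apply: tame_le (tameB tame_nat (tame_cst r)).
by rewrite ger0_norm//; lra.
Qed.

Lemma tame_resid r D f : tame D f -> exists E, tame E (resid r f).
Proof.
move=> tf; eexists; rewrite /resid.
exact: tameB (tameB tf (tame_cst _)) (tameZ _ (tameB tame_nat (tame_cst r))).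
Qed.

Lemma ispm_resid r D f : 0 < r -> tame D f -> ispm r (resid r f) 0.
Proof.
move=> r0 tf; have hf := pmean_cvg (ltW r0) tf.
apply: eq_ispm (ispmB (ispmB hf (ispm_cst r (pmean r f)))
   (ispmZ (regr r f) (ispm_centered r))) _ _ => [k//|].
by rewrite mulr0 !subr0 subrr.
Qed.

Lemma ispm_resid_centered r D f : 0 < r -> tame D f ->
  ispm r (fun k => resid r f k * (k%:R - r)) 0.
Proof.
move=> r0 tf.
have tc : tame _ (fun k => (f k - pmean r f) * (k%:R - r)) :=
  tameM (tameB tf (tame_cst _)) (tameB tame_nat (tame_cst r)).
have hc := pmean_cvg (ltW r0) tc.
apply: eq_ispm (ispmB hc (ispmZ (regr r f) (ispm_centered2 r))) _ _ => [k|].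
  by rewrite /resid; ring.
by rewrite /regr; field; rewrite gt_eqF.
Qed.

Lemma ispm_resid2 r D f : 0 < r -> tame D f ->
  ispm r (fun k => resid r f k ^+ 2) (resid_var r f).
Proof.
by move=> r0 tf; have [E tE] := tame_resid r tf; apply: (pmean_cvg (ltW r0) (tameX 2 tE)).
Qed.

(** An affine function has no second difference, so the residual inherits that
    of h at 0 and cannot be small at 0, 1 and 2 at once. *)
Lemma resid_var_ge0 r D f : 0 < r -> tame D f -> 0 <= resid_var r f.
Proof.
move=> r0 tf; apply: (ispm_ge0 (ltW r0) (ispm_resid2 r0 tf)) => k.
exact: sqr_ge0.
Qed.

(** The first term tilts the statistic upwards, the second one moves the total
    below n. The two are orthogonal, so their effects on the moment generating
    function separate. *)
Definition tilt r f (alpha gamma : R) k := alpha * resid r f k - gamma * (k%:R - r).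

Lemma ispm_tilt r D f alpha gamma : 0 < r -> tame D f -> ispm r (tilt r f alpha gamma) 0.
Proof.
move=> r0 tf.
apply: eq_ispm (ispmB (ispmZ (alpha) (ispm_resid r0 tf))
   (ispmZ (gamma) (ispm_centered r))) _ _ => [k//|].
by rewrite !mulr0 subrr.
Qed.

Lemma ispm_tilt2 r D f alpha gamma : 0 < r -> tame D f ->
  ispm r (fun k => tilt r f alpha gamma k ^+ 2)
    (alpha ^+ 2 * resid_var r f + gamma ^+ 2 * r).
Proof.
move=> r0 tf.
apply: eq_ispm (ispmD (ispmD (ispmZ (alpha ^+ 2) (ispm_resid2 r0 tf))
   (ispmZ (gamma ^+ 2) (ispm_centered2 r)))
   (ispmZ (- (2 * alpha * gamma)) (ispm_resid_centered r0 tf))) _ _ => [k|].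
  by rewrite /tilt; ring.
by rewrite mulr0 addr0.
Qed.

(** The constant depends on f only through its growth D and on r only through
    its range; this uniformity allows a truncation of the function, and a
    rate, that change with n. *)
Lemma tilt_mgf (l0 l1 D : R) : 0 < l0 -> l0 <= l1 -> 1 <= D ->
  exists C : R, 1 <= C /\ forall r f, l0 <= r <= l1 -> tame D f ->
    [/\ `|regr r f| <= C, resid_var r f <= C &
      forall s alpha gamma : R, 0 <= s <= 1 -> `|alpha| <= s -> `|gamma| <= s ->
        (forall k, expR (s * `|f k|) <= D ^+ k.+1 * Num.sqrt k`!%:R) ->
      (forall n, \sum_(0 <= k < n) pois r k * expR (tilt r f alpha gamma k) <=
         expR ((alpha ^+ 2 * resid_var r f + gamma ^+ 2 * r) / 2 + s ^+ 3 * C)) /\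
      (forall e : R, 0 < e -> \forall n \near \oo,
         1 + (alpha ^+ 2 * resid_var r f + gamma ^+ 2 * r) / 2 - s ^+ 3 * C - e <=
         \sum_(0 <= k < n) pois r k * expR (tilt r f alpha gamma k))].
Proof.
move=> l00 l01 D1.
pose A := D * expR (l1 * D).
pose D2 := (D + (1 + A)) * (3 + l1).
pose T := l0^-1 * (D2 * expR (l1 * D2)).
pose E1 := D + (1 + A) + (1 + T) * (3 + l1).
pose E := E1 + (3 + l1).
pose S := E1 ^+ 2 * expR (l1 * E1 ^+ 2).
pose D' := D * expR (A + (1 + T) * (1 + l1)).
pose M := mgf_cst l1 E D'.
have D0 : 0 <= D by exact: le_trans D1.
have l10 : 0 <= l1 by exact: le_trans (ltW l00) l01.
have A0 : 0 <= A by rewrite mulr_ge0 ?expR_ge0.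
have D20 : 0 <= D2 by rewrite mulr_ge0//; lra.
have T0 : 0 <= T by rewrite mulr_ge0 ?invr_ge0 ?(ltW l00)// mulr_ge0 ?expR_ge0.
have T1 : 0 <= 1 + T by lra.
have E10 : 0 <= E1.
  by rewrite /E1 !addr_ge0 ?mulr_ge0//; lra.
have S0 : 0 <= S by rewrite mulr_ge0 ?expR_ge0 ?exprn_ge0.
have E0 : 0 <= E by rewrite /E; lra.
have E1' : 1 <= E.
  have : 0 <= (1 + T) * (3 + l1) by rewrite mulr_ge0//; lra.
  by rewrite /E /E1; lra.
have D'1 : 1 <= D'.
  rewrite /D' mulr_ege1// -[leLHS]expR0 ler_expR addr_ge0// mulr_ge0//; lra.
have D'0 : 0 <= D' by exact: le_trans D'1.
have M0 : 0 <= M.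
  have e0 : 0 <= 1 + expR (4 * (l1 * (E ^+ 3 * D')) ^+ 2).
    by rewrite addr_ge0 ?expR_ge0.
  by apply: mulr_ge0 e0; rewrite mulr_ge0 ?exprn_ge0.
exists (1 + T + S + M); split; first by lra.
move=> r f /andP[r0' r1] tf.
have r0 : 0 < r by exact: lt_le_trans r0'.
have r0w := ltW r0.
have ub d : 0 <= d -> d * expR (r * d) <= d * expR (l1 * d).
  by move=> d0; rewrite ler_wpM2l// ler_expR ler_wpM2r.
have aA : `|pmean r f| <= A.
  by apply: le_trans (ispm_norm_le r0w tf (pmean_cvg r0w tf)) (ub D D0).
have t1 : tame (D + (1 + A)) (fun k => f k - pmean r f).
  by apply: tame_le (tameB tf (tame_cst (pmean r f))); rewrite lerD2l lerD2l.
have t2 : tame (3 + l1) (fun k => k%:R - r) by apply: tame_centered; rewrite r0w.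
have t3 := tameM t1 t2.
have rT : `|regr r f| <= T.
  rewrite /regr normrM ler_pM//.
    by rewrite ger0_norm ?invr_ge0// lef_pV2// posrE.
  by apply: le_trans (ispm_norm_le r0w t3 (pmean_cvg r0w t3)) (ub D2 D20).
have t4 : tame E1 (resid r f).
  apply: tame_le (tameB t1 (tameZ (regr r f) t2)).
  by rewrite lerD2l ler_wpM2r//; lra.
have vS : resid_var r f <= S.
  have := ispm_norm_le r0w (tameX 2 t4) (ispm_resid2 r0 tf).
  move=> h; apply: le_trans (ler_norm _) (le_trans h _); apply: ub.
  by rewrite exprn_ge0.
split; [lra|lra|].
move=> s alpha gamma /andP[s0 s1] als gas dom.
pose psi := tilt r f alpha gamma.
have psiE k : `|psi k| <= s * E ^+ k.+1.
  have h1 : `|psi k| <= s * (`|resid r f k| + `|k%:R - r|).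
    rewrite /psi /tilt [leRHS]mulrDr (le_trans (ler_normB _ _))// !normrM.
    by rewrite lerD// ler_wpM2r.
  apply: le_trans h1 _; rewrite ler_wpM2l//.
  have [_ h] := tameD (tame_norm t4) (tame_norm t2).
  by apply: le_trans (h k); apply: ler_norm.
have psiD k : expR `|psi k| <= D' ^+ k.+1 * Num.sqrt k`!%:R.
  have h1 : `|psi k| <= s * `|f k| + (A + (1 + T) * (1 + l1)) * k.+1%:R.
    have k0 : 0 <= k%:R :> R by [].
    have hk : `|k%:R - r| <= k%:R + l1.
      by rewrite ler_norml; apply/andP; split; lra.
    have hr : `|resid r f k| <= `|f k| + A + T * (k%:R + l1).
      rewrite /resid (le_trans (ler_normB _ _))// lerD//.
        by rewrite (le_trans (ler_normB _ _))// lerD2l.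
      by rewrite normrM ler_pM.
    have h0 : `|psi k| <= s * (`|resid r f k| + `|k%:R - r|).
      rewrite /psi /tilt [leRHS]mulrDr (le_trans (ler_normB _ _))// !normrM.
      by rewrite lerD// ler_wpM2r.
    apply: le_trans h0 _.
    apply: (@le_trans _ _ (s * (`|f k| + A + T * (k%:R + l1) + (k%:R + l1)))).
      by rewrite ler_wpM2l// lerD.
    have -> : `|f k| + A + T * (k%:R + l1) + (k%:R + l1) =
       `|f k| + (A + (1 + T) * (k%:R + l1)) by ring.
    rewrite mulrDr lerD2l.
    have p0 : 0 <= (1 + T) * (k%:R + l1) by rewrite mulr_ge0// addr_ge0.
    apply: (@le_trans _ _ (A + (1 + T) * (k%:R + l1))).
      by rewrite ler_piMl// addr_ge0.
    rewrite [leRHS]mulrDl; apply: lerD.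
      by rewrite ler_peMr// ler1n.
    by rewrite -mulrA ler_wpM2l// -natr1; nra.
  apply: (@le_trans _ _ (expR (s * `|f k| + (A + (1 + T) * (1 + l1)) * k.+1%:R))).
    by rewrite ler_expR.
  rewrite expRD expRM_natr /D' exprMn mulrAC ler_wpM2r ?dom//.
have MM : mgf_cst r E D' <= 1 + T + S + M.
  apply: (@le_trans _ _ M); last lra.
  have e0 : 0 <= E ^+ 3 * D' by rewrite mulr_ge0 ?exprn_ge0.
  rewrite /M /mgf_cst /sqrt_fact_cst ler_wpM2l// lerD2l ler_expR ler_wpM2l//.
  by rewrite lerXn2r ?nnegrE ?mulr_ge0// ler_wpM2r.
have s30 : 0 <= s ^+ 3 by rewrite exprn_ge0.
have sMM := ler_wpM2l s30 MM.
split=> [n|e e0].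
  apply: le_trans (mgf_le r0w s0 E1' D'1 psiE psiD (ispm_tilt _ _ r0 tf) (ispm_tilt2 _ _ r0 tf) n) _.
  by rewrite ler_expR lerD2l.
have := mgf_ge r0w s0 E1' D'1 psiE psiD (ispm_tilt _ _ r0 tf) (ispm_tilt2 _ _ r0 tf) e0.
by apply: filterS => n; apply: le_trans; lra.
Qed.

Lemma expR_quad (w : R) : 0 <= w -> expR (w - w ^+ 2) <= 1 + w.
Proof.
move=> w0; have h := expR_ge1Dx (- (w - w ^+ 2)).
have : (1 - (w - w ^+ 2)) * (1 + w) <= expR (- (w - w ^+ 2)) * (1 + w).
  by rewrite ler_wpM2r//; lra.
have -> : (1 - (w - w ^+ 2)) * (1 + w) = 1 + w ^+ 3 by ring.
have w3 : 0 <= w ^+ 3 by rewrite exprn_ge0.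
rewrite expRN mulrC ler_pdivlMr ?expR_gt0//.
have := expR_gt0 (w - w ^+ 2); nra.
Qed.

End Residual.

(** * Moderate deviations for nondecreasing functions *)


Section Core.
Context {R : realType}.

Lemma sum_cells_cst (N : nat) (a : R) : \sum_(m < N) a = N%:R * a.
Proof. by rewrite sumr_const card_ord mulr_natl. Qed.

(** After tilting by t along the residual and by beta against the count, the
    sum of the residuals is near N * t * sg and the total near n - N * beta *
    r. The four exceptional events are deviations from these two values by N *
    beta * sg and N * beta * r, upwards and downwards. *)
Lemma lower_tilt (N n : nat) (l1 D s0 C r u t beta : R) (f : nat -> R) :
  let sg := resid_var r f in
  (0 < N)%N -> N%:R * r = n%:R -> 0 < r -> r <= l1 -> tame D f ->
  (forall k, f k <= f k.+1) -> 1 <= C -> 0 < s0 -> s0 <= sg -> sg <= C ->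
  `|regr r f| <= C -> 0 < beta -> beta <= t -> t <= 1 ->
  32 * t * C <= s0 ->
  (forall s alpha gamma : R, 0 <= s <= 2 * t -> `|alpha| <= s -> `|gamma| <= s ->
      (forall n, \sum_(0 <= k < n) pois r k * expR (tilt r f alpha gamma k) <=
         expR ((alpha ^+ 2 * sg + gamma ^+ 2 * r) / 2 + s ^+ 3 * C)) /\
      (forall e : R, 0 < e -> \forall n \near \oo,
         1 + (alpha ^+ 2 * sg + gamma ^+ 2 * r) / 2 - s ^+ 3 * C - e <=
         \sum_(0 <= k < n) pois r k * expR (tilt r f alpha gamma k))) ->
  u < (t - beta) * sg - 2 * C * beta * r ->
  let C1 := 16 * C + (C + l1) ^+ 2 in
  2 * (N%:R * t ^+ 3 * C1) + 7 <= N%:R * beta ^+ 2 * r / 2 ->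
  2 * (N%:R * t ^+ 3 * C1) + 7 <= N%:R * beta ^+ 2 * sg / 2 ->
  expR (- (N%:R * (t ^+ 2 * sg / 2 + beta * t * sg + 2 * beta ^+ 2 * r + t ^+ 3 * C1)) - 1)
   <= urn_prob R n (fun x : 'I_N -> nat =>
        N%:R * (pmean r f + u) < \sum_(m < N) f (x m)).
Proof.
move=> sg N0 Nr r0 rl tf fS C1_ s00 ssg sgC tauC b0 bt t1 tC mgf uu C1 M1 M2.
have NR : 0 < N%:R :> R by rewrite ltr0n.
have t0 : 0 < t by exact: lt_le_trans bt.
have sg0 : 0 < sg by exact: lt_le_trans ssg.
pose psi := tilt r f t beta.
pose v := t ^+ 2 * sg + beta ^+ 2 * r.
(* The first component separates deviations of the total from deviations of
   the residuals, the second one is the direction. *)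
pose I := (bool * bool)%type.
pose sn (b : bool) : R := if b then 1 else -1.
pose g (i : I) (k : nat) : R :=
  sn i.2 * beta * (if i.1 then k%:R - r else resid r f k).
pose c (i : I) : R :=
  if i.1 then (if i.2 then 0 else - (2 * N%:R * beta ^+ 2 * r))
  else (if i.2 then - (N%:R * beta * (t + beta) * sg)
        else N%:R * beta * (t - beta) * sg).
pose al (i : I) : R := if i.1 then t else t + sn i.2 * beta.
pose ga (i : I) : R := if i.1 then beta - sn i.2 * beta else beta.
pose W (i : I) : R := expR ((al i ^+ 2 * sg + ga i ^+ 2 * r) / 2 + (2 * t) ^+ 3 * C).
have t20 : 0 <= 2 * t <= 2 * t by lra.
have tilt_g i k : psi k + g i k = tilt r f (al i) (ga i) k.
  by case: i => -[] []; rewrite /psi /g /tilt /al /ga /sn/=; ring.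
have WB i B : \sum_(0 <= j < B) pois r j * expR (psi j + g i j) <= W i.
  under eq_bigr do rewrite tilt_g.
  have [] := mgf (2 * t) (al i) (ga i) t20 _ _ => //.
    by rewrite ler_norml /al /sn; case: i => -[] [] /=; apply/andP;
     clear -b0 bt t0; split; lra.
  by rewrite ler_norml /ga /sn; case: i => -[] [] /=; apply/andP;
     clear -b0 bt t0; split; lra.
pose w := v / 2 - 2 * ((2 * t) ^+ 3 * C).
have r1 : 0 <= beta ^+ 2 * r by rewrite mulr_ge0 ?sqr_ge0// ltW.
have bt2 : beta ^+ 2 <= t ^+ 2 by rewrite lerXn2r ?nnegrE// ltW.
have t2_0 : 0 <= t ^+ 2 by rewrite sqr_ge0.
have w0 : 0 <= w.
  have h : t ^+ 2 * (32 * t * C) <= t ^+ 2 * s0 by rewrite ler_wpM2l.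
  have h2 : t ^+ 2 * s0 <= t ^+ 2 * sg by rewrite ler_wpM2l.
  have -> : w = (t ^+ 2 * sg + beta ^+ 2 * r - t ^+ 2 * (32 * t * C)) / 2.
    by rewrite /w /v; field.
  by rewrite divr_ge0//; clear -h h2 r1; lra.
have zB : \forall B \near \oo, 1 + w <= \sum_(0 <= j < B) pois r j * expR (psi j).
  have h1 : `|t| <= 2 * t by rewrite ger0_norm; clear -t0; lra.
  have h2 : `|beta| <= 2 * t by rewrite ger0_norm; clear -t0 b0 bt; lra.
  have [_ H] := mgf (2 * t) t beta t20 h1 h2.
  have e0 : 0 < (2 * t) ^+ 3 * C.
    by rewrite mulr_gt0 ?exprn_gt0//; clear -t0 C1_; lra.
  apply: filterS (H _ e0) => B; apply: le_trans.
  by rewrite /w /v le_eqVlt; apply/orP; left; apply/eqP; ring.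
pose Y := N%:R * (t * (t + beta) * sg + 2 * beta ^+ 2 * r).
have good : forall x : 'I_N -> nat, (forall i, c i + \sum_(m < N) g i (x m) < 0) ->
    [/\ (tot x <= n)%N, N%:R * (pmean r f + u) < \sum_(m < N) f (x m) &
      \sum_(m < N) psi (x m) <= Y].
  move=> x H.
  pose d := (tot x)%:R - n%:R :> R.
  pose S := \sum_(m < N) resid r f (x m).
  have sd : \sum_(m < N) ((x m)%:R - r) = d by rewrite tot_real Nr.
  have g1 b : \sum_(m < N) g (true, b) (x m) = sn b * beta * d.
    by rewrite /g/= -mulr_sumr sd.
  have g2 b : \sum_(m < N) g (false, b) (x m) = sn b * beta * S.
    by rewrite /g/= -mulr_sumr.
  have d0 : d < 0.
    by have := H (true, true); rewrite g1 /c/sn/= add0r mul1r pmulr_rlt0.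
  have d1 : - (2 * N%:R * beta * r) < d.
    have := H (true, false); rewrite g1 /c/sn/=.
    have -> : - (2 * N%:R * beta ^+ 2 * r) + -1 * beta * d =
      beta * (- (2 * N%:R * beta * r) - d) by ring.
    by rewrite pmulr_rlt0// subr_lt0.
  have S1 : S < N%:R * (t + beta) * sg.
    have := H (false, true); rewrite g2 /c/sn/=.
    have -> : - (N%:R * beta * (t + beta) * sg) + 1 * beta * S =
      beta * (S - N%:R * (t + beta) * sg) by ring.
    by rewrite pmulr_rlt0// subr_lt0.
  have S2 : N%:R * (t - beta) * sg < S.
    have := H (false, false); rewrite g2 /c/sn/=.
    have -> : N%:R * beta * (t - beta) * sg + -1 * beta * S =
      beta * (N%:R * (t - beta) * sg - S) by ring.
    by rewrite pmulr_rlt0// subr_lt0.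
  split.
  - by move: d0; rewrite subr_lt0 ltr_nat => /ltnW.
  - have -> : \sum_(m < N) f (x m) = N%:R * pmean r f + S + regr r f * d.
      rewrite -sd mulr_sumr -sum_cells_cst /S -!big_split/=.
      by apply: eq_bigr => m _; rewrite /resid; ring.
    have h1 : - (C * (2 * N%:R * beta * r)) <= regr r f * d.
      rewrite lerNl -mulrN.
      apply: (@le_trans _ _ (`|regr r f| * (- d))).
        by rewrite ler_wpM2r ?ler_norm// oppr_ge0 ltW.
      by apply: ler_pM => //; rewrite ?oppr_ge0; clear -d0 d1; lra.
    rewrite mulrDr -!addrA ltrD2l.
    have h2 : N%:R * u < N%:R * ((t - beta) * sg - 2 * C * beta * r).
      by rewrite ltr_pM2l.
    have h3 : N%:R * ((t - beta) * sg - 2 * C * beta * r) =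
      N%:R * (t - beta) * sg - C * (2 * N%:R * beta * r) by ring.
    by clear -h1 h2 h3 S2; lra.
  - have -> : \sum_(m < N) psi (x m) = t * S - beta * d.
      by rewrite -sd /S !mulr_sumr -sumrB; apply: eq_bigr => m _.
    have h1 : t * S <= t * (N%:R * (t + beta) * sg) by rewrite ler_pM2l// ltW.
    have h2 : beta * (- (2 * N%:R * beta * r)) <= beta * d by rewrite ler_pM2l// ltW.
    have -> : Y = t * (N%:R * (t + beta) * sg) - beta * (- (2 * N%:R * beta * r)).
      by rewrite /Y; ring.
    by clear -h1 h2; lra.
have z0 : 0 <= 1 + w by clear -w0; lra.
have := urn_prob_lower N0 (ltW r0) fS z0 zB WB good.
set P := urn_prob _ _ _.
pose X := N%:R * (t ^+ 2 * sg / 2).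
pose m1 := N%:R * beta ^+ 2 * r / 2.
pose m2 := N%:R * beta ^+ 2 * sg / 2.
pose e := N%:R * t ^+ 3 * C1.
rewrite -/m1 -/e in M1; rewrite -/m2 -/e in M2.
have e8 : N%:R * ((2 * t) ^+ 3 * C) <= e.
  have -> : N%:R * ((2 * t) ^+ 3 * C) = N%:R * t ^+ 3 * (8 * C) by ring.
  have t3 : 0 <= N%:R * t ^+ 3 by rewrite mulr_ge0// exprn_ge0// ltW.
  rewrite /e ler_wpM2l//.
  by rewrite /C1; have := sqr_ge0 (C + l1); clear -C1_; lra.
have cW i : expR (c i) * W i ^+ N <=
   if i.1 then expR (X + e) else expR (X + m1 - m2 + e).
  rewrite /W -expRM_natl -expRD.
  have E : forall a b : R, a + N%:R * (b + (2 * t) ^+ 3 * C) =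
     a + N%:R * b + N%:R * ((2 * t) ^+ 3 * C) by move=> a b; ring.
  rewrite E; case: i => -[] b /=; rewrite ler_expR lerD//.
    rewrite le_eqVlt; apply/orP; left; apply/eqP.
    by case: b; rewrite /c /al /ga /sn /X /=; field.
  rewrite le_eqVlt; apply/orP; left; apply/eqP.
  by case: b; rewrite /c /al /ga /sn /X /m1 /m2 /=; field.
have sumW : \sum_i expR (c i) * W i ^+ N <= 2 * expR (X + e) + 2 * expR (X + m1 - m2 + e).
  apply: le_trans (ler_sum _ (fun i _ => cW i)) _.
  rewrite -(pair_bigA _ (fun (a b : bool) => if a then expR (X + e) else expR (X + m1 - m2 + e)))/=.
  by rewrite !big_bool/=; clear; lra.
have zN : expR (X + m1 - e) <= (1 + w) ^+ N.
  apply: (@le_trans _ _ (expR (w - w ^+ 2) ^+ N)); last first.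
    by rewrite lerXn2r ?nnegrE ?expR_ge0// expR_quad.
  rewrite -expRM_natl ler_expR.
  have -> : X + m1 - e = N%:R * (v / 2 - t ^+ 3 * C1) by rewrite /X /m1 /e /v; field.
  rewrite ler_pM2l//.
  have wv : w <= v / 2.
    rewrite /w lerBlDr lerDl mulr_ge0// mulr_ge0 ?exprn_ge0//; clear -t0 C1_; lra.
  have vb : v / 2 <= t ^+ 2 * (C + l1).
    have h1 : t ^+ 2 * sg <= t ^+ 2 * C by rewrite ler_wpM2l.
    have h2 : beta ^+ 2 * r <= t ^+ 2 * l1 by rewrite ler_pM ?sqr_ge0// ltW.
    have h3 : 0 <= t ^+ 2 * sg by rewrite mulr_ge0// ltW.
    by rewrite /v mulrDr; clear -h1 h2 h3 r1; lra.
  have w2 : w ^+ 2 <= t ^+ 3 * (C + l1) ^+ 2.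
    apply: (@le_trans _ _ ((t ^+ 2 * (C + l1)) ^+ 2)).
      rewrite lerXn2r ?nnegrE//; last by clear -wv vb; lra.
      by apply: mulr_ge0 => //; clear -C1_ r0 rl; lra.
    rewrite exprMn -exprM ler_wpM2r ?sqr_ge0//.
    by rewrite ler_wiXn2l// ltW.
  have -> : t ^+ 3 * C1 = 2 * ((2 * t) ^+ 3 * C) + t ^+ 3 * (C + l1) ^+ 2.
    by rewrite /C1; ring.
  have E2 : w = v / 2 - 2 * ((2 * t) ^+ 3 * C) by [].
  by rewrite [X in _ <= X - _]E2; clear -w2; lra.
move=> H.
have key : expR (X + m1 - e) / 2 <= expR Y * P.
  apply: le_trans H.
  have q1 : expR (X + e) <= expR (X + m1 - e) / 8.
    have -> : X + e = (X + m1 - e) - (m1 - 2 * e) by ring.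
    rewrite [in leLHS]expRD ler_wpM2l ?expR_ge0// expRN lef_pV2 ?posrE ?expR_gt0//.
    by apply: le_trans (expR_ge1Dx _); clear -M1; lra.
  have q2 : expR (X + m1 - m2 + e) <= expR (X + m1 - e) / 8.
    have -> : X + m1 - m2 + e = (X + m1 - e) - (m2 - 2 * e) by ring.
    rewrite [in leLHS]expRD ler_wpM2l ?expR_ge0// expRN lef_pV2 ?posrE ?expR_gt0//.
    by apply: le_trans (expR_ge1Dx _); clear -M2; lra.
  by clear -q1 q2 zN sumW; lra.
rewrite -(ler_pM2l (expR_gt0 Y)); apply: le_trans key.
rewrite -expRD.
apply: (@le_trans _ _ (expR (X + m1 - e - 1))).
  rewrite ler_expR.
  have -> : Y + (- (N%:R * (t ^+ 2 * sg / 2 + beta * t * sg + 2 * beta ^+ 2 * r +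
     t ^+ 3 * C1)) - 1) = X - e - 1 by rewrite /Y /X /e; field.
  have : 0 <= m1.
    rewrite /m1 -(mulrA N%:R); apply: divr_ge0 => //.
    by apply: mulr_ge0 => //; apply: ltW.
  by clear; lra.
rewrite [leLHS]expRD ler_wpM2l ?expR_ge0// expRN lef_pV2 ?posrE ?expR_gt0//.
by apply: le_trans (expR_ge1Dx _); clear; lra.
Qed.


(** With beta = d * t and a tilt that overshoots the target u by the factor 1
    + 2 x, the cost of the tilt is the Gaussian exponent up to a relative
    error of order x + d. *)
Lemma lower_exponent (N t u sg d r C1 del rho x : R) :
  0 < N -> 0 < t -> 0 < sg -> 0 < d -> 0 < rho -> d * r <= rho * sg ->
  0 < x -> x <= 4^-1 -> t * sg = (1 + 2 * x) * u ->
  2 * (t * C1) <= d * sg -> 2 * sg <= d * (N * u ^+ 2) ->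
  5 * x + 3 * ((3 + 4 * rho) * d) + d <= del ->
  N * (t ^+ 2 * sg / 2 + d * t * t * sg + 2 * (d * t) ^+ 2 * r + t ^+ 3 * C1) + 1
  <= (1 + del) * (N * u ^+ 2 / (2 * sg)).
Proof.
move=> N0 t0 sg0 d0 rho0 dr x0 x4 tsg tC1 Nu hdel.
have sg2 : 0 < 2 * sg by lra.
pose p := N * u ^+ 2 / (2 * sg).
have dp : 1 <= d * p.
  have -> : d * p = d * (N * u ^+ 2) / (2 * sg) by rewrite /p mulrA.
  by rewrite (ler_pdivlMr _ _ sg2) mul1r.
have p0 : 0 < p by rewrite -(pmulr_rgt0 _ d0); exact: lt_le_trans dp.
have Nt : 0 < N * t ^+ 2 by apply: mulr_gt0 => //; apply: exprn_gt0.
have qs : N * t ^+ 2 * (sg / 2) = (1 + 2 * x) ^+ 2 * p.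
  have -> : (1 + 2 * x) ^+ 2 * p = N * ((1 + 2 * x) * u) ^+ 2 / (2 * sg) by rewrite /p; ring.
  by rewrite -tsg; field; rewrite gt_eqF.
have h1 : t ^+ 2 * sg / 2 + d * t * t * sg + 2 * (d * t) ^+ 2 * r + t ^+ 3 * C1 <=
   t ^+ 2 * (sg / 2 * (1 + (3 + 4 * rho) * d)).
  have -> : t ^+ 2 * sg / 2 + d * t * t * sg + 2 * (d * t) ^+ 2 * r + t ^+ 3 * C1 =
    t ^+ 2 * (sg / 2 + d * sg + 2 * (d * (d * r)) + t * C1) by field.
  rewrite ler_pM2l ?exprn_gt0//.
  have a2 : d * (d * r) <= d * (rho * sg) by rewrite ler_pM2l.
  have -> : sg / 2 * (1 + (3 + 4 * rho) * d) =
    sg / 2 + 3 * (d * sg) / 2 + 2 * (d * (rho * sg)) by field.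
  lra.
have h2 := ler_wpM2l (ltW N0) h1.
pose y := (3 + 4 * rho) * d.
have y0 : 0 < y by rewrite mulr_gt0//; lra.
apply: (@le_trans _ _ (((1 + 2 * x) ^+ 2 * (1 + y) + d) * p)).
  have -> : ((1 + 2 * x) ^+ 2 * (1 + y) + d) * p =
    N * (t ^+ 2 * (sg / 2 * (1 + (3 + 4 * rho) * d))) + d * p.
    have -> : ((1 + 2 * x) ^+ 2 * (1 + y) + d) * p = ((1 + 2 * x) ^+ 2 * p) * (1 + y) + d * p.
      by ring.
    by rewrite -qs /y; ring.
  exact: lerD.
rewrite -/p (ler_pM2r p0); apply: (@le_trans _ _ (1 + (5 * x + 3 * y + d))).
  rewrite addrA lerD2r.
  have x2 : x ^+ 2 <= x / 4 by rewrite expr2; nra.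
  have : (1 + 2 * x) ^+ 2 <= 1 + 5 * x.
    have -> : (1 + 2 * x) ^+ 2 = 1 + 4 * x + 4 * x ^+ 2 by ring.
    lra.
  move=> h; have y1 : 0 <= 1 + y by lra.
  have h3 := ler_wpM2r y1 h.
  apply: le_trans h3 _.
  have : x * y <= 4^-1 * y by rewrite ler_pM2r.
  nra.
by rewrite lerD2l.
Qed.

(** The ratio d of beta to t is a small constant; t exceeds u / sg by a factor
    1 + 2 G d, just enough for the tilted statistic to stay above u in spite
    of its fluctuation. *)
Lemma core_lower (l0 l1 D s0 del : R) :
  0 < l0 -> l0 <= l1 -> 1 <= D -> 0 < s0 -> 0 < del ->
  exists M : R, 1 <= M /\ forall (N n : nat) (r u : R) (f : nat -> R),
    (0 < N)%N -> N%:R * r = n%:R -> l0 <= r <= l1 -> tame D f ->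
    (forall k, f k <= f k.+1) -> s0 <= resid_var r f ->
    0 < u -> u * M <= 1 -> M <= N%:R * u ^+ 2 ->
    (forall k, expR (4 / s0 * u * `|f k|) <= D ^+ k.+1 * Num.sqrt k`!%:R) ->
    expR (- ((1 + del) * (N%:R * u ^+ 2 / (2 * resid_var r f)))) <=
    urn_prob R n (fun x : 'I_N -> nat =>
        N%:R * (pmean r f + u) < \sum_(m < N) f (x m)).
Proof.
move=> l00 l01 D1 s00 del0.
have [C [C_1 HC]] := tilt_mgf l00 l01 D1.
pose C1 := 16 * C + (C + l1) ^+ 2.
(* G * d is the relative overshoot of the tilt: d makes up for the downward
   fluctuation of the residuals, 2 * C * rho * d for the regression term of the
   lowered total. H * d is the resulting relative error of the exponent. *)
pose rho := l1 / s0.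
pose G := 1 + 2 * C * rho.
pose H := 5 * G + 3 * (3 + 4 * rho) + 1.
pose d := (4 * G + H / del)^-1.
pose m0 := Num.min l0 s0.
have l10 : 0 < l1 by exact: lt_le_trans l01.
have rho0 : 0 < rho by rewrite divr_gt0.
have C0 : 0 < C by exact: lt_le_trans C_1.
have G1 : 1 <= G.
  by rewrite /G lerDl; apply: mulr_ge0; [lra|exact: ltW].
have H0 : 0 < H by rewrite /H; lra.
have Hd0 : 0 < H / del by rewrite divr_gt0.
have dinv : 0 < 4 * G + H / del by lra.
have d0 : 0 < d by rewrite invr_gt0.
have dG : G * d <= 4^-1.
  by rewrite /d ler_pdivrMr//; lra.
have dH : H * d <= del.
  rewrite /d ler_pdivrMr//.
  have -> : del * (4 * G + H / del) = del * (4 * G) + H by field; rewrite gt_eqF.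
  by rewrite lerDr mulr_ge0//; lra.
have d1 : d <= 4^-1 by apply: le_trans dG; rewrite ler_peMl// ltW.
have m00 : 0 < m0 by rewrite /m0 lt_min l00.
have m0l : m0 <= l0 by rewrite /m0 ge_min lexx.
have m0s : m0 <= s0 by rewrite /m0 ge_min lexx orbT.
have C10 : 0 < C1 by rewrite /C1; have := sqr_ge0 (C + l1); lra.
have rs : rho * s0 = l1 by rewrite /rho divfK// gt_eqF.
pose c2 := 32 * C / s0.
pose c3 := 8 * C1 / (d ^+ 2 * m0).
pose c4 := 2 * C1 / (d * s0).
pose c5 := 28 * C ^+ 2 / (d ^+ 2 * m0).
pose c6 := 2 * C / d.
have dm0 : 0 < d ^+ 2 * m0 by rewrite mulr_gt0// exprn_gt0.
have ds0 : 0 < d * s0 by rewrite mulr_gt0.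
have c20 : 0 < c2 by rewrite divr_gt0// mulr_gt0.
have c30 : 0 < c3 by rewrite divr_gt0// mulr_gt0.
have c40 : 0 < c4 by rewrite divr_gt0// mulr_gt0.
have c50 : 0 < c5 by rewrite divr_gt0// mulr_gt0// exprn_gt0.
have c60 : 0 < c6 by rewrite divr_gt0// mulr_gt0.
pose c7 := (2 + c2 + c3 + c4) * (2 / s0).
have c70 : 0 < c7 by rewrite mulr_gt0 ?divr_gt0//; clear -c20 c30 c40; lra.
exists (1 + c7 + c5 + c6); split; first by clear -c70 c50 c60; lra.
move=> N n r u f N0 Nr /andP[r0' rl] tf fS ssg u0 uM Mu dom.
have [tauC sgC HC'] := HC r f (introT andP (conj r0' rl)) tf.
set sg := resid_var r f in ssg sgC HC' *.
have r0 : 0 < r by exact: lt_le_trans r0'.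
have NR : 0 < N%:R :> R by rewrite ltr0n.
have sg0 : 0 < sg by exact: lt_le_trans ssg.
pose th := 1 + 2 * (G * d).
have Gd0 : 0 < G * d by rewrite mulr_gt0//; clear -G1; lra.
have th1 : 1 <= th by rewrite /th; clear -Gd0; lra.
have th2 : th <= 2 by rewrite /th; clear -dG; lra.
have [t tsg] : exists t, t * sg = th * u.
  by exists (th * u / sg); rewrite divfK// gt_eqF.
have t0 : 0 < t by rewrite -(pmulr_lgt0 _ sg0) tsg mulr_gt0//; clear -th1; lra.
have tc c : 0 < c -> c <= 2 + c2 + c3 + c4 -> t * c <= 1.
  move=> cp cle; apply: le_trans uM.
  apply: (@le_trans _ _ (u * ((2 + c2 + c3 + c4) * (2 / s0)))); last first.
    by rewrite ler_pM2l// -/c7; clear -c50 c60; lra.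
  have -> : u * ((2 + c2 + c3 + c4) * (2 / s0)) = (2 * u / s0) * (2 + c2 + c3 + c4).
    by ring.
  rewrite ler_pM ?(ltW t0) ?(ltW cp)// ler_pdivlMr//.
  apply: (@le_trans _ _ (t * sg)); first by rewrite ler_pM2l.
  by rewrite tsg ler_pM2r.
have t2 : t * 2 <= 1 by apply: tc => //; clear -c20 c30 c40; lra.
have t_2 : t * c2 <= 1 by apply: tc => //; clear -c20 c30 c40; lra.
have t_3 : t * c3 <= 1 by apply: tc => //; clear -c20 c30 c40; lra.
have t_4 : t * c4 <= 1 by apply: tc => //; clear -c20 c30 c40; lra.
have tC : 32 * t * C <= s0.
  move: t_2; rewrite /c2 mulrA ler_pdivrMr// mul1r; clear; lra.
have tC3 : 8 * (t * C1) <= d ^+ 2 * m0.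
  move: t_3; rewrite /c3 mulrA ler_pdivrMr// mul1r; clear; lra.
have tC4 : 2 * (t * C1) <= d * s0.
  move: t_4; rewrite /c4 mulrA ler_pdivrMr// mul1r; clear; lra.
pose beta := d * t.
have b0 : 0 < beta by rewrite mulr_gt0.
have bt : beta <= t by rewrite /beta ger_pMl//; clear -d1; lra.
have s2 : 4 / s0 * u >= 2 * t.
  have -> : 4 / s0 * u = 2 * (2 * u / s0) by ring.
  rewrite ler_pM2l// ler_pdivlMr//.
  apply: (@le_trans _ _ (t * sg)); first by rewrite ler_pM2l.
  by rewrite tsg ler_pM2r.
have mgf s alpha gamma : 0 <= s <= 2 * t -> `|alpha| <= s -> `|gamma| <= s ->
      (forall n, \sum_(0 <= k < n) pois r k * expR (tilt r f alpha gamma k) <=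
         expR ((alpha ^+ 2 * sg + gamma ^+ 2 * r) / 2 + s ^+ 3 * C)) /\
      (forall e : R, 0 < e -> \forall n \near \oo,
         1 + (alpha ^+ 2 * sg + gamma ^+ 2 * r) / 2 - s ^+ 3 * C - e <=
         \sum_(0 <= k < n) pois r k * expR (tilt r f alpha gamma k)).
  move=> /andP[s_0 s_t] als gas; apply: HC' => //.
    by rewrite s_0/=; clear -s_t t2; lra.
  move=> k; apply: le_trans (dom k); rewrite ler_expR ler_wpM2r//.
  exact: le_trans s_t s2.
have t1 : t <= 1 by clear -t2 t0; lra.
have uu : u < (t - beta) * sg - 2 * C * beta * r.
  have h1 : C * (d * t) * r <= C * rho * d * (t * sg).
    have -> : C * (d * t) * r = C * d * t * r by ring.
    have -> : C * rho * d * (t * sg) = C * d * t * (rho * sg) by ring.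
    rewrite ler_pM2l ?mulr_gt0//; apply: le_trans rl _.
    by rewrite -rs ler_pM2l.
  have -> : (t - beta) * sg - 2 * C * beta * r =
     t * sg * (1 - d) - 2 * (C * (d * t) * r) by rewrite /beta; ring.
  apply: (@lt_le_trans _ _ (t * sg * (1 - G * d))); last first.
    have -> : t * sg * (1 - G * d) = t * sg * (1 - d) - 2 * (C * rho * d * (t * sg)).
      by rewrite /G; ring.
    by clear -h1; lra.
  rewrite tsg mulrAC ltr_pMl//.
  by rewrite /th; move: (G * d) Gd0 dG => x x0 x4; clear -x0 x4; nra.
have Nt2 : 28 <= N%:R * t ^+ 2 * (d ^+ 2 * m0).
  have h1 : u <= t * C.
    apply: (@le_trans _ _ (t * sg)); last by rewrite ler_pM2l.
    by rewrite tsg ler_peMl// ltW.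
  have h2 : u ^+ 2 <= t ^+ 2 * C ^+ 2.
    by rewrite -exprMn lerXn2r ?nnegrE ?(ltW u0)// mulr_ge0// ltW.
  have h3 : c5 <= N%:R * (t ^+ 2 * C ^+ 2).
    apply: (@le_trans _ _ (N%:R * u ^+ 2)); last by rewrite ler_pM2l.
    by apply: le_trans Mu; clear -c60 c70; lra.
  move: h3; rewrite /c5 ler_pdivrMr//.
  have -> : N%:R * (t ^+ 2 * C ^+ 2) * (d ^+ 2 * m0) =
     N%:R * t ^+ 2 * (d ^+ 2 * m0) * C ^+ 2 by ring.
  by rewrite ler_pM2r// exprn_gt0.
have Nt0 : 0 < N%:R * t ^+ 2 by rewrite mulr_gt0// exprn_gt0.
have MM q : m0 <= q -> 2 * (N%:R * t ^+ 3 * C1) + 7 <= N%:R * beta ^+ 2 * q / 2.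
  move=> mq.
  have h1 : N%:R * t ^+ 2 * (8 * (t * C1)) <= N%:R * t ^+ 2 * (d ^+ 2 * m0).
    by rewrite ler_pM2l.
  have h2 : N%:R * t ^+ 2 * (d ^+ 2 * m0) <= N%:R * t ^+ 2 * (d ^+ 2 * q).
    by rewrite ler_pM2l// ler_pM2l// exprn_gt0.
  have -> : N%:R * beta ^+ 2 * q / 2 = N%:R * t ^+ 2 * (d ^+ 2 * q) / 2.
    by rewrite /beta; field.
  have -> : 2 * (N%:R * t ^+ 3 * C1) = N%:R * t ^+ 2 * (8 * (t * C1)) / 4.
    by field.
  by clear -h1 h2 Nt2; lra.
have := lower_tilt N0 Nr r0 rl tf fS C_1 s00 ssg sgC tauC b0 bt t1 tC mgf uu
  (MM r (le_trans m0l r0')) (MM sg (le_trans m0s ssg)).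
apply: le_trans; rewrite ler_expR -/C1 -/sg lerNl opprB opprK addrC.
apply: (lower_exponent (x := G * d) (rho := rho) NR t0 sg0 d0 rho0 _ Gd0 dG tsg).
- apply: (@le_trans _ _ r); first by rewrite ger_pMl//; clear -d1; lra.
  by apply: le_trans rl _; rewrite -rs ler_pM2l.
- by apply: le_trans tC4 _; rewrite ler_pM2l.
- have h : c6 <= N%:R * u ^+ 2 by apply: le_trans Mu; clear -c50 c70; lra.
  move: h; rewrite /c6 (ler_pdivrMr _ _ d0) (mulrC _ d) => h.
  by apply: le_trans h; clear -sgC; lra.
- apply: le_trans dH; rewrite le_eqVlt; apply/orP; left; apply/eqP.
  by rewrite /H; ring.
Qed.

(** The choice t = u / sg optimizes Chernoff's bound. The error terms are of
    relative order u and 1 / (sqrt N * u), the latter from the sqrt n slack in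
    the total. *)
Lemma core_upper (l0 l1 D s0 del : R) :
  0 < l0 -> l0 <= l1 -> 1 <= D -> 0 < s0 -> 0 < del ->
  exists M : R, 1 <= M /\ forall (N n : nat) (r u K : R) (f : nat -> R),
    (0 < N)%N -> (0 < n)%N -> N%:R * r = n%:R -> l0 <= r <= l1 -> tame D f ->
    (forall k, f k <= f k.+1) -> s0 <= resid_var r f ->
    0 < u -> u * M <= 1 -> M <= N%:R * u ^+ 2 ->
    (forall k, expR (4 / s0 * u * `|f k|) <= D ^+ k.+1 * Num.sqrt k`!%:R) ->
    urn_prob R n (fun x : 'I_N -> nat =>
        (N%:R * (pmean r f + u) < \sum_(m < N) f (x m)) ||
        [exists m, K < (x m)%:R]) <=
    expR (- ((1 - del) * (N%:R * u ^+ 2 / (2 * resid_var r f)))) +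
    N%:R * (expR (- K) * M).
Proof.
move=> l00 l01 D1 s00 del0.
have [C [C_1 HC]] := tilt_mgf l00 l01 D1.
have C0 : 0 < C by exact: lt_le_trans C_1.
have l10 : 0 < l1 by exact: lt_le_trans l01.
pose e1 := expR (1 : R).
pose c1 := s0^-1.
pose c2 := 6 * C / (del * s0 ^+ 2).
pose c3 := (6 * C / del) ^+ 2 * l1.
pose c4 := 12 * C / del.
pose c5 := expR 2 * (1 * e1 * expR (l1 * (1 * e1))).
have c10 : 0 < c1 by rewrite invr_gt0.
have c20 : 0 < c2 by rewrite divr_gt0 ?mulr_gt0 ?exprn_gt0//.
have c30 : 0 < c3 by rewrite mulr_gt0 ?exprn_gt0 ?divr_gt0 ?mulr_gt0.
have c40 : 0 < c4 by rewrite divr_gt0 ?mulr_gt0.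
have c50 : 0 < c5 by rewrite !mulr_gt0 ?expR_gt0.
exists (1 + c1 + c2 + c3 + c4 + c5); split; first lra.
move=> N n r u K f N0 n0 Nr /andP[r0' rl] tf fS ssg u0 uM Mu dom.
have [tauC sgC HC'] := HC r f (introT andP (conj r0' rl)) tf.
set sg := resid_var r f in ssg sgC HC' *.
have r0 : 0 < r by exact: lt_le_trans r0'.
have r0w := ltW r0.
have NR : 0 < N%:R :> R by rewrite ltr0n.
have sg0 : 0 < sg by exact: lt_le_trans ssg.
pose t := u / sg.
have tsg : t * sg = u by rewrite /t divfK// gt_eqF.
have t0 : 0 < t by rewrite divr_gt0.
have uc c : 0 < c -> c <= 1 + c1 + c2 + c3 + c4 + c5 -> u * c <= 1.
  by move=> cp cle; apply: le_trans uM; rewrite ler_pM2l.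
have u1 : u * c1 <= 1 by apply: uc => //; clear -c20 c30 c40 c50; lra.
have u2 : u * c2 <= 1 by apply: uc => //; clear -c10 c30 c40 c50; lra.
have tu : t <= u / s0 by rewrite /t ler_pM2l// lef_pV2.
have t1 : t <= 1 by apply: le_trans tu u1.
have [ZB _] : (forall n, \sum_(0 <= k < n) pois r k * expR (tilt r f t 0 k) <=
         expR ((t ^+ 2 * sg + 0 ^+ 2 * r) / 2 + t ^+ 3 * C)) /\
      (forall e : R, 0 < e -> \forall n \near \oo,
         1 + (t ^+ 2 * sg + 0 ^+ 2 * r) / 2 - t ^+ 3 * C - e <=
         \sum_(0 <= k < n) pois r k * expR (tilt r f t 0 k)).
  apply: HC'; [by rewrite (ltW t0)|by rewrite gtr0_norm|by rewrite normr0 ltW|].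
  move=> k; apply: le_trans (dom k); rewrite ler_expR ler_wpM2r//.
  apply: le_trans tu _.
  have : 0 < u / s0 by rewrite divr_gt0.
  by rewrite -mulrA (mulrC _ u); clear; lra.
set E := expR _ in ZB.
have ZB' B : \sum_(0 <= j < B) pois r j *
    expR (t * (f j - pmean r f - regr r f * (j%:R - r))) <= E.
  apply: le_trans (ZB B); rewrite le_eqVlt; apply/orP; left; apply/eqP.
  by apply: eq_bigr => j _; rewrite /tilt /resid mul0r subr0.
pose T := expR (- K) * (1 * e1 * expR (l1 * (1 * e1))).
have TB B : \sum_(0 <= j < B) pois r j * (K < j%:R)%R%:R <= T.
  pose g (j : nat) : R := (K < j%:R)%R%:R.
  have tg : tame 1 g.
    by split=> // k; rewrite expr1n /g; case: (K < _)%R; rewrite ?normr1 ?normr0.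
  have hg := pmean_cvg r0w tg.
  have g0 j : 0 <= g j by rewrite /g.
  apply: le_trans (ispm_psum_le B r0w hg g0) _.
  have := ispm_tail r0w tg hg (_ : forall k, k%:R <= K -> g k = 0).
  move=> h; apply: le_trans (ler_norm _) _; apply: le_trans (h _) _.
    by move=> k kK; rewrite /g ltNge kK.
  rewrite /T ler_pM2l ?expR_gt0// ler_pM2l ?mulr_gt0 ?expR_gt0//.
  by rewrite ler_expR ler_pM2r// mulr_gt0 ?expR_gt0.
have := urn_prob_upper u N0 n0 Nr (ltW t0) fS ZB' TB.
set P := urn_prob _ _ _ => HH.
have : P <= expR 2 * (expR (t * (`|regr r f| * Num.sqrt n%:R) - t * (N%:R * u)) * E ^+ N
   + N%:R * T).
  rewrite -(ler_pM2l (expR_gt0 (- 2))) [leRHS]mulrA -expRD addNr expR0 mul1r.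
  exact: HH.
move=> h; apply: le_trans h _; rewrite mulrDr; apply: lerD.
  rewrite /E -expRM_natl -!expRD ler_expR.
  pose p := N%:R * u ^+ 2 / (2 * sg).
  rewrite -/p expr0n/= mul0r addr0.
  have p0 : 0 < p by rewrite divr_gt0 ?mulr_gt0 ?exprn_gt0.
  have ep : t * (N%:R * u) = 2 * p by rewrite /p /t; field; rewrite gt_eqF.
  have eq2 : N%:R * (t ^+ 2 * sg / 2) = p by rewrite /p /t; field; rewrite gt_eqF.
  have b1 : 2 <= del / 3 * p.
    have h : c4 <= N%:R * u ^+ 2 by apply: le_trans Mu; clear -c10 c20 c30 c50; lra.
    rewrite /p mulrA ler_pdivlMr ?mulr_gt0//.
    move: h; rewrite /c4 ler_pdivrMr// => h.
    by clear -h sgC; lra.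
  have b2 : N%:R * (t ^+ 3 * C) <= del / 3 * p.
    rewrite -eq2.
    have -> : N%:R * (t ^+ 3 * C) = (N%:R * t ^+ 2) * (t * C) by ring.
    have -> : del / 3 * (N%:R * (t ^+ 2 * sg / 2)) = (N%:R * t ^+ 2) * (del * sg / 6).
      by field.
    have Nt : 0 < N%:R * t ^+ 2 by apply: mulr_gt0 => //; apply: exprn_gt0.
    rewrite (ler_pM2l Nt).
    apply: (@le_trans _ _ (del * s0 / 6)); last first.
      by rewrite ler_pM2r// ler_pM2l.
    apply: (@le_trans _ _ (u / s0 * C)); first by rewrite ler_pM2r.
    move: u2; rewrite /c2 mulrA ler_pdivrMr ?mulr_gt0 ?exprn_gt0// mul1r => u2.
    rewrite mulrAC ler_pdivrMr//.
    have -> : del * s0 / 6 * s0 = del * s0 ^+ 2 / 6 by field.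
    by clear -u2; lra.
  have b3 : t * (`|regr r f| * Num.sqrt n%:R) <= del / 3 * p.
    have sN : Num.sqrt n%:R ^+ 2 = N%:R * r by rewrite sqr_sqrtr// Nr.
    set q := Num.sqrt n%:R in sN *.
    have q0 : 0 <= q by rewrite sqrtr_ge0.
    have -> : del / 3 * p = t * (del / 6 * (N%:R * u)) by rewrite /p /t; field; rewrite gt_eqF.
    rewrite ler_pM2l//.
    apply: (@le_trans _ _ (C * q)); first by rewrite ler_wpM2r.
    have h : c3 <= N%:R * u ^+ 2 by apply: le_trans Mu; clear -c10 c20 c40 c50; lra.
    rewrite -(@ler_pXn2r _ 2)// ?nnegrE; last first.
    - by rewrite mulr_ge0 ?divr_ge0 ?mulr_ge0 ?(ltW del0) ?(ltW NR) ?(ltW u0).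
    - by rewrite mulr_ge0 ?(ltW C0).
    rewrite exprMn sN.
    have h2 : c3 * N%:R * (del / 6) ^+ 2 <= N%:R * u ^+ 2 * N%:R * (del / 6) ^+ 2.
      by rewrite ler_pM2r ?exprn_gt0 ?divr_gt0// ler_pM2r.
    have e3 : c3 * N%:R * (del / 6) ^+ 2 = C ^+ 2 * (N%:R * l1).
      by rewrite /c3; field; rewrite gt_eqF.
    apply: (@le_trans _ _ (C ^+ 2 * (N%:R * l1))).
      by rewrite ler_pM2l ?exprn_gt0// ler_pM2l.
    rewrite -e3; apply: le_trans h2 _; rewrite le_eqVlt; apply/orP; left; apply/eqP.
    by ring.
  have -> : N%:R * (t ^+ 2 * sg / 2 + t ^+ 3 * C) = p + N%:R * (t ^+ 3 * C).
    by rewrite mulrDr eq2.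
  by rewrite ep; clear -b1 b2 b3; lra.
rewrite mulrCA ler_pM2l// /T mulrCA ler_pM2l ?expR_gt0// -/c5; clear -c10 c20 c30 c40; lra.
Qed.

End Core.

(** * Curvature, and the mean under an alternative *)


Section Curvature.
Context {R : realType}.
Implicit Types (r : R) (h : nat -> R).

(** The second orthogonal polynomial of the Poisson law: it is uncorrelated
    with all affine functions of the count. *)
Definition quadp r (k : nat) : R := (k%:R - r) ^+ 2 - k%:R.
Definition curv r h : R := pmean r (fun k => h k * quadp r k).

Lemma ispm_nat3 r : ispm r (fun k => k%:R * (k%:R * k%:R)) (r * (r * (r + 1) + 2 * r + 1)).
Proof.
apply: (ispmS (g := fun k => k%:R * k%:R)).
apply: eq_ispm (ispmD (ispmD (ispm_nat2 r) (ispmZ 2 (ispm_nat r))) (ispm1 r)) _ _ => // k.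
by rewrite -natr1; ring.
Qed.

Lemma ispm_nat4 r : ispm r (fun k => k%:R * (k%:R * (k%:R * k%:R)))
  (r * (r * (r * (r + 1) + 2 * r + 1) + 3 * (r * (r + 1)) + 3 * r + 1)).
Proof.
apply: (ispmS (g := fun k => k%:R * (k%:R * k%:R))).
apply: eq_ispm (ispmD (ispmD (ispmD (ispm_nat3 r) (ispmZ 3 (ispm_nat2 r)))
  (ispmZ 3 (ispm_nat r))) (ispm1 r)) _ _ => // k.
by rewrite -natr1; ring.
Qed.

Lemma ispm_quadp r : ispm r (quadp r) 0.
Proof.
apply: eq_ispm (ispmB (ispm_centered2 r) (ispm_nat r)) _ _ => [k//|].
by rewrite subrr.
Qed.

Lemma ispm_quadp_centered r : ispm r (fun k => (k%:R - r) * quadp r k) 0.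
Proof.
apply: eq_ispm (ispmD (ispmD (ispmD (ispm_nat3 r) (ispmZ (- (3 * r + 1)) (ispm_nat2 r)))
  (ispmZ (3 * r ^+ 2 + r) (ispm_nat r))) (ispm_cst r (- r ^+ 3))) _ _ => [k|].
  by rewrite /quadp; ring.
by ring.
Qed.

Lemma ispm_quadp2 r : ispm r (fun k => quadp r k ^+ 2) (2 * r ^+ 2).
Proof.
apply: eq_ispm (ispmD (ispmD (ispmD (ispmD (ispm_nat4 r)
  (ispmZ (- (2 * (2 * r + 1))) (ispm_nat3 r)))
  (ispmZ ((2 * r + 1) ^+ 2 + 2 * r ^+ 2) (ispm_nat2 r)))
  (ispmZ (- (2 * r ^+ 2 * (2 * r + 1))) (ispm_nat r)))
  (ispm_cst r (r ^+ 4))) _ _ => [k|].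
  by rewrite /quadp; ring.
by ring.
Qed.

Lemma tame_quadp r : exists E, tame E (quadp r).
Proof.
eexists; apply: tameB tame_nat.
exact: (tameX 2 (tameB tame_nat (tame_cst r))).
Qed.

Lemma ispm_curv r D h : 0 <= r -> tame D h ->
  ispm r (fun k => h k * quadp r k) (curv r h).
Proof.
by move=> r0 th; have [E tE] := tame_quadp r; apply: (pmean_cvg r0 (tameM th tE)).
Qed.

Lemma ispm_resid_quadp r D h : 0 < r -> tame D h ->
  ispm r (fun k => resid r h k * quadp r k) (curv r h).
Proof.
move=> r0 th.
apply: eq_ispm (ispmB (ispmB (ispm_curv (ltW r0) th)
  (ispmZ (pmean r h) (ispm_quadp r))) (ispmZ (regr r h) (ispm_quadp_centered r))) _ _ => [k|].
  by rewrite /resid; ring.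
by rewrite !mulr0 !subr0.
Qed.

(** Up to additive constants the two variables of the correlation are the
    residual of h and quadp, and quadp has variance 2 r ^ 2. *)
Lemma rho_sq r D h : 0 < r -> tame D h ->
  rho h r ^+ 2 = curv r h ^+ 2 / (2 * r ^+ 2 * resid_var r h).
Proof.
move=> r0 th; rewrite /rho.
have tn : tame 2 (fun k => k%:R : R) := tame_nat.
have r0w := ltW r0.
have mn : pmean r (fun k => k%:R : R) = r := ispmE (ispm_nat r).
rewrite (covariance_poisson r0 th tn) mn -/(regr r h).
have tX := tameB th (tameZ (regr r h) tn).
have tY : tame _ (fun x => x%:R ^+ 2 - (2 * r + 1) * x%:R) :=
  tameB (tameX 2 tn) (tameZ (2 * r + 1) tn).
have mX : pmean r (fun x => h x - regr r h * x%:R) = pmean r h - regr r h * r.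
  exact: ispmE (ispmB (pmean_cvg r0w th) (ispmZ _ (ispm_nat r))).
have mY : pmean r (fun x => x%:R ^+ 2 - (2 * r + 1) * x%:R) = - r ^+ 2.
  apply: ispmE; apply: eq_ispm (ispmB (ispm_nat2 r) (ispmZ (2 * r + 1) (ispm_nat r))) _ _ => [k|].
    by rewrite expr2.
  ring.
rewrite /corr /variance (covariance_poisson r0 tX tY) (covariance_poisson r0 tX tX)
  (covariance_poisson r0 tY tY) mX mY.
have -> : pmean r (fun k => (h k - regr r h * k%:R - (pmean r h - regr r h * r)) *
    (k%:R ^+ 2 - (2 * r + 1) * k%:R - - r ^+ 2)) = curv r h.
  apply: ispmE; apply: eq_ispm (ispm_resid_quadp r0 th) _ _ => // k.
  by rewrite /resid /quadp; ring.
have -> : pmean r (fun k => (h k - regr r h * k%:R - (pmean r h - regr r h * r)) *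
    (h k - regr r h * k%:R - (pmean r h - regr r h * r))) = resid_var r h.
  apply: ispmE; apply: eq_ispm (ispm_resid2 r0 th) _ _ => // k.
  by rewrite /resid; ring.
have -> : pmean r (fun k => (k%:R ^+ 2 - (2 * r + 1) * k%:R - - r ^+ 2) *
    (k%:R ^+ 2 - (2 * r + 1) * k%:R - - r ^+ 2)) = 2 * r ^+ 2.
  apply: ispmE; apply: eq_ispm (ispm_quadp2 r) _ _ => // k.
  by rewrite /quadp; ring.
rewrite expr_div_n exprMn !sqr_sqrtr ?(resid_var_ge0 r0 th)//.
  by rewrite (mulrC (resid_var _ _)).
by rewrite mulr_ge0// sqr_ge0.
Qed.

Definition diff2 h (k : nat) : R := h k.+2 - 2 * h k.+1 + h k.

(** Two applications of the shift identity show that curv r h is r ^ 2 times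
    the average second difference of h. *)
Lemma ispm_diff2 r D h : 0 < r -> tame D h -> ispm r (diff2 h) (curv r h / r ^+ 2).
Proof.
move=> r0 th; have r0w := ltW r0.
have t1 := tameS th; have t2 := tameS t1.
have m0 := pmean_cvg r0w th; have m1 := pmean_cvg r0w t1; have m2 := pmean_cvg r0w t2.
set a0 := pmean r _ in m0; set a1 := pmean r _ in m1; set a2 := pmean r _ in m2.
have k1 : ispm r (fun k => k%:R * h k) (r * a1) := ispmS m1.
have k1' : ispm r (fun k => k%:R * h k.+1) (r * a2) := ispmS (g := fun k => h k.+1) m2.
have k2 : ispm r (fun k => k%:R * (k%:R * h k)) (r * (r * a2 + a1)).
  apply: (ispmS (g := fun k => k%:R * h k)).
  by apply: eq_ispm (ispmD k1' m1) _ _ => // k; rewrite -natr1; ring.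
have c1 : ispm r (fun k => h k * quadp r k) (r * (r * a2 + a1) - (2 * r + 1) * (r * a1) + r ^+ 2 * a0).
  apply: eq_ispm (ispmD (ispmB k2 (ispmZ (2 * r + 1) k1)) (ispmZ (r ^+ 2) m0)) _ _ => // k.
  by rewrite /quadp; ring.
rewrite /curv (ispmE c1).
apply: eq_ispm (ispmD (ispmB m2 (ispmZ 2 m1)) m0) _ _ => // .
by field; rewrite gt_eqF.
Qed.

Lemma curv_ge r D h b : 0 < r -> tame D h -> (forall k, 0 <= diff2 h k) ->
  b <= diff2 h 0 -> r ^+ 2 * expR (- r) * b <= curv r h.
Proof.
move=> r0 th h0 hb.
have := ispm_psum_le 1 (ltW r0) (ispm_diff2 r0 th) h0.
rewrite big_nat1 {1}/pois expr0 fact0 invr1 !mul1r ler_pdivlMr ?exprn_gt0//.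
move=> H; apply: le_trans H.
have -> : r ^+ 2 * expR (- r) * b = expR (- r) * b * r ^+ 2 by ring.
by rewrite ler_pM2r ?exprn_gt0// ler_pM2l ?expR_gt0.
Qed.

Lemma resid_diff2 r h k : diff2 (resid r h) k = diff2 h k.
Proof. by rewrite /diff2 /resid -!natr1; ring. Qed.

Lemma resid_var_ge (l0 l1 : R) : 0 < l0 -> l0 <= l1 -> exists w, 0 < w /\
  forall r D h b, l0 <= r <= l1 -> tame D h -> 0 <= b -> b <= diff2 h 0 ->
  w * b ^+ 2 <= resid_var r h.
Proof.
move=> l00 l01; have l10 : 0 < l1 by exact: lt_le_trans l01.
pose v := Num.min 1 (Num.min l0 (l0 ^+ 2 / 2)).
have v0 : 0 < v by rewrite /v !lt_min ltr01 l00 divr_gt0// exprn_gt0.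
pose w := v * expR (- l1) / 6.
exists w; split; first by rewrite !mulr_gt0 ?expR_gt0 ?invr_gt0.
move=> r D h b /andP[lr rl] th b0 hb.
have r0 : 0 < r by exact: lt_le_trans lr.
have sq k : 0 <= resid r h k ^+ 2 by apply: sqr_ge0.
have := ispm_psum_le 3 (ltW r0) (ispm_resid2 r0 th) sq.
rewrite !big_nat_recr//= big_nil add0r => H; apply: le_trans H.
have er : expR (- l1) <= expR (- r) by rewrite ler_expR lerN2.
have vE (x : R) : v <= x -> v * expR (- l1) <= x * expR (- r).
  by move=> vx; rewrite ler_pM// ?expR_ge0// ltW.
have p0 : v * expR (- l1) <= pois r 0.
  rewrite /pois expr0 fact0 invr1 mul1r; apply: vE.
  by rewrite /v ge_min lexx.
have p1 : v * expR (- l1) <= pois r 1.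
  rewrite /pois expr1 (_ : 1`! = 1)%N// invr1 mulr1; apply: vE.
  by apply: le_trans lr; rewrite /v !ge_min lexx orbT.
have p2 : v * expR (- l1) <= pois r 2.
  rewrite /pois (_ : 2`! = 2)%N//; apply: vE.
  apply: (@le_trans _ _ (l0 ^+ 2 / 2)); first by rewrite /v !ge_min lexx !orbT.
  by rewrite ler_pM2r// lerXn2r// nnegrE ltW.
have vv0 : 0 < v * expR (- l1) by rewrite mulr_gt0 ?expR_gt0.
have := resid_diff2 r h 0; rewrite {1}/diff2.
move: (resid r h 0) (resid r h 1) (resid r h 2) => x y z E.
have xyz : b ^+ 2 <= 6 * (x ^+ 2 + y ^+ 2 + z ^+ 2).
  apply: (@le_trans _ _ ((z - 2 * y + x) ^+ 2)).
    by rewrite lerXn2r ?nnegrE ?E//; exact: le_trans hb.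
  have := sqr_ge0 (x - z); have := sqr_ge0 (y + 2 * x); have := sqr_ge0 (y + 2 * z).
  by clear; nra.
rewrite /w.
apply: (@le_trans _ _ (v * expR (- l1) * x ^+ 2 + v * expR (- l1) * y ^+ 2 + v * expR (- l1) * z ^+ 2)).
  rewrite -!mulrDr -[leLHS]mulrA ler_pM2l//; clear -xyz; lra.
by rewrite !lerD// ler_wpM2r// sqr_ge0.
Qed.

Lemma ispm_norm_le_scale r D (A : R) g v : 0 <= r -> 1 <= D -> 0 <= A ->
  (forall k, `|g k| <= A * D ^+ k.+1) -> ispm r g v -> `|v| <= A * (D * expR (r * D)).
Proof.
move=> r0 D1; rewrite le_eqVlt => /predU1P[<-|A0] gA gv.
  have g0 : g =1 fun=> 0.
    by move=> k; apply/eqP; rewrite -normr_le0 (le_trans (gA k))// mul0r.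
  have /ispmE := eq_ispm gv g0 erefl.
  by rewrite (ispmE (ispm_cst r 0)) => <-; rewrite normr0 mul0r.
have tg : tame D (fun k => A^-1 * g k).
  split=> // k; rewrite normrM gtr0_norm ?invr_gt0//.
  by rewrite mulrC ler_pdivrMr// mulrC.
have := ispm_norm_le r0 tg (ispmZ A^-1 gv).
by rewrite normrM gtr0_norm ?invr_gt0// mulrC ler_pdivrMr// mulrC.
Qed.

Lemma binomial_taylor (e : R) k : `|e| <= 1 ->
  `|(1 + e) ^+ k - (1 + k%:R * e + k%:R * (k%:R - 1) / 2 * e ^+ 2)| <= `|e| ^+ 3 * 4 ^+ k.
Proof.
move=> e1; have e0 : 0 <= `|e| by [].
elim: k => [|k IH].
  rewrite !expr0 !mul0r !addr0 subrr normr0 mulr1 exprn_ge0//.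
set rk := _ - _ in IH.
have -> : (1 + e) ^+ k.+1 - (1 + k.+1%:R * e + k.+1%:R * (k.+1%:R - 1) / 2 * e ^+ 2) =
   (1 + e) * rk + e ^+ 3 * (k%:R * (k%:R - 1) / 2).
  by rewrite /rk exprS -natr1; field.
apply: le_trans (ler_normD _ _) _; rewrite (normrM (1 + e)) (normrM (e ^+ 3)) normrX
  (normrM _ 2^-1) (normrM k%:R).
have h1 : `|1 + e| <= 2 by rewrite (le_trans (ler_normD _ _))// normr1; lra.
have kk : `|k%:R| * `|k%:R - 1| * `|2^-1| <= 4 ^+ k :> R.
  rewrite normr_nat (ger0_norm (_ : 0 <= 2^-1))//.
  have k2 : k%:R <= 2 ^+ k :> R by rewrite -natrX ler_nat ltnW// ltn_expl.
  have k1 : `|k%:R - 1| <= 2 ^+ k :> R.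
    have : 0 <= k%:R :> R by [].
    have : 1 <= 2 ^+ k :> R by rewrite exprn_ege1//; lra.
    by move=> ? ?; rewrite ler_norml; apply/andP; split; lra.
  have -> : 4 ^+ k = 2 ^+ k * 2 ^+ k :> R by rewrite -exprMn; congr (_ ^+ _); ring.
  have := ler_pM (ler0n _ k) (normr_ge0 _) k2 k1.
  have : 0 <= k%:R * `|k%:R - 1| :> R by rewrite mulr_ge0.
  lra.
have IH2 := ler_pM (normr_ge0 _) (normr_ge0 _) h1 IH.
have := ler_wpM2l (exprn_ge0 3 e0) kk.
rewrite (exprS 4) !mulrA in IH2 *.
have : 0 <= `|e| ^+ 3 * 4 ^+ k by rewrite mulr_ge0 ?exprn_ge0.
lra.
Qed.

Lemma pois_ratio_taylor (l r e : R) k : 0 <= r <= l -> `|e| <= 1 ->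
  `|expR (- (r * e)) * (1 + e) ^+ k - (1 + e * (k%:R - r) + e ^+ 2 / 2 * quadp r k)| <=
  `|e| ^+ 3 * (((1 + l) ^+ 2 + expR l + 3 * l ^+ 3 * expR l) * 4 ^+ k).
Proof.
move=> /andP[r0 rl] e1; have e0 : 0 <= `|e| by [].
have l0 : 0 <= l by exact: le_trans rl.
have z1 : `|- (r * e)| <= l.
  by rewrite normrN normrM ger0_norm// -[leRHS]mulr1 ler_pM.
have z3 : `|- (r * e)| ^+ 3 <= `|e| ^+ 3 * l ^+ 3.
  rewrite normrN normrM ger0_norm// mulrC -exprMn lerXn2r ?nnegrE ?mulr_ge0//.
  by rewrite ler_wpM2l.
have := binomial_taylor k e1; have := expR_taylor2 (- (r * e)).
set E := expR _; set S := _ - _ => hS; set P := (1 + k%:R * e + _); set T := _ - P => hT.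
have hS' : `|S| <= `|e| ^+ 3 * (l ^+ 3 * expR l).
  apply: le_trans hS _; rewrite mulrA ler_pM ?exprn_ge0 ?expR_ge0//.
  by rewrite ler_expR.
have k0 : 0 <= k%:R :> R by [].
have k2 : k%:R <= 2 ^+ k :> R by rewrite -natrX ler_nat ltnW// ltn_expl.
have two1 : 1 <= 2 ^+ k :> R by rewrite exprn_ege1//; lra.
have four : 4 ^+ k = 2 ^+ k * 2 ^+ k :> R by rewrite -exprMn; congr (_ ^+ _); ring.
have k4 : k%:R <= 4 ^+ k :> R by rewrite four; nra.
have kk4 : k%:R * k%:R <= 4 ^+ k :> R by rewrite four ler_pM.
have one4 : 1 <= 4 ^+ k :> R by rewrite exprn_ege1//; lra.
have km1 : 0 <= k%:R * (k%:R - 1) :> R.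
  by case: (k) => [|j]; [rewrite mul0r|rewrite mulr_ge0// subr_ge0 ler1n].
have hE : E <= expR l by rewrite ler_expR (le_trans (ler_norm _) z1).
have E0 : 0 <= E by apply: expR_ge0.
have hP : `|P| <= 3 * 4 ^+ k.
  rewrite /P (le_trans (ler_normD _ _))// (_ : 3 * 4 ^+ k = (1 + 4 ^+ k) + (4 ^+ k - 1 + 4 ^+ k)); last by ring.
  apply: lerD.
    rewrite (le_trans (ler_normD _ _))// normr1 lerD2l normrM normr_nat.
    by apply: le_trans k4; rewrite ler_piMr.
  rewrite normrM normrX (ger0_norm (_ : 0 <= _ / 2)); last by rewrite divr_ge0.
  apply: (@le_trans _ _ (k%:R * (k%:R - 1) / 2)).
    by rewrite ler_piMr ?divr_ge0// exprn_ile1.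
  lra.
pose Q := 1 + - (r * e) + (- (r * e)) ^+ 2 / 2.
have -> : E * (1 + e) ^+ k - (1 + e * (k%:R - r) + e ^+ 2 / 2 * quadp r k) =
   E * T + P * S + e ^+ 3 * (- (r * (k%:R * (k%:R - 1)) / 2) + k%:R * r ^+ 2 / 2
      + e * (k%:R * (k%:R - 1) * r ^+ 2 / 4)).
  have -> : E * (1 + e) ^+ k = E * T + E * P by rewrite /T; ring.
  have -> : E * P = S * P + Q * P by rewrite /S /Q; ring.
  by rewrite /Q /P /quadp; field.
have b1 : `|E * T| <= `|e| ^+ 3 * (expR l * 4 ^+ k).
  rewrite normrM ger0_norm// mulrCA.
  by apply: ler_pM.
have b2 : `|P * S| <= `|e| ^+ 3 * (3 * l ^+ 3 * expR l * 4 ^+ k).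
  rewrite normrM; have := ler_pM (normr_ge0 _) (normr_ge0 _) hP hS'.
  by move=> h; apply: le_trans h _; rewrite le_eqVlt; apply/orP; left; apply/eqP; ring.
have b3 : `|e ^+ 3 * (- (r * (k%:R * (k%:R - 1)) / 2) + k%:R * r ^+ 2 / 2
      + e * (k%:R * (k%:R - 1) * r ^+ 2 / 4))| <= `|e| ^+ 3 * ((1 + l) ^+ 2 * 4 ^+ k).
  rewrite normrM normrX ler_wpM2l ?exprn_ge0//.
  have rr : r ^+ 2 <= l ^+ 2 by rewrite lerXn2r ?nnegrE.
  have rr0 : 0 <= r ^+ 2 by rewrite sqr_ge0.
  have a1 : r * (k%:R * (k%:R - 1)) <= l * 4 ^+ k.
    by rewrite ler_pM//; lra.
  have a1' : 0 <= r * (k%:R * (k%:R - 1)) by rewrite mulr_ge0.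
  have a2 : k%:R * r ^+ 2 <= 4 ^+ k * l ^+ 2 by rewrite ler_pM.
  have a2' : 0 <= k%:R * r ^+ 2 by rewrite mulr_ge0.
  have a3 : k%:R * (k%:R - 1) * r ^+ 2 <= 4 ^+ k * l ^+ 2 by rewrite ler_pM//; lra.
  have a3' : 0 <= k%:R * (k%:R - 1) * r ^+ 2 by rewrite mulr_ge0.
  have a4 : `|e * (k%:R * (k%:R - 1) * r ^+ 2 / 4)| <= 4 ^+ k * l ^+ 2 / 4.
    rewrite normrM (ger0_norm (_ : 0 <= _ / 4)); last by rewrite divr_ge0.
    apply: (@le_trans _ _ (k%:R * (k%:R - 1) * r ^+ 2 / 4)); last by rewrite ler_pM2r.
    by rewrite ler_piMl// divr_ge0.
  apply: le_trans (ler_normD _ _) _.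
  have a5 : `|- (r * (k%:R * (k%:R - 1)) / 2) + k%:R * r ^+ 2 / 2| <=
     l * 4 ^+ k / 2 + 4 ^+ k * l ^+ 2 / 2.
    by rewrite ler_norml; apply/andP; split; lra.
  have : 0 <= l * 4 ^+ k by rewrite mulr_ge0//; lra.
  have : 0 <= 4 ^+ k * l ^+ 2 by rewrite mulr_ge0 ?sqr_ge0//; lra.
  have -> : (1 + l) ^+ 2 * 4 ^+ k = 4 ^+ k + 2 * (l * 4 ^+ k) + 4 ^+ k * l ^+ 2 by ring.
  lra.
have := le_trans (ler_normD _ _) (lerD (le_trans (ler_normD _ _) (lerD b1 b2)) b3).
by move=> h; apply: le_trans h _; rewrite le_eqVlt; apply/orP; left; apply/eqP; ring.
Qed.

Lemma pois_shift r e k : pois (r * (1 + e)) k = pois r k * (expR (- (r * e)) * (1 + e) ^+ k).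
Proof.
rewrite /pois exprMn (_ : - (r * (1 + e)) = - r + - (r * e)); last by ring.
by rewrite expRD; ring.
Qed.

(** The likelihood ratio of the rates r * (1 + e) and r is expR (- (r * e)) *
    (1 + e) ^+ k, which is 1 + e * (k - r) + e ^ 2 / 2 * quadp r k up to order
    e ^ 3. *)
Lemma pmean_perturb (l1 D : R) : 0 <= l1 -> exists C : R, 0 <= C /\
  forall r h (e : R), 0 < r <= l1 -> tame D h -> `|e| <= 1 -> 0 < 1 + e ->
  `|pmean (r * (1 + e)) h - pmean r h - e * pmean r (fun k => h k * (k%:R - r))
     - e ^+ 2 / 2 * curv r h| <= C * `|e| ^+ 3.
Proof.
move=> l10.
pose c := (1 + l1) ^+ 2 + expR l1 + 3 * l1 ^+ 3 * expR l1.
have c0 : 0 <= c.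
  by rewrite /c !addr_ge0 ?sqr_ge0 ?expR_ge0// !mulr_ge0 ?expR_ge0 ?exprn_ge0.
have [D1|D1] := leP 1 D; last first.
  by exists 0; split=> // r h e _ [H _]; rewrite leNgt D1 in H.
pose D' := D * 4.
have D'1 : 1 <= D' by rewrite /D'; lra.
exists (c * (D' * expR (l1 * D'))); split.
  by rewrite !mulr_ge0 ?expR_ge0//; lra.
move=> r h e /andP[r0 rl] th e1 e0.
have r0w := ltW r0.
have m1 : ispm r (fun k => h k * (expR (- (r * e)) * (1 + e) ^+ k)) (pmean (r * (1 + e)) h).
  have [H] := pmean_cvg (mulr_ge0 r0w (ltW e0)) th.
  split; suff -> : series (fun k => pois r k * (h k * (expR (- (r * e)) * (1 + e) ^+ k))) =
    series (fun k => pois (r * (1 + e)) k * h k) by [].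
  apply/funext => n.
  by rewrite /series/=; apply: eq_bigr => k _; rewrite pois_shift; ring.
have m2 := pmean_cvg r0w th.
have m3 := pmean_cvg r0w (tameM th (tameB tame_nat (tame_cst r))).
have m4 := ispm_curv r0w th.
have M := ispmB (ispmB (ispmB m1 m2) (ispmZ e m3)) (ispmZ (e ^+ 2 / 2) m4).
have : `|pmean (r * (1 + e)) h - pmean r h - e * pmean r (fun k => h k * (k%:R - r))
     - e ^+ 2 / 2 * curv r h| <= (`|e| ^+ 3 * c) * (D' * expR (r * D')).
  apply: ispm_norm_le_scale M => //; first by rewrite mulr_ge0 ?exprn_ge0.
  move=> k.
  have -> : h k * (expR (- (r * e)) * (1 + e) ^+ k) - h k - e * (h k * (k%:R - r)) -
    e ^+ 2 / 2 * (h k * quadp r k) = h k * (expR (- (r * e)) * (1 + e) ^+ k -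
     (1 + e * (k%:R - r) + e ^+ 2 / 2 * quadp r k)) by ring.
  rewrite normrM.
  have rl' : 0 <= r <= l1 by rewrite r0w.
  have := ler_pM (normr_ge0 _) (normr_ge0 _) (th.2 k) (pois_ratio_taylor k rl' e1).
  move=> H; apply: le_trans H _; rewrite -/c /D' exprMn (exprS 4).
  have -> : D ^+ k.+1 * (`|e| ^+ 3 * (c * 4 ^+ k)) = `|e| ^+ 3 * c * (D ^+ k.+1 * 4 ^+ k).
    by ring.
  rewrite ler_wpM2l ?mulr_ge0 ?exprn_ge0// ler_wpM2l ?exprn_ge0//; first lra.
  by rewrite ler_peMl ?exprn_ge0//; lra.
move=> H; apply: le_trans H _.
have -> : c * (D' * expR (l1 * D')) * `|e| ^+ 3 = (`|e| ^+ 3 * c) * (D' * expR (l1 * D')) by ring.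
rewrite ler_wpM2l ?mulr_ge0 ?exprn_ge0// ler_wpM2l//; first lra.
by rewrite ler_expR ler_wpM2r//; lra.
Qed.

(** The relative deviations of the cells sum to zero. So the linear terms
    cancel, and the quadratic ones add up to eps p / 2. *)
Lemma A1_expansion (l1 D : R) : 0 <= l1 -> exists C : R, 0 <= C /\
  forall (N n : nat) (p : 'I_N -> R) h (eta : R), (0 < N)%N -> (0 < n)%N ->
    n%:R / N%:R <= l1 -> tame D h -> (forall m, 0 < p m) -> \sum_m p m = 1 ->
    (forall m, `|eps_cell p m| <= eta) -> eta <= 1 ->
  `|A1 n p h - pmean (n%:R / N%:R) h - eps p / 2 * curv (n%:R / N%:R) h| <=
   C * eta * eps p.
Proof.
move=> l10; have [C [C0 HC]] := pmean_perturb D l10; exists C; split=> //.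
move=> N n p h eta N0 n0 rl th p0 p1 ep e1.
have NR : 0 < N%:R :> R by rewrite ltr0n.
set r := n%:R / N%:R in rl *.
have r0 : 0 < r by rewrite divr_gt0// ltr0n.
pose e m := eps_cell p m.
have np m : n%:R * p m = r * (1 + e m).
  by rewrite /r /e /eps_cell; field; rewrite gt_eqF.
have e0 m : 0 < 1 + e m.
  by rewrite /e /eps_cell addrC subrK mulr_gt0.
have se : \sum_m e m = 0.
  rewrite /e /eps_cell big_split/= -mulr_sumr p1 mulr1 sumr_const card_ord.
  by rewrite mulNrn subrr.
have -> : A1 n p h = N%:R^-1 * \sum_m pmean (r * (1 + e m)) h.
  rewrite /A1; congr (_ * _); apply: eq_bigr => m _.
  by rewrite np (expectation_poisson _ th)// mulr_gt0.
pose a1 := pmean r (fun k => h k * (k%:R - r)).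
have E : N%:R^-1 * \sum_m pmean (r * (1 + e m)) h - pmean r h - eps p / 2 * curv r h =
  N%:R^-1 * \sum_m (pmean (r * (1 + e m)) h - pmean r h - e m * a1 - e m ^+ 2 / 2 * curv r h).
  have -> : \sum_m (pmean (r * (1 + e m)) h - pmean r h - e m * a1 - e m ^+ 2 / 2 * curv r h) =
    \sum_m pmean (r * (1 + e m)) h - N%:R * pmean r h - (\sum_m e m) * a1
     - (\sum_m e m ^+ 2) / 2 * curv r h.
    have -> : N%:R * pmean r h = \sum_(m < N) pmean r h.
      by rewrite sumr_const card_ord mulr_natl.
    by rewrite !mulr_suml -!sumrB.
  rewrite se mul0r subr0 /eps -/(e _).
  have -> : \sum_(m < N) (N%:R * p m - 1) ^+ 2 = \sum_m e m ^+ 2 by [].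
  by field; rewrite gt_eqF.
rewrite E normrM gtr0_norm ?invr_gt0// /eps.
have -> : C * eta * (N%:R^-1 * \sum_(m < N) (N%:R * p m - 1) ^+ 2) =
  N%:R^-1 * \sum_(m < N) C * eta * e m ^+ 2 by rewrite -mulr_sumr; ring.
rewrite ler_wpM2l ?invr_ge0//; apply: le_trans (ler_norm_sum _ _ _) _.
apply: ler_sum => m _.
have rl' : 0 < r <= l1 by rewrite r0.
apply: le_trans (HC r h (e m) rl' th (le_trans (ep m) e1) (e0 m)) _.
rewrite -mulrA ler_wpM2l// exprSr -normrX ger0_norm ?sqr_ge0// mulrC.
by rewrite ler_wpM2r ?sqr_ge0// ep.
Qed.

End Curvature.

(** * Truncation *)


#[local] Opaque pmean.

Section Truncation.
Context {R : realType}.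

Lemma resid_varE (r D : R) f : 0 < r -> tame D f ->
  resid_var r f = pmean r (fun k => f k * f k) - pmean r f ^+ 2
    - pmean r (fun k => f k * (k%:R - r)) ^+ 2 / r.
Proof.
move=> r0 tf; have r0w := ltW r0.
have tc : tame (2 + (1 + `|r|)) (fun k => k%:R - r) := tameB tame_nat (tame_cst r).
have m1 := pmean_cvg r0w tf.
have m2 := pmean_cvg r0w (tameM tf tf).
have m3 := pmean_cvg r0w (tameM tf tc).
set a := pmean r f in m1 *; set b := pmean r (fun k => f k * f k) in m2 *.
set c := pmean r (fun k => f k * (k%:R - r)) in m3 *.
have tauE : regr r f = c / r.
  rewrite /regr mulrC; congr (_ / _); apply: ispmE.
  apply: eq_ispm (ispmB m3 (ispmZ a (ispm_centered r))) _ _ => [k|].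
    by rewrite mulrBl.
  by rewrite mulr0 subr0.
apply: ispmE.
apply: eq_ispm (ispmD (ispmD (ispmD (ispmB m2 (ispmZ (2 * a) m1)) (ispm_cst r (a ^+ 2)))
   (ispmB (ispmZ (2 * (c / r) * a) (ispm_centered r)) (ispmZ (2 * (c / r)) m3)))
   (ispmZ ((c / r) ^+ 2) (ispm_centered2 r))) _ _ => [k|].
  by rewrite /resid tauE -/a; ring.
by field; rewrite gt_eqF.
Qed.

(** The functions differ beyond K only, where the Poisson tail is of order
    expR (- K). *)
Lemma trunc_close (l0 l1 D : R) : 0 < l0 -> l0 <= l1 -> 1 <= D ->
  exists C : R, 1 <= C /\ forall (r K : R) h f, l0 <= r <= l1 ->
    tame D h -> tame D f -> (forall k, k%:R <= K -> f k = h k) ->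
    `|pmean r h - pmean r f| <= C * expR (- K) /\
    `|resid_var r h - resid_var r f| <= C * expR (- K).
Proof.
move=> l00 l01 D1; have l10 : 0 < l1 by exact: lt_le_trans l01.
have D0 : 0 < D by exact: lt_le_trans D1.
pose T d : R := d * expR 1 * expR (l1 * (d * expR 1)).
have T0 d : 0 < d -> 0 < T d by move=> d0; rewrite /T !mulr_gt0 ?expR_gt0.
pose D3 := D * (3 + l1).
have D30 : 0 < D3 by rewrite mulr_gt0//; lra.
pose A := D * expR (l1 * D); pose A3 := D3 * expR (l1 * D3).
have A0 : 0 < A by rewrite mulr_gt0 ?expR_gt0.
have A30 : 0 < A3 by rewrite mulr_gt0 ?expR_gt0.
have T1 : 0 < T (D + D) by apply: T0; lra.
have T2 : 0 < T (D * D + D * D) by apply: T0; rewrite addr_gt0// mulr_gt0.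
have T3 : 0 < T (D3 + D3) by apply: T0; lra.
pose C := T (D * D + D * D) + 2 * A * T (D + D) + 2 * A3 * T (D3 + D3) / l0.
have C0 : 0 < C.
  apply: addr_gt0; first apply: addr_gt0 => //.
    by apply: mulr_gt0 => //; apply: mulr_gt0.
  by apply: divr_gt0 => //; apply: mulr_gt0 => //; apply: mulr_gt0.
exists (1 + T (D + D) + C); split; first lra.
move=> r K h f /andP[lr rl] th tf fh.
have r0 : 0 < r by exact: lt_le_trans lr.
have r0w := ltW r0.
have tc : tame (3 + l1) (fun k => k%:R - r) by apply: tame_centered; rewrite r0w.
have tail d g v : tame d g -> ispm r g v -> (forall k, k%:R <= K -> g k = 0) ->
    `|v| <= T d * expR (- K).
  move=> tg gv gK; have d1 := tame_ge1 tg.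
  apply: le_trans (ispm_tail r0w tg gv gK) _; rewrite mulrC.
  rewrite ler_pM2r ?expR_gt0// /T ler_pM2l ?mulr_gt0 ?expR_gt0//; last lra.
  by rewrite ler_expR ler_pM2r// mulr_gt0 ?expR_gt0//; lra.
have bound d g : tame d g -> `|pmean r g| <= d * expR (l1 * d).
  move=> tg; have d1 := tame_ge1 tg.
  apply: le_trans (ispm_norm_le r0w tg (pmean_cvg r0w tg)) _.
  by rewrite ler_pM2l ?ler_expR ?ler_pM2r//; lra.
have thh := tameM th th; have tff := tameM tf tf.
have thc := tameM th tc; have tfc := tameM tf tc.
have e0 : 0 < expR (- K) by apply: expR_gt0.
have d1 : `|pmean r h - pmean r f| <= T (D + D) * expR (- K).
  apply: tail (tameB th tf) (ispmB (pmean_cvg r0w th) (pmean_cvg r0w tf)) _.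
  by move=> k /fh ->; rewrite subrr.
have d2 : `|pmean r (fun k => h k * h k) - pmean r (fun k => f k * f k)| <=
    T (D * D + D * D) * expR (- K).
  apply: tail (tameB thh tff) (ispmB (pmean_cvg r0w thh) (pmean_cvg r0w tff)) _.
  by move=> k /fh ->; rewrite subrr.
have d3 : `|pmean r (fun k => h k * (k%:R - r)) - pmean r (fun k => f k * (k%:R - r))| <=
    T (D3 + D3) * expR (- K).
  apply: tail (tameB thc tfc) (ispmB (pmean_cvg r0w thc) (pmean_cvg r0w tfc)) _.
  by move=> k /fh ->; rewrite subrr.
have bh := bound _ _ th; have bf := bound _ _ tf.
have bhc := bound _ _ thc; have bfc := bound _ _ tfc.
have sq (x y a t : R) : 0 <= a -> `|x| <= a -> `|y| <= a -> `|x - y| <= t ->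
    `|x ^+ 2 - y ^+ 2| <= 2 * a * t.
  move=> a0 xa ya xyt; rewrite subr_sqr normrM mulrC ler_pM//.
  by rewrite (le_trans (ler_normD _ _))//; lra.
have s1 := sq _ _ _ _ (ltW A0) bh bf d1.
have s3 := sq _ _ _ _ (ltW A30) bhc bfc d3.
split.
  apply: le_trans d1 _; rewrite ler_pM2r//; lra.
rewrite (resid_varE r0 th) (resid_varE r0 tf).
move: s1 s3 d2; set ah := pmean r h; set af := pmean r f.
set ch := pmean r (fun k => h k * (k%:R - r)); set cf := pmean r (fun k => f k * (k%:R - r)).
set m2h := pmean r _; set m2f := pmean r _ => s1 s3 d2.
have -> : m2h - ah ^+ 2 - ch ^+ 2 / r - (m2f - af ^+ 2 - cf ^+ 2 / r) =
  (m2h - m2f) - (ah ^+ 2 - af ^+ 2) - (ch ^+ 2 - cf ^+ 2) / r by ring.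
have s3' : `|(ch ^+ 2 - cf ^+ 2) / r| <= 2 * A3 * T (D3 + D3) / l0 * expR (- K).
  rewrite normrM (gtr0_norm (_ : 0 < r^-1)) ?invr_gt0//.
  have -> : 2 * A3 * T (D3 + D3) / l0 * expR (- K) = 2 * A3 * (T (D3 + D3) * expR (- K)) / l0.
    by ring.
  by rewrite ler_pM ?invr_ge0// lef_pV2 ?posrE.
apply: le_trans (ler_normB _ _) _.
have := le_trans (ler_normB _ _) (lerD d2 s1) => H.
apply: le_trans (lerD H s3') _.
apply: (@le_trans _ _ (C * expR (- K))); last by rewrite ler_pM2r//; lra.
by rewrite /C le_eqVlt; apply/orP; left; apply/eqP; ring.
Qed.

(** The regression removes every multiple of the count. *)
Lemma resid_affine (r D b : R) f k : 0 < r -> tame D f ->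
  resid r (fun j => f j + b * j%:R) k = resid r f k.
Proof.
move=> r0 tf; have r0w := ltW r0.
have aE : pmean r (fun j => f j + b * j%:R) = pmean r f + b * r.
  exact: ispmE (ispmD (pmean_cvg r0w tf) (ispmZ b (ispm_nat r))).
have tc := tameM (tameB tf (tame_cst (pmean r f))) (tameB tame_nat (tame_cst r)).
have tE : regr r (fun j => f j + b * j%:R) = regr r f + b.
  rewrite /regr aE.
  have -> : pmean r (fun k => (f k + b * k%:R - (pmean r f + b * r)) * (k%:R - r)) =
    pmean r (fun k => (f k - pmean r f) * (k%:R - r)) + b * r.
    apply: ispmE; apply: eq_ispm (ispmD (pmean_cvg r0w tc) (ispmZ b (ispm_centered2 r))) _ _ => // j.
    by ring.
  by field; rewrite gt_eqF.
by rewrite /resid aE tE; ring.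
Qed.

Lemma urn_prob_mono N n (P Q : ('I_N -> nat) -> bool) :
  (forall x, tot x = n -> P x -> Q x) -> urn_prob R n P <= urn_prob R n Q.
Proof.
move=> PQ; rewrite /urn_prob /multinomial_prob big_mkcond [leRHS]big_mkcond/=.
apply: ler_sum => k _; rewrite /multinomial_pmf.
have pos : 0 <= n`!%:R / \prod_(m < N) (k m)`!%:R *
    \prod_(m < N) (@uniform_cells R N) m ^+ k m.
  rewrite mulr_ge0 ?divr_ge0//; apply: prodr_ge0 => m _ //.
  by rewrite exprn_ge0// invr_ge0.
case: ifP => // Pk; last by case: ifP => // _; case: ifP.
case: eqP => [kn|_]; last by case: ifP.
by rewrite (PQ _ kn Pk).
Qed.

Lemma dom_affine (s0 u uf B D D2 : R) (f : nat -> R) :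
  0 < s0 -> 0 <= B -> 0 <= D -> 0 < u -> 0 <= uf -> uf <= 2 * u ->
  u * (16 / s0 * B) <= 1 -> D * expR 1 <= D2 ->
  (forall k, expR (16 / s0 * u * `|f k|) <= D ^+ k.+1 * Num.sqrt k`!%:R) ->
  forall k, expR (4 / (s0 / 2) * uf * `|f k + B * k%:R|) <=
    D2 ^+ k.+1 * Num.sqrt k`!%:R.
Proof.
move=> s00 B0 D0 u0 uf0 uf2 uB DD dom k.
have k0 : 0 <= k%:R :> R by [].
have e0 : 0 <= D * expR 1 by rewrite mulr_ge0 ?expR_ge0.
apply: (@le_trans _ _ ((D * expR 1) ^+ k.+1 * Num.sqrt k`!%:R)); last first.
  by rewrite ler_wpM2r ?sqrtr_ge0// lerXn2r ?nnegrE// (le_trans e0).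
rewrite exprMn [leRHS]mulrAC.
apply: (@le_trans _ _ (expR (16 / s0 * u * `|f k|) * expR 1 ^+ k.+1)); last first.
  by rewrite ler_wpM2r ?exprn_ge0 ?expR_ge0.
rewrite -expRM_natr mul1r -expRD ler_expR.
apply: (@le_trans _ _ (16 / s0 * u * (`|f k| + B * k%:R))).
  have -> : 16 / s0 * u = 4 / (s0 / 2) * (2 * u) by field; rewrite gt_eqF.
  have q0 : 0 < 4 / (s0 / 2) by rewrite !divr_gt0.
  have h : `|f k + B * k%:R| <= `|f k| + B * k%:R.
    by rewrite (le_trans (ler_normD _ _))// lerD2l ger0_norm// mulr_ge0.
  rewrite -(mulrA (4 / (s0 / 2)) uf) -(mulrA (4 / (s0 / 2)) (2 * u)) (ler_pM2l q0).
  by apply: ler_pM.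
rewrite mulrDr lerD2l.
have -> : 16 / s0 * u * (B * k%:R) = (u * (16 / s0 * B)) * k%:R by ring.
by apply: (@le_trans _ _ (k%:R)); [rewrite ler_piMl|rewrite ler_nat].
Qed.

(** As K exceeds a multiple of N * u ^ 2 + ln N, the union bound over the N
    cells is negligible against the probability to be estimated. *)
Lemma absorb_tail (N x L K M M2 c p : R) : 0 < N -> expR L = N -> 1 <= M2 ->
  1 <= x -> p <= c * x -> c + M2 <= M -> 1 <= M -> 0 <= L -> M * (x + L) <= K ->
  N * (expR (- K) * M2) <= expR (- p).
Proof.
move=> N0 eN M21 x1 pc cM M1 L0 MK.
have x0 : 0 < x by exact: lt_le_trans x1.
apply: (@le_trans _ _ (N * (expR (- K) * expR M2))).
  rewrite (ler_pM2l N0) (ler_pM2l (expR_gt0 _)).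
  by apply: le_trans (expR_ge1Dx _); lra.
rewrite -eN -!expRD ler_expR.
have h1 : M * x + L <= K.
  by apply: le_trans MK; rewrite mulrDr lerD2l ler_peMl.
have h2 : (c + M2) * x <= M * x by rewrite (ler_pM2r x0).
have h3 : M2 <= M2 * x by rewrite ler_peMr//; lra.
lra.
Qed.

Lemma exponent_close (N u uf sh sf d : R) : 0 < N -> 0 < u -> 0 < sh ->
  0 < d -> d <= 8^-1 -> u <= uf -> uf <= (1 + d) * u -> `|sh - sf| <= d * sh ->
  (1 + d) * (N * uf ^+ 2 / (2 * sf)) <= (1 + 8 * d) * (N * u ^+ 2 / (2 * sh)) /\
  (1 - 2 * d) * (N * u ^+ 2 / (2 * sh)) <= (1 - d) * (N * uf ^+ 2 / (2 * sf)).
Proof.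
move=> N0 u0 sh0 d0 d8 u1 u2; rewrite ler_distl => /andP[s1 s2].
have sf1 : sf <= (1 + d) * sh by lra.
have sf2 : (1 - d) * sh <= sf by lra.
have sf0 : 0 < sf by apply: lt_le_trans sf2; rewrite mulr_gt0//; lra.
have uf0 : 0 < uf by exact: lt_le_trans u1.
have uu1 : uf ^+ 2 <= (1 + d) ^+ 2 * u ^+ 2.
  by rewrite -exprMn lerXn2r ?nnegrE//; [exact: ltW|rewrite mulr_ge0//; lra].
have uu2 : u ^+ 2 <= uf ^+ 2 by rewrite lerXn2r ?nnegrE// ltW.
have U0 : 0 < u ^+ 2 by rewrite exprn_gt0.
have UF0 : 0 < uf ^+ 2 by rewrite exprn_gt0.
have q0 : 0 < N / (2 * sf * sh) by rewrite divr_gt0// !mulr_gt0.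
split.
  have -> : (1 + d) * (N * uf ^+ 2 / (2 * sf)) =
    N / (2 * sf * sh) * ((1 + d) * uf ^+ 2 * sh) by field; rewrite !gt_eqF.
  have -> : (1 + 8 * d) * (N * u ^+ 2 / (2 * sh)) =
    N / (2 * sf * sh) * ((1 + 8 * d) * u ^+ 2 * sf) by field; rewrite !gt_eqF.
  rewrite ler_pM2l//.
  apply: (@le_trans _ _ ((1 + d) ^+ 3 * (u ^+ 2 * sh))).
    have -> : (1 + d) ^+ 3 * (u ^+ 2 * sh) = (1 + d) * ((1 + d) ^+ 2 * u ^+ 2) * sh by ring.
    by rewrite ler_pM2r// ler_pM2l//; lra.
  apply: (@le_trans _ _ ((1 + 8 * d) * (1 - d) * (u ^+ 2 * sh))).
    rewrite ler_pM2r ?mulr_gt0//.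
    have dd : d ^+ 2 <= d / 8 by rewrite expr2; nra.
    have ddd : d ^+ 3 <= d / 8.
      rewrite exprS; apply: le_trans (ler_wpM2l (ltW d0) dd) _; nra.
    have -> : (1 + d) ^+ 3 = 1 + 3 * d + 3 * d ^+ 2 + d ^+ 3 by ring.
    have -> : (1 + 8 * d) * (1 - d) = 1 + 7 * d - 8 * d ^+ 2 by ring.
    lra.
  have -> : (1 + 8 * d) * (1 - d) * (u ^+ 2 * sh) = (1 + 8 * d) * u ^+ 2 * ((1 - d) * sh) by ring.
  by rewrite ler_pM2l// mulr_gt0//; lra.
have -> : (1 - 2 * d) * (N * u ^+ 2 / (2 * sh)) =
  N / (2 * sf * sh) * (u ^+ 2 * ((1 - 2 * d) * sf)) by field; rewrite !gt_eqF.
have -> : (1 - d) * (N * uf ^+ 2 / (2 * sf)) =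
  N / (2 * sf * sh) * (uf ^+ 2 * ((1 - d) * sh)) by field; rewrite !gt_eqF.
rewrite ler_pM2l//; apply: ler_pM => //; first exact: ltW.
  by rewrite mulr_ge0 ?(ltW sf0)//; lra.
apply: (@le_trans _ _ ((1 - 2 * d) * ((1 + d) * sh))).
  by rewrite ler_pM2l//; lra.
rewrite mulrA ler_pM2r//.
have := sqr_ge0 d; have -> : (1 - 2 * d) * (1 + d) = 1 - d - 2 * d ^+ 2 by ring.
lra.
Qed.

(** Here f is h truncated beyond K. Adding B * k to f makes it nondecreasing;
    this changes neither the event, because the total is n, nor the residual
    variance. As f <= h, the lower bound for f is one for h; and the two
    statistics differ only if some cell exceeds K. *)
Theorem truncated_deviation (l0 l1 D s0 B del : R) :
  0 < l0 -> l0 <= l1 -> 1 <= D -> 0 < s0 -> 0 <= B -> 0 < del ->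
  exists M : R, 1 <= M /\ forall (N n : nat) (r u K : R) (h f : nat -> R),
    (0 < N)%N -> (0 < n)%N -> N%:R * r = n%:R -> l0 <= r <= l1 ->
    tame D h -> tame D f -> (forall k, f k - B <= f k.+1) ->
    (forall k, f k <= h k) -> (forall k, k%:R <= K -> f k = h k) ->
    s0 <= resid_var r h ->
    0 < u -> u * M <= 1 -> M <= N%:R * u ^+ 2 ->
    M * (N%:R * u ^+ 2 + ln N%:R) <= K ->
    (forall k, expR (16 / s0 * u * `|f k|) <= D ^+ k.+1 * Num.sqrt k`!%:R) ->
    let P := urn_prob R n (fun x : 'I_N -> nat =>
        N%:R * (pmean r h + u) < \sum_(m < N) h (x m)) in
    let p := N%:R * u ^+ 2 / (2 * resid_var r h) in
    expR (- ((1 + del) * p)) <= P /\ P <= expR (- ((1 - del) * p)).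
Proof.
move=> l00 l01 D1 s00 B0 del0.
pose d := (8 + 8 / del)^-1.
have di0 : 0 < 8 / del by rewrite divr_gt0.
have d0 : 0 < d by rewrite invr_gt0; lra.
have d8 : d <= 8^-1 by rewrite /d lef_pV2 ?posrE//; lra.
have ddel : 8 * d <= del.
  rewrite /d ler_pdivrMr; last lra.
  have -> : del * (8 + 8 / del) = del * 8 + 8 by field; rewrite gt_eqF.
  lra.
clearbody d; clear di0.
pose D2 := D + (1 + B) * 2 + D * expR 1.
have e1 : 1 <= expR (1 : R) by rewrite -[leLHS]expR0 ler_expR.
have De0 : 0 <= D * expR 1 by rewrite mulr_ge0 ?expR_ge0//; lra.
have D21 : 1 <= D2 by rewrite /D2; lra.
have DD2 : D * expR 1 <= D2 by rewrite /D2; lra.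
have s20 : 0 < s0 / 2 by rewrite divr_gt0.
have [M1 [M11 HL]] := core_lower l00 l01 D21 s20 d0.
have [M2 [M21 HU]] := core_upper l00 l01 D21 s20 d0.
have [C [C1 HC]] := trunc_close l00 l01 D1.
have [S [S1 HS]] := tilt_mgf l00 l01 D1.
pose c1 := C / d; pose c2 := C / (d * s0); pose c3 := 16 / s0 * B.
pose c4 := (2 * s0)^-1; pose c5 := 2 * S / d.
have c10 : 0 < c1 by rewrite divr_gt0//; lra.
have c20 : 0 < c2 by rewrite divr_gt0 ?mulr_gt0//; lra.
have c30 : 0 <= c3 by rewrite mulr_ge0// divr_ge0// ltW.
have c40 : 0 < c4 by rewrite invr_gt0 mulr_gt0.
have c50 : 0 < c5 by rewrite divr_gt0//; lra.
pose M := 2 * M1 + 2 * M2 + c1 + c2 + c3 + c4 + c5.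
have M_1 : 1 <= M by rewrite /M; clear -M11 M21 c10 c20 c30 c40 c50; lra.
have Mc1 : c1 <= M by rewrite /M; clear -M11 M21 c10 c20 c30 c40 c50; lra.
have Mc2 : c2 <= M by rewrite /M; clear -M11 M21 c10 c20 c30 c40 c50; lra.
have Mc3 : c3 <= M by rewrite /M; clear -M11 M21 c10 c20 c30 c40 c50; lra.
have Mc4 : c4 + M2 <= M by rewrite /M; clear -M11 M21 c10 c20 c30 c40 c50; lra.
have Mc5 : c5 <= M by rewrite /M; clear -M11 M21 c10 c20 c30 c40 c50; lra.
have MM1 : 2 * M1 <= M by rewrite /M; clear -M11 M21 c10 c20 c30 c40 c50; lra.
have MM2 : 2 * M2 <= M by rewrite /M; clear -M11 M21 c10 c20 c30 c40 c50; lra.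
clearbody M; exists M; split=> //.
move=> N n r u K h f N0 n0 Nr lrl th tf fB fh fhK sh u0 uM MN MK dom P p.
have /andP[lr rl] := lrl.
have NR : 0 < N%:R :> R by rewrite ltr0n.
have NR1 : 1 <= N%:R :> R by rewrite ler1n.
have r0 : 0 < r by exact: lt_le_trans lr.
have r0w := ltW r0.
have lnN : 0 <= ln (N%:R : R) by rewrite ln_ge0.
have Nu0 : 0 < N%:R * u ^+ 2 by rewrite mulr_gt0// exprn_gt0.
have M0 : 0 < M by exact: lt_le_trans M_1.
have u1 : u <= 1.
  by apply: le_trans uM; rewrite ler_peMr// ltW.
have uc c : c <= M -> u * c <= 1.
  by move=> cM; apply: le_trans uM; rewrite ler_pM2l.
(* K exceeds ln N, hence the errors expR (- K) are at most 1 / N, which is small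
   against u because N * u >= M ^ 2. *)
have hK : ln N%:R <= K.
  apply: le_trans MK; apply: (@le_trans _ _ (N%:R * u ^+ 2 + ln N%:R)).
    by rewrite lerDr ltW.
  by rewrite ler_peMl// addr_ge0// ltW.
have eK : expR (- K) <= N%:R^-1.
  rewrite expRN lef_pV2 ?posrE ?expR_gt0//.
  by rewrite -{1}(@lnK R N%:R) ?posrE// ler_expR.
have [cl1 cl2] := HC r K h f lrl th tf fhK.
have Nu : M * M <= N%:R * u.
  apply: (@le_trans _ _ (M * (N%:R * u ^+ 2))); first by rewrite ler_pM2l.
  have -> : M * (N%:R * u ^+ 2) = (u * M) * (N%:R * u) by ring.
  by rewrite ler_piMl// ltW// mulr_gt0.
have CK1 : C * expR (- K) <= d * u.
  apply: (@le_trans _ _ (C / N%:R)); first by rewrite ler_pM2l//; clear -C1; lra.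
  rewrite ler_pdivrMr//.
  have : c1 <= N%:R * u.
    apply: le_trans Mc1 (le_trans _ Nu); rewrite ler_peMl// ltW//.
  by rewrite /c1 ler_pdivrMr// => H; apply: le_trans H _; rewrite le_eqVlt; apply/orP; left; apply/eqP; ring.
have CK2 : C * expR (- K) <= d * s0.
  apply: (@le_trans _ _ (C / N%:R)); first by rewrite ler_pM2l//; clear -C1; lra.
  rewrite ler_pdivrMr//.
  have : c2 <= N%:R.
    apply: le_trans Mc2 (le_trans MN _); rewrite ler_piMr ?(ltW NR)//.
    by rewrite exprn_ile1// ltW.
  by rewrite /c2 ler_pdivrMr ?mulr_gt0// mulrC.
have sh0 : 0 < resid_var r h by exact: lt_le_trans sh.
have [_ sS _] := HS r h lrl th.
have [sg sgE] : exists sg, sg = resid_var r h by exists (resid_var r h).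
have [q qE] : exists q, q = N%:R * u ^+ 2 / (2 * sg) by exists (N%:R * u ^+ 2 / (2 * sg)).
rewrite -sgE in sh sh0 sS cl2; have pE : p = q by rewrite /p -sgE qE.
rewrite {}pE {p}; move: q qE => p pE.
have [uf ufD] : exists uf, uf = pmean r h - pmean r f + u by exists (pmean r h - pmean r f + u).
have afh : pmean r f <= pmean r h by apply: (ispm_le r0w (pmean_cvg r0w tf) (pmean_cvg r0w th)).
have uf1 : u <= uf by rewrite ufD lerDr subr_ge0.
have uf2 : uf <= (1 + d) * u.
  by rewrite ufD; move: (le_trans (ler_norm _) (le_trans cl1 CK1)); clear; lra.
have uf0 : 0 < uf by exact: lt_le_trans uf1.
have uf3 : uf <= 2 * u by apply: le_trans uf2 _; rewrite ler_pM2r//; clear -d8; lra.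
pose g j := f j + B * j%:R.
have tg : tame D2 g.
  apply: tame_le (tameD tf (tameZ B tame_nat)).
  by rewrite /D2 ger0_norm//; clear -De0; lra.
have gS k : g k <= g k.+1.
  by rewrite /g -natr1; have := fB k; clear; lra.
have ag : pmean r g = pmean r f + B * r.
  exact: ispmE (ispmD (pmean_cvg r0w tf) (ispmZ B (ispm_nat r))).
have vg : resid_var r g = resid_var r f.
  rewrite /resid_var; congr (pmean r _); apply/funext => k.
  by rewrite /g (resid_affine B k r0 tf).
have sclose : `|sg - resid_var r g| <= d * sg.
  rewrite vg; apply: le_trans cl2 (le_trans CK2 _); by rewrite ler_pM2l.
have sg2 : s0 / 2 <= resid_var r g.
  move: sclose; rewrite ler_distl => /andP[_ h2].
  have : d * sg <= 8^-1 * sg by rewrite ler_pM2r.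
  by clear -h2 sh s00; lra.
have ufM1 : uf * M1 <= 1.
  have M10 : 0 <= M1 by clear -M11; lra.
  apply: le_trans (ler_wpM2r M10 uf3) _.
  by have := uc _ MM1; clear; lra.
have ufM2 : uf * M2 <= 1.
  have M20 : 0 <= M2 by clear -M21; lra.
  apply: le_trans (ler_wpM2r M20 uf3) _.
  by have := uc _ MM2; clear; lra.
have Nuf : M <= N%:R * uf ^+ 2.
  apply: le_trans MN _; rewrite (ler_pM2l NR).
  by rewrite lerXn2r ?nnegrE ?(ltW u0) ?(ltW uf0).
have Nuf1 : M1 <= N%:R * uf ^+ 2.
  by apply: le_trans Nuf; clear -M11 MM1; lra.
have Nuf2 : M2 <= N%:R * uf ^+ 2.
  by apply: le_trans Nuf; clear -M21 MM2; lra.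
have domg := dom_affine s00 B0 (le_trans ler01 D1) u0 (ltW uf0) uf3 (uc _ Mc3) DD2 dom.
have ufE : pmean r h + u = pmean r f + uf by rewrite ufD; ring.
have sumg (x : 'I_N -> nat) : tot x = n ->
    \sum_(m < N) g (x m) = \sum_(m < N) f (x m) + N%:R * (B * r).
  move=> xn; rewrite /g big_split/= -mulr_sumr -natr_sum -/(tot x) xn -Nr.
  by congr (_ + _); ring.
have [ex1 ex2] := exponent_close NR u0 sh0 d0 d8 uf1 uf2 sclose.
rewrite -pE in ex1 ex2.
have sg20 : 0 < 2 * sg by rewrite (pmulr_rgt0 _ (ltr0Sn R 1)).
have p0 : 0 < p by rewrite pE (divr_gt0 Nu0 sg20).
have hl := HL N n r uf g N0 Nr lrl tg gS sg2 uf0 ufM1 Nuf1 domg.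
have hu := HU N n r uf K g N0 n0 Nr lrl tg gS sg2 uf0 ufM2 Nuf2 domg.
have NgE : N%:R * (pmean r g + uf) = N%:R * (pmean r h + u) + N%:R * (B * r).
  by rewrite ag ufE; ring.
have lowP : urn_prob R n (fun x : 'I_N -> nat =>
    N%:R * (pmean r g + uf) < \sum_(m < N) g (x m)) <= P.
  apply: urn_prob_mono => x xn; rewrite (sumg x xn) NgE ltrD2r => H.
  by apply: lt_le_trans H _; apply: ler_sum => m _; apply: fh.
have uppP : P <= urn_prob R n (fun x : 'I_N -> nat =>
    (N%:R * (pmean r g + uf) < \sum_(m < N) g (x m)) || [exists m, K < (x m)%:R]).
  apply: urn_prob_mono => x xn H; rewrite (sumg x xn) NgE ltrD2r.
  case: (boolP [exists m, K < (x m)%:R]) => [_|nK]; first by rewrite orbT.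
  rewrite orbF; suff -> : \sum_(m < N) f (x m) = \sum_(m < N) h (x m) by [].
  apply: eq_bigr => m _; apply: fhK; rewrite leNgt; apply/negP => Km.
  by move/existsP: nK; apply; exists m.
have h4 : p <= c4 * (N%:R * u ^+ 2).
  rewrite pE /c4 (mulrC _ (N%:R * u ^+ 2)) (ler_pM2l Nu0).
  by rewrite lef_pV2 ?posrE ?(mulr_gt0 _ s00) ?sg20// (ler_pM2l (ltr0Sn R 1)).
have tailP := absorb_tail NR (lnK (NR : N%:R \is Num.pos)) M21 (le_trans M_1 MN) h4 Mc4 M_1 lnN MK.
have dp : 1 <= d * p.
  have hc5 := le_trans Mc5 MN.
  have -> : d * p = d * (N%:R * u ^+ 2) / (2 * sg) by rewrite pE mulrA.
  rewrite (ler_pdivlMr _ _ sg20) mul1r.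
  move: hc5; rewrite /c5 (ler_pdivrMr _ _ d0) (mulrC _ d) => hc5.
  by apply: le_trans hc5; clear -sS; lra.
have delp : (8 * d) * p <= del * p by rewrite (ler_pM2r p0).
split.
  apply: le_trans (le_trans hl lowP); rewrite ler_expR lerN2.
  by apply: le_trans ex1 _; clear -delp; lra.
apply: le_trans uppP (le_trans hu _).
apply: (le_trans (lerD (lexx _) tailP)).
apply: (@le_trans _ _ (expR 1 * expR (- ((1 - 2 * d) * p)))).
  have a1 : expR (- ((1 - d) * (N%:R * uf ^+ 2 / (2 * resid_var r g)))) <=
      expR (- ((1 - 2 * d) * p)) by rewrite ler_expR lerN2.
  have a2 : expR (- p) <= expR (- ((1 - 2 * d) * p)).
    by rewrite ler_expR lerN2; clear -dp; lra.
  apply: (le_trans (lerD a1 a2)).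
  have := expR_ge1Dx (1 : R); have := expR_ge0 (- ((1 - 2 * d) * p)).
  by move: (expR _) (expR 1) => a b a0 b0; clear -a0 b0; nra.
by rewrite -expRD ler_expR; clear -delp dp; lra.
Qed.

End Truncation.

(** * Power divergence functions *)


Section PowerDivergence.
Context {R : realType}.
Implicit Types (d r a t : R) (k : nat).

Lemma xlnx_ge (t : R) : 0 <= t -> t - 1 <= t * ln t.
Proof.
rewrite le_eqVlt => /predU1P[<-|t0]; first by rewrite mul0r; lra.
have h : -1 < t^-1 - 1 by have : 0 < t^-1 by [rewrite invr_gt0]; lra.
have := le_ln1Dx h; rewrite addrC subrK lnV ?posrE// => H.
have := ler_wpM2l (ltW t0) H; rewrite mulrBr divff ?gt_eqF// mulr1 mulrN; lra.
Qed.

(** Bernoulli's inequality for a real exponent: t ^ a = t * e ^ ((a - 1) ln t)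
    is at least t + (a - 1) * t ln t, and t ln t >= t - 1. *)
Lemma powR_bernoulli_ge (a t : R) : 1 <= a -> 0 <= t -> 1 + a * (t - 1) <= t `^ a.
Proof.
move=> a1; rewrite le_eqVlt => /predU1P[<-|t0].
  by rewrite powR0 ?gt_eqF//; lra.
have -> : t `^ a = t * expR ((a - 1) * ln t).
  have a0 : 0 < a by lra.
  by rewrite -(mulr_powRB1 (ltW t0) a0) /powR gt_eqF.
have h1 := expR_ge1Dx ((a - 1) * ln t).
have h2 := ler_wpM2l (ltW t0) h1.
have h3 := xlnx_ge (ltW t0).
have a10 : 0 <= a - 1 by lra.
have h4 := ler_wpM2l a10 h3.
by apply: le_trans h2; clear -h4; lra.
Qed.

(** The previous inequality at t ^ a with the exponent 1 / a. *)
Lemma powR_bernoulli_le (a t : R) : 0 < a -> a <= 1 -> 0 <= t -> t `^ a <= 1 + a * (t - 1).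
Proof.
move=> a0 a1 t0; have ai : 1 <= a^-1 by rewrite invf_ge1.
have := powR_bernoulli_ge ai (powR_ge0 t a).
rewrite -powRrM divff ?gt_eqF// powRr1// => H.
have := ler_wpM2l (ltW a0) H.
by rewrite mulrDr mulr1 mulrA divff ?gt_eqF// mul1r; lra.
Qed.

Definition pd_coef d : R := 2 / (d * (d + 1)).

Lemma power_divE d r k : d != 0 -> -1 < d -> 0 < r ->
  power_div d r k = pd_coef d * (r^-1 `^ d * k%:R `^ (1 + d) - k%:R).
Proof.
move=> d0 d1 r0; rewrite /power_div (negbTE d0) -/(pd_coef d).
have a0 : 0 < 1 + d by lra.
have := mulr_powRB1 (ler0n R k) a0.
have -> : 1 + d - 1 = d by ring.
move=> <-.
by rewrite powRM ?invr_ge0 ?(ltW r0)//; ring.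
Qed.

(** After division by k + 1 the two neighbours average to 1, and Bernoulli's
    inequality at both of them gives midpoint convexity. *)
Lemma powR_midpoint_ge a k : 1 <= a ->
  0 <= k.+2%:R `^ a - 2 * k.+1%:R `^ a + (k%:R : R) `^ a.
Proof.
move=> a1; have m0 : 0 < k.+1%:R :> R by rewrite ltr0n.
have e (j : nat) : j%:R `^ a = k.+1%:R `^ a * (j%:R / k.+1%:R) `^ a :> R.
  by rewrite -powRM ?divr_ge0// mulrC divfK ?gt_eqF.
rewrite (e k.+2) (e k).
have -> (x y z : R) : x * y - 2 * x + x * z = x * (y + z - 2) by ring.
rewrite mulr_ge0 ?powR_ge0//.
have h1 := powR_bernoulli_ge a1 (_ : 0 <= k.+2%:R / k.+1%:R).
have h2 := powR_bernoulli_ge a1 (_ : 0 <= k%:R / k.+1%:R).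
have {}h1 := h1 (divr_ge0 (ler0n R _) (ler0n R _)).
have {}h2 := h2 (divr_ge0 (ler0n R _) (ler0n R _)).
have s : k.+2%:R / k.+1%:R + k%:R / k.+1%:R = 2 :> R.
  rewrite -mulrDl -natrD (_ : (k.+2 + k)%N = (2 * k.+1)%N); last lia.
  by rewrite natrM mulfK ?gt_eqF.
move: (k.+2%:R / k.+1%:R) (k%:R / k.+1%:R) s h1 h2 => x y s h1 h2.
have : a * (x - 1) + a * (y - 1) = 0.
  have -> : y = 2 - x by lra.
  ring.
lra.
Qed.

Lemma powR_midpoint_le a k : 0 < a -> a <= 1 ->
  k.+2%:R `^ a - 2 * k.+1%:R `^ a + (k%:R : R) `^ a <= 0.
Proof.
move=> a0 a1; have m0 : 0 < k.+1%:R :> R by rewrite ltr0n.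
have e (j : nat) : j%:R `^ a = k.+1%:R `^ a * (j%:R / k.+1%:R) `^ a :> R.
  by rewrite -powRM ?divr_ge0// mulrC divfK ?gt_eqF.
rewrite (e k.+2) (e k).
have -> (x y z : R) : x * y - 2 * x + x * z = x * (y + z - 2) by ring.
rewrite mulr_ge0_le0 ?powR_ge0//.
have h1 := powR_bernoulli_le a0 a1 (divr_ge0 (ler0n R k.+2) (ler0n R k.+1)).
have h2 := powR_bernoulli_le a0 a1 (divr_ge0 (ler0n R k) (ler0n R k.+1)).
have s : k.+2%:R / k.+1%:R + k%:R / k.+1%:R = 2 :> R.
  rewrite -mulrDl -natrD (_ : (k.+2 + k)%N = (2 * k.+1)%N); last lia.
  by rewrite natrM mulfK ?gt_eqF.
move: (k.+2%:R / k.+1%:R) (k%:R / k.+1%:R) s h1 h2 => x y s h1 h2.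
have : a * (x - 1) + a * (y - 1) = 0.
  have -> : y = 2 - x by lra.
  ring.
lra.
Qed.

Lemma pd_coef_gt0 d : 0 < d -> 0 < pd_coef d.
Proof. by move=> d0; rewrite /pd_coef divr_gt0// mulr_gt0//; lra. Qed.

Lemma pd_coef_lt0 d : -1 < d -> d < 0 -> pd_coef d < 0.
Proof. by move=> d1 d0; rewrite /pd_coef pmulr_rlt0// invr_lt0 nmulr_rlt0//; lra. Qed.

Lemma xlnx_midpoint r k : 0 < r ->
  0 <= k.+2%:R * ln (k.+2%:R / r) - 2 * (k.+1%:R * ln (k.+1%:R / r)) + k%:R * ln (k%:R / r).
Proof.
move=> r0; have m0 : 0 < k.+1%:R :> R by rewrite ltr0n.
pose L := ln (k.+1%:R / r).
have lr (j : nat) : (0 < j)%N -> ln (j%:R / r) = ln (j%:R / k.+1%:R) + L.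
  move=> j0; rewrite /L -lnM ?posrE ?divr_gt0 ?ltr0n//.
  by rewrite mulrA divfK ?gt_eqF.
have e (j : nat) : j%:R * ln (j%:R / r) = k.+1%:R * ((j%:R / k.+1%:R) * ln (j%:R / k.+1%:R)) + j%:R * L.
  case: j => [|j]; first by rewrite !mul0r mulr0 addr0.
  by rewrite lr// mulrDr mulrA (mulrC k.+1%:R) divfK ?gt_eqF.
rewrite (e k.+2) (e k) -/L.
have h1 := xlnx_ge (divr_ge0 (ler0n R k.+2) (ler0n R k.+1)).
have h2 := xlnx_ge (divr_ge0 (ler0n R k) (ler0n R k.+1)).
have s : k.+2%:R / k.+1%:R + k%:R / k.+1%:R = 2 :> R.
  rewrite -mulrDl -natrD (_ : (k.+2 + k)%N = (2 * k.+1)%N); last lia.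
  by rewrite natrM mulfK ?gt_eqF.
have -> (x y : R) : k.+1%:R * x + k.+2%:R * L - 2 * (k.+1%:R * L) + (k.+1%:R * y + k%:R * L) =
   k.+1%:R * (x + y).
  by rewrite -!(natr1 k.+1) -(natr1 k); ring.
rewrite mulr_ge0//; move: s h1 h2.
move: (k.+2%:R / k.+1%:R) (k%:R / k.+1%:R) => x y s h1 h2; lra.
Qed.

(** The power divergence is convex: the coefficient 2 / (d (d + 1)) changes
    sign at d = 0 together with the convexity of x ^ (1 + d). *)
Lemma power_div_diff2_ge0 d r k : -1 < d -> 0 < r -> 0 <= diff2 (power_div d r) k.
Proof.
move=> d1 r0; rewrite /diff2.
have [->|d0] := eqVneq d 0.
  rewrite /power_div eqxx; have := xlnx_midpoint k r0.
  by rewrite -!mulrA; lra.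
rewrite !power_divE//.
set V := r^-1 `^ d; have V0 : 0 < V by rewrite powR_gt0// invr_gt0.
have -> : pd_coef d * (V * k.+2%:R `^ (1 + d) - k.+2%:R) - 2 * (pd_coef d * (V * k.+1%:R `^ (1 + d) - k.+1%:R)) +
   pd_coef d * (V * k%:R `^ (1 + d) - k%:R) =
   pd_coef d * (V * (k.+2%:R `^ (1 + d) - 2 * k.+1%:R `^ (1 + d) + k%:R `^ (1 + d))).
  by rewrite -!(natr1 k.+1) -(natr1 k); ring.
have [dn|dp] := ltP d 0.
  have a0 : 0 < 1 + d by lra.
  have a1 : 1 + d <= 1 by lra.
  apply: mulr_le0; first exact: ltW (pd_coef_lt0 d1 dn).
  by rewrite pmulr_rle0//; exact: powR_midpoint_le.
have dp' : 0 < d by rewrite lt_neqAle eq_sym d0.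
have a1 : 1 <= 1 + d by lra.
by rewrite mulr_ge0 ?(ltW (pd_coef_gt0 dp'))// mulr_ge0 ?(ltW V0)// powR_midpoint_ge.
Qed.

Lemma power_div0 d r : power_div d r 0 = 0.
Proof. by rewrite /power_div; case: ifP => _; rewrite mulr0 mul0r. Qed.

Lemma powR_rate_bounds d (l0 l1 : R) : 0 < l0 -> l0 <= l1 ->
  exists v V : R, 0 < v /\ forall r, l0 <= r <= l1 -> v <= r^-1 `^ d <= V.
Proof.
move=> l00 l01; have l10 : 0 < l1 by exact: lt_le_trans l01.
have i0 : 0 < l0^-1 by rewrite invr_gt0.
have i1 : 0 < l1^-1 by rewrite invr_gt0.
have [d0|d0] := leP 0 d.
  exists (l1^-1 `^ d), (l0^-1 `^ d); split; first exact: powR_gt0.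
  move=> r /andP[r0 r1]; have rp : 0 < r by exact: lt_le_trans r0.
  by rewrite !ge0_ler_powR ?nnegrE ?invr_ge0 ?(ltW rp) ?(ltW l00) ?(ltW l10)// lef_pV2.
exists (l0^-1 `^ d), (l1^-1 `^ d); split; first exact: powR_gt0.
move=> r /andP[r0 r1]; have rp : 0 < r by exact: lt_le_trans r0.
have dn : 0 <= - d by lra.
have e (x : R) : x `^ d = (x `^ (- d))^-1 by rewrite -powRN opprK.
rewrite !e !lef_pV2 ?posrE ?powR_gt0 ?invr_gt0//.
by rewrite !ge0_ler_powR ?nnegrE ?invr_ge0 ?(ltW rp) ?(ltW l00) ?(ltW l10)// lef_pV2.
Qed.

Lemma power_div_diff2_0 d (l0 l1 : R) : -1 < d -> 0 < l0 -> l0 <= l1 ->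
  exists2 b, 0 < b & forall r, l0 <= r <= l1 -> b <= diff2 (power_div d r) 0.
Proof.
move=> d1 l00 l01.
have [->|d0] := eqVneq d 0.
  exists (4 * ln 2); first by rewrite mulr_gt0// ln_gt0//; lra.
  move=> r /andP[r0 r1]; have rp : 0 < r by exact: lt_le_trans r0.
  rewrite /diff2 power_div0 addr0 /power_div eqxx.
  rewrite !ln_div ?posrE ?ltr0n// ln1.
  by rewrite le_eqVlt; apply/orP; left; apply/eqP; ring.
have [v [V [v0 vV]]] := powR_rate_bounds d l00 l01.
pose q := 2 * pd_coef d * (2 `^ d - 1).
have q0 : 0 < q.
  have [dn|dp] := ltP d 0.
    have : 2 `^ d < 1.
      by rewrite /powR gt_eqF// -[ltRHS]expR0 ltr_expR nmulr_rlt0// ln_gt0//; lra.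
    have := pd_coef_lt0 d1 dn; rewrite /q => h1 h2; nra.
  have dp' : 0 < d by rewrite lt_neqAle eq_sym d0.
  have : 1 < 2 `^ d.
    by rewrite /powR gt_eqF// -[ltLHS]expR0 ltr_expR mulr_gt0// ?ln_gt0//; lra.
  rewrite /q -subr_gt0 => h1.
  by apply: mulr_gt0 => //; apply: mulr_gt0 => //; exact: pd_coef_gt0.
exists (q * v); first by rewrite mulr_gt0.
move=> r lr; have /andP[r0 r1] := lr; have rp : 0 < r by exact: lt_le_trans r0.
have /andP[vr _] := vV r lr.
rewrite /diff2 power_div0 addr0 /power_div (negbTE d0) -/(pd_coef d) mul1r.
rewrite powRM ?invr_ge0 ?(ltW rp)//.
have -> : pd_coef d * 2 * (2 `^ d * r^-1 `^ d - 1) - 2 * (pd_coef d * 1 * (r^-1 `^ d - 1)) = q * r^-1 `^ d.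
  by rewrite /q; ring.
by rewrite ler_pM2l.
Qed.

Lemma nat_powR_le d k : (0 < k)%N -> k%:R `^ d <= (1 + 2 `^ d) ^+ k :> R.
Proof.
move=> k0; have k1 : 1 <= k%:R :> R by rewrite ler1n.
have p0 : 0 <= 2 `^ d :> R by apply: powR_ge0.
have [d0|d0] := leP 0 d; last first.
  apply: (@le_trans _ _ 1); last by rewrite exprn_ege1//; lra.
  by rewrite -[leRHS](powRr0 k%:R) ler_powR// ltW.
apply: (@le_trans _ _ ((2 `^ d) ^+ k)); last by rewrite lerXn2r ?nnegrE//; lra.
have -> : (2 `^ d) ^+ k = (2 ^+ k) `^ d :> R.
  by rewrite -powR_mulrn// -powRrM mulrC powRrM powR_mulrn.
by rewrite ge0_ler_powR ?nnegrE// -natrX ler_nat ltnW// ltn_expl.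
Qed.

Lemma ln_rate_bounds (l0 l1 r : R) : 0 < l0 -> l0 <= r <= l1 ->
  `|ln r| <= `|ln l0| + `|ln l1|.
Proof.
move=> l00 /andP[r0 r1]; have rp : 0 < r by exact: lt_le_trans r0.
have lp : 0 < l1 by exact: lt_le_trans r1.
have h1 : ln l0 <= ln r by rewrite ler_ln ?posrE.
have h2 : ln r <= ln l1 by rewrite ler_ln ?posrE.
have h3 := ler_norm (ln l1); have h4 := ler_norm (- ln l0); rewrite normrN in h4.
have h5 := normr_ge0 (ln l0); have h6 := normr_ge0 (ln l1).
by rewrite ler_norml; apply/andP; split; lra.
Qed.

Lemma tame_power_div d (l0 l1 : R) : -1 < d -> 0 < l0 -> l0 <= l1 ->
  exists D : R, forall r, l0 <= r <= l1 -> tame D (power_div d r).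
Proof.
move=> d1 l00 l01.
have [->|d0] := eqVneq d 0.
  pose L := `|ln l0| + `|ln l1|.
  have L0 : 0 <= L by rewrite addr_ge0.
  exists ((1 + `|2|) * 2 * (2 + (1 + `|L|))) => r lr.
  have /andP[r0 r1] := lr; have rp : 0 < r by exact: lt_le_trans r0.
  have tl : tame (2 + (1 + `|L|)) (fun k => k%:R + L) := tameD tame_nat (tame_cst L).
  apply: tame_bound (tameM (tameZ 2 tame_nat) tl) => k.
  rewrite /power_div eqxx !normrM; case: k => [|k]; first by rewrite normr0 !mulr0 !mul0r.
  rewrite ler_wpM2l ?mulr_ge0// [leRHS]ger0_norm ?addr_ge0//.
  rewrite ln_div ?posrE ?ltr0n// (le_trans (ler_normB _ _))// lerD ?ln_rate_bounds//.
  rewrite ger0_norm ?ln_ge0 ?ler1n//.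
  by rewrite ltW// ln_sublinear// ltr0n.
have [v [V [v0 vV]]] := powR_rate_bounds d l00 l01.
have V0 : 0 < V by have /andP[h1 h2] := vV l0 (introT andP (conj (lexx _) l01)); lra.
pose W := 1 + 2 `^ d : R.
have W1 : 1 <= W by rewrite /W lerDl powR_ge0.
exists ((1 + `|pd_coef d|) * 2 * ((1 + V) * W + (1 + `|1|))) => r lr.
have /andP[r0 r1] := lr; have rp : 0 < r by exact: lt_le_trans r0.
have /andP[_ rV] := vV r lr.
have tp : tame ((1 + V) * W) (fun k => (k%:R / r) `^ d).
  split=> [|k]; first by rewrite mulr_ege1//; lra.
  rewrite ger0_norm ?powR_ge0//; case: k => [|k].
    by rewrite mul0r powR0// exprn_ge0// mulr_ge0//; lra.
  rewrite powRM ?invr_ge0 ?(ltW rp)// exprMn mulrC ler_pM ?powR_ge0//.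
    apply: (le_trans rV); apply: (@le_trans _ _ (1 + V)); first lra.
    by rewrite -[leLHS]expr1 ler_weXn2l//; lra.
  apply: (le_trans (nat_powR_le d (ltn0Sn k))).
  by rewrite -/W (exprS _ k.+1) ler_peMl// exprn_ge0//; lra.
apply: eq_tame (tameM (tameZ (pd_coef d) tame_nat) (tameB tp (tame_cst 1))) => k.
by rewrite /power_div (negbTE d0).
Qed.

Lemma diff2_slope (h : nat -> R) : (forall k, 0 <= diff2 h k) ->
  forall k, h 1%N - h 0%N <= h k.+1 - h k.
Proof.
move=> h2; elim=> [|k IH]; first exact: lexx.
by apply: le_trans IH _; have := h2 k; rewrite /diff2; lra.
Qed.

(** By convexity every increment is at least the first one, so the function
    never decreases by more than a constant. *)
Lemma power_div_slope d r D : -1 < d -> 0 < r -> tame D (power_div d r) ->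
  forall k, power_div d r k - D ^+ 2 <= power_div d r k.+1.
Proof.
move=> d1 r0 [_ tD] k.
have := diff2_slope (fun j => power_div_diff2_ge0 j d1 r0) k.
rewrite power_div0 subr0; have := tD 1%N; rewrite ler_norml => /andP[h _]; lra.
Qed.

Lemma sqrt_fact_ge1 k : 1 <= Num.sqrt (k`!%:R : R).
Proof. by rewrite -[leLHS]sqrtr1 ler_wsqrtr// ler1n fact_gt0. Qed.

(** This is n ^ n / n! <= e ^ n, one term of the exponential series. *)
Lemma k_lnk_le k : k%:R * ln (k%:R : R) <= ln k`!%:R + k%:R.
Proof.
case: k => [|k]; first by rewrite mul0r fact0 ln1 addr0.
set n := k.+1; have n0 : 0 < n%:R :> R by rewrite ltr0n.
have f0 : 0 < n`!%:R :> R by rewrite ltr0n fact_gt0.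
have h : n%:R ^+ n <= n`!%:R * expR n%:R :> R.
  have := exp_sum_le n.+1 (ltW n0); rewrite big_nat_recr//= => H.
  rewrite mulrC -ler_pdivrMr//; apply: le_trans H; rewrite lerDr.
  by apply: sumr_ge0 => i _; rewrite divr_ge0 ?exprn_ge0 ?ltW.
have : ln (n%:R ^+ n) <= ln (n`!%:R * expR n%:R) :> R.
  by rewrite ler_ln ?posrE ?mulr_gt0 ?expR_gt0 ?exprn_gt0.
by rewrite lnM ?posrE ?expR_gt0// expRK lnXn// mulr_natl.
Qed.

(** For d <= 0 the function grows at most like k ln k, so for small u the
    exponential of c * u times it is below a geometric factor times sqrt (k!). *)
Lemma power_div_dom_le0 d (l0 l1 c : R) : -1 < d -> d <= 0 -> 0 < l0 -> l0 <= l1 -> 0 < c ->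
  exists D e : R, [/\ 1 <= D, 0 < e & forall r u, l0 <= r <= l1 -> 0 < u -> u <= e ->
    forall k, expR (c * u * `|power_div d r k|) <= D ^+ k.+1 * Num.sqrt k`!%:R].
Proof.
move=> d1 dle l00 l01 c_0.
have grow (A x : R) k : 0 <= A -> x <= A * k%:R -> expR x <= expR A ^+ k.+1.
  move=> A0 xA; rewrite -expRM_natr ler_expR (le_trans xA)// ler_wpM2l// ler_nat.
  exact: leqnSn.
have [->|d0] := eqVneq d 0.
  pose L := `|ln l0| + `|ln l1|.
  have L0 : 0 <= L by rewrite addr_ge0.
  exists (expR (1 + L)), (4 * c)^-1; split.
  - by rewrite -[leLHS]expR0 ler_expR; lra.
  - by rewrite invr_gt0 mulr_gt0.
  move=> r u lr u0 ue k.
  have /andP[r0 r1] := lr; have rp : 0 < r by exact: lt_le_trans r0.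
  have cu : c * u <= 4^-1.
    have := ler_wpM2l (ltW c_0) ue; rewrite invfM mulrCA divff ?gt_eqF//; lra.
  have cu0 : 0 < c * u by rewrite mulr_gt0.
  have f0 : 0 < k`!%:R :> R by rewrite ltr0n fact_gt0.
  have lf : 0 <= ln (k`!%:R : R) by rewrite ln_ge0// ler1n fact_gt0.
  have hb : `|power_div 0 r k| <= 2 * (ln k`!%:R + k%:R + k%:R * L).
    rewrite /power_div eqxx !normrM (ger0_norm (_ : 0 <= 2))// -mulrA ler_wpM2l//.
    case: k f0 lf => [|k] f0 lf; first by rewrite normr0 !mul0r fact0 ln1 !addr0.
    rewrite normr_nat ln_div ?posrE ?ltr0n//.
    apply: (@le_trans _ _ (k.+1%:R * (ln k.+1%:R + L))).
      rewrite ler_wpM2l// (le_trans (ler_normB _ _))// lerD ?ln_rate_bounds//.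
      by rewrite ger0_norm// ln_ge0// ler1n.
    by rewrite mulrDr lerD2r k_lnk_le.
  apply: (@le_trans _ _ (expR ((1 + L) * k%:R + 2^-1 * ln k`!%:R))).
    rewrite ler_expR; apply: (@le_trans _ _ (4^-1 * (2 * (ln k`!%:R + k%:R + k%:R * L)))).
      by rewrite ler_pM// ltW.
    have kL : 0 <= k%:R * L by rewrite mulr_ge0.
    have kk : 0 <= k%:R :> R by [].
    have -> : (1 + L) * k%:R = k%:R + k%:R * L by ring.
    by clear -kL kk; lra.
  rewrite expRD; apply: ler_pM; rewrite ?expR_ge0//.
    by apply: grow => //; lra.
  by rewrite -powR12_sqrt ?(ltW f0)// /powR gt_eqF.
have dn : d < 0 by rewrite lt_neqAle d0.
have [v [V [v0 vV]]] := powR_rate_bounds d l00 l01.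
have V0 : 0 < V by have /andP[h1 h2] := vV l0 (introT andP (conj (lexx _) l01)); lra.
pose A := c * (`|pd_coef d| * (1 + V)).
have A0 : 0 <= A by rewrite mulr_ge0 ?(ltW c_0)// mulr_ge0//; lra.
exists (expR A), 1; split=> //; first by rewrite -[leLHS]expR0 ler_expR.
move=> r u lr u0 ue k.
have /andP[r0 r1] := lr; have rp : 0 < r by exact: lt_le_trans r0.
have /andP[_ rV] := vV r lr.
apply: (@le_trans _ _ (expR A ^+ k.+1)); last first.
  by rewrite ler_peMr ?sqrt_fact_ge1// exprn_ge0// expR_ge0.
apply: grow => //.
have hb : `|power_div d r k| <= `|pd_coef d| * (1 + V) * k%:R.
  rewrite /power_div (negbTE d0) -/(pd_coef d) normrM (normrM (pd_coef d)) normr_nat mulrAC.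
  case: k => [|k]; first by rewrite !mulr0.
  rewrite ler_wpM2r// ler_wpM2l// (le_trans (ler_normB _ _))// normr1 addrC lerD2l.
  rewrite ger0_norm ?powR_ge0// powRM ?invr_ge0 ?(ltW rp)//.
  apply: le_trans rV; rewrite ler_piMl ?powR_ge0//.
  by rewrite -[leRHS](powRr0 k.+1%:R) ler_powR ?ler1n// ltW.
have -> : A * k%:R = c * 1 * (`|pd_coef d| * (1 + V) * k%:R) by rewrite /A; ring.
by apply: ler_pM => //; [rewrite mulr_ge0 ?ltW|rewrite ler_wpM2l ?(ltW c_0)].
Qed.

(** For d > 0 the function has no exponential moments. The cap k / u gives u
    times the function linear growth, hence moments that are uniform in u, and
    it leaves the function unchanged up to a level of order u ^ (- 1 / d). *)
Definition cutoff (h : nat -> R) (u : R) k : R := Num.min (h k) (k%:R / u).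

Definition cutoff_level d (l0 u : R) : R := l0 * (pd_coef d * u)^-1 `^ d^-1.

Section Cutoff.
Variables (d l0 l1 u r : R).
Hypotheses (d0 : 0 < d) (l00 : 0 < l0) (lr : l0 <= r <= l1) (u0 : 0 < u) (u1 : u <= 1).

Let f := cutoff (power_div d r) u.
Let r0 : 0 < r. Proof. by case/andP: lr => h _; apply: lt_le_trans h. Qed.
Let ku0 k : 0 <= k%:R / u. Proof. by rewrite divr_ge0// ltW. Qed.

Lemma cutoff_le k : f k <= power_div d r k.
Proof. by rewrite /f /cutoff ge_min lexx. Qed.

Lemma power_div_ge k : - (pd_coef d * k%:R) <= power_div d r k.
Proof.
rewrite /power_div (gt_eqF d0) -/(pd_coef d) mulrBr mulr1 lerDr.
by rewrite mulr_ge0 ?powR_ge0// mulr_ge0// ltW ?pd_coef_gt0.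
Qed.

Lemma cutoff_ge k : - (pd_coef d * k%:R) <= f k.
Proof.
rewrite /f /cutoff le_min power_div_ge/=; apply: le_trans (ku0 k).
by rewrite oppr_le0 mulr_ge0// ltW ?pd_coef_gt0.
Qed.

Lemma tame_cutoff D : tame D (power_div d r) -> tame (D + (1 + `|pd_coef d|) * 2) f.
Proof.
move=> th; apply: tame_bound (tameD (tame_norm th) (tameZ (pd_coef d) tame_nat)) => k.
have c00 := pd_coef_gt0 d0.
have ck : 0 <= pd_coef d * k%:R by rewrite mulr_ge0// ltW.
rewrite [leRHS]ger0_norm ?addr_ge0// ler_norml; apply/andP; split.
  by apply: le_trans (cutoff_ge k); rewrite lerN2 lerDr.
by apply: le_trans (cutoff_le k) _; rewrite (le_trans (ler_norm _))// lerDl.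
Qed.

Lemma cutoff_slope B : 0 <= B ->
  (forall k, power_div d r k - B <= power_div d r k.+1) ->
  forall k, f k - B <= f k.+1.
Proof.
move=> B0 hB k; rewrite /f /cutoff le_min; apply/andP; split.
  by apply: le_trans (hB k); rewrite lerD2r ge_min lexx.
apply: (@le_trans _ _ (k%:R / u)); last by rewrite ler_pM2r ?invr_gt0// ler_nat.
by rewrite lerBlDr (@le_trans _ _ (k%:R / u))// ?lerDl// ge_min lexx orbT.
Qed.

Lemma cutoff_dom (c : R) k : 0 < c ->
  expR (c * u * `|f k|) <= expR (c * (1 + pd_coef d)) ^+ k.+1 * Num.sqrt k`!%:R.
Proof.
move=> c_0; have c00 := pd_coef_gt0 d0.
apply: (@le_trans _ _ (expR (c * (1 + pd_coef d)) ^+ k.+1)); last first.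
  by rewrite ler_peMr ?sqrt_fact_ge1// exprn_ge0// expR_ge0.
rewrite -expRM_natr ler_expR -!mulrA ler_pM2l//.
apply: (@le_trans _ _ ((1 + pd_coef d) * k%:R)); last first.
  by rewrite ler_pM2l ?ler_nat//; lra.
have k0 : 0 <= k%:R :> R by [].
have ck : 0 <= pd_coef d * k%:R by rewrite mulr_ge0// ltW.
have -> : u * `|f k| = `|u * f k| by rewrite normrM gtr0_norm.
rewrite ler_norml; apply/andP; split.
  have h := ler_wpM2l (ltW u0) (cutoff_ge k).
  have h2 : u * (pd_coef d * k%:R) <= pd_coef d * k%:R by rewrite ler_piMl.
  by apply: le_trans h; rewrite mulrN lerN2 mulrDl mul1r; lra.
have : u * f k <= u * (k%:R / u) by rewrite ler_pM2l// /f /cutoff ge_min lexx orbT.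
rewrite mulrCA divff ?gt_eqF// mulr1 => h; apply: le_trans h _.
by rewrite mulrDl mul1r lerDl.
Qed.

Lemma cutoff_eq k : k%:R <= cutoff_level d l0 u -> f k = power_div d r k.
Proof.
move=> kK; apply: min_l.
have c00 := pd_coef_gt0 d0; have cu : 0 < pd_coef d * u by rewrite mulr_gt0.
have kr : k%:R / r <= (pd_coef d * u)^-1 `^ d^-1.
  rewrite ler_pdivrMr//; apply: (le_trans kK).
  rewrite /cutoff_level mulrC ler_wpM2l ?powR_ge0//.
  by case/andP: lr.
have h : (k%:R / r) `^ d <= (pd_coef d * u)^-1.
  apply: (@le_trans _ _ (((pd_coef d * u)^-1 `^ d^-1) `^ d)).
    by rewrite ge0_ler_powR ?nnegrE ?powR_ge0 ?divr_ge0 ?(ltW d0) ?(ltW r0).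
  by rewrite -powRrM mulVf ?gt_eqF// powRr1// invr_ge0 ltW.
rewrite /power_div (gt_eqF d0) -/(pd_coef d) (mulrC (pd_coef d)) -mulrA ler_wpM2l//.
have h2 := ler_wpM2l (ltW c00) h.
rewrite invfM mulrA divff ?gt_eqF// mul1r in h2.
by apply: le_trans h2; rewrite ler_pM2l//; lra.
Qed.

End Cutoff.
End PowerDivergence.

(** * From deviations to slopes *)


Section Assembly.
Context {R : realType}.
#[local] Opaque pmean.

(** For d <= 0 the function is not cut off, and N serves as a level that
    dominates N * u ^ 2 + ln N. *)
Definition trunc_level (d l0 : R) (N : nat) (u : R) : R :=
  if d <= 0 then N%:R else cutoff_level d l0 u.

Definition trunc (d : R) (h : nat -> R) (u : R) : nat -> R :=
  if d <= 0 then h else cutoff h u.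

Lemma trunc_le d h u k : trunc d h u k <= h k.
Proof. by rewrite /trunc; case: ifP => // _; rewrite /cutoff ge_min lexx. Qed.

Lemma power_div_uniform (d l0 l1 : R) : -1 < d -> 0 < l0 -> l0 <= l1 ->
  exists D c s0 : R, [/\ 1 <= D, 0 < c & 0 < s0] /\
    forall r, l0 <= r <= l1 ->
    [/\ tame D (power_div d r), c <= curv r (power_div d r), `|curv r (power_div d r)| <= D &
        s0 <= resid_var r (power_div d r)].
Proof.
move=> d1 l00 l01; have l10 : 0 < l1 by exact: lt_le_trans l01.
have [D tD] := tame_power_div d1 l00 l01.
have [b b0 hb] := power_div_diff2_0 d1 l00 l01.
have [w [w0 hw]] := resid_var_ge l00 l01.
have D1 : 1 <= D.
  by have [] : tame D (power_div d l0) by apply: tD; rewrite lexx.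
pose E := D * ((3 + l1) ^+ 2 + 2).
have E1 : D <= E.
  rewrite /E ler_peMr//; first by lra.
  have : 0 <= (3 + l1) ^+ 2 by rewrite exprn_ge0//; lra.
  lra.
have E0 : 0 <= E by lra.
have eE : 1 <= expR (l1 * E) by rewrite -[leLHS]expR0 ler_expR mulr_ge0// ltW.
have DE : D <= E * expR (l1 * E) by apply: le_trans E1 _; rewrite ler_peMr.
exists (E * expR (l1 * E)), (l0 ^+ 2 * expR (- l1) * b), (w * b ^+ 2); split.
  split; first by lra.
    by rewrite !mulr_gt0 ?expR_gt0 ?exprn_gt0.
  by rewrite mulr_gt0 ?exprn_gt0.
move=> r lr; have /andP[r0 r1] := lr; have rp : 0 < r by exact: lt_le_trans r0.
have th := tD r lr.
have h0 k : 0 <= diff2 (power_div d r) k by exact: power_div_diff2_ge0.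
split.
- exact: tame_le th.
- apply: le_trans (curv_ge rp th h0 (hb r lr)).
  rewrite ler_pM2r// ler_pM ?exprn_ge0 ?expR_ge0 ?(ltW l00)//.
    by rewrite lerXn2r ?nnegrE ?(ltW l00) ?(ltW rp).
  by rewrite ler_expR lerN2.
- have r01 : 0 <= r <= l1 by rewrite (ltW rp).
  have tq : tame ((3 + l1) ^+ 2 + 2) (quadp r).
    exact: tameB (tameX 2 (tame_centered r01)) tame_nat.
  apply: le_trans (ispm_norm_le (ltW rp) (tameM th tq) (ispm_curv (ltW rp) th)) _.
  by rewrite ler_wpM2l// ler_expR ler_wpM2r.
- by apply: (hw r D) => //; [exact: ltW|exact: hb].
Qed.

Lemma power_div_deviation (d l0 l1 del : R) : -1 < d -> 0 < l0 -> l0 <= l1 -> 0 < del ->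
  exists M : R, 1 <= M /\ forall (N n : nat) (r u : R), (0 < N)%N -> (0 < n)%N ->
    N%:R * r = n%:R -> l0 <= r <= l1 -> 0 < u -> u * M <= 1 ->
    M <= N%:R * u ^+ 2 -> M * (N%:R * u ^+ 2 + ln N%:R) <= trunc_level d l0 N u ->
    let h := power_div d r in
    let P := urn_prob R n (fun x : 'I_N -> nat =>
        N%:R * (pmean r h + u) < \sum_(m < N) h (x m)) in
    let p := N%:R * u ^+ 2 / (2 * resid_var r h) in
    expR (- ((1 + del) * p)) <= P /\ P <= expR (- ((1 - del) * p)).
Proof.
move=> d1 l00 l01 del0.
have [D [c [s0 [[D1 c_0 s00] hD]]]] := power_div_uniform d1 l00 l01.
have s16 : 0 < 16 / s0 by rewrite divr_gt0.
have [E [e [[e0 DE] tE sE fE dE]]] : exists E e : R, [/\ 0 < e /\ D <= E,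
   forall r u, l0 <= r <= l1 -> 0 < u -> u <= e -> tame E (trunc d (power_div d r) u),
   forall r u, l0 <= r <= l1 -> 0 < u -> u <= e ->
     forall k, trunc d (power_div d r) u k - D ^+ 2 <= trunc d (power_div d r) u k.+1,
   forall (N : nat) r u k, l0 <= r <= l1 -> 0 < u -> u <= e -> k%:R <= trunc_level d l0 N u ->
     trunc d (power_div d r) u k = power_div d r k &
   forall r u, l0 <= r <= l1 -> 0 < u -> u <= e -> forall k,
     expR (16 / s0 * u * `|trunc d (power_div d r) u k|) <= E ^+ k.+1 * Num.sqrt k`!%:R].
  have sl r k : l0 <= r <= l1 -> power_div d r k - D ^+ 2 <= power_div d r k.+1.
    move=> lr; have [th _ _ _] := hD r lr; apply: power_div_slope th k => //.
    by case/andP: lr => h _; apply: lt_le_trans h.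
  rewrite /trunc /trunc_level; have [dle|dgt] := leP d 0.
    have [F [e [F1 e0 hF]]] := power_div_dom_le0 d1 dle l00 l01 s16.
    exists (D + F), e; split=> //; first by lra.
    - move=> r u lr _ _; have [th _ _ _] := hD r lr; apply: tame_le th; lra.
    - by move=> r u lr _ _ k; apply: sl.
    - move=> r u lr u0 ue k; apply: le_trans (hF r u lr u0 ue k) _.
      by rewrite ler_wpM2r ?sqrtr_ge0// lerXn2r ?nnegrE//; lra.
  pose F := expR (16 / s0 * (1 + pd_coef d)); have F0 : 0 < F by exact: expR_gt0.
  have nc := normr_ge0 (pd_coef d).
  exists (D + (1 + `|pd_coef d|) * 2 + F), 1; split=> //; first by lra.
  - move=> r u lr u0 ue; have [th _ _ _] := hD r lr.
    apply: tame_le (tame_cutoff dgt u0 th); lra.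
  - move=> r u lr u0 ue k; apply: (cutoff_slope u0) => [|j]; last exact: sl.
    by rewrite exprn_ge0//; lra.
  - by move=> N r u k lr u0 ue kK; exact: (cutoff_eq dgt l00 lr u0 kK).
  - move=> r u lr u0 ue k; apply: le_trans (cutoff_dom r dgt u0 ue k s16) _.
    rewrite -/F ler_wpM2r ?sqrtr_ge0//; clearbody F.
    by rewrite lerXn2r ?nnegrE//; lra.
have E1 : 1 <= E by lra.
have D20 : 0 <= D ^+ 2 by rewrite exprn_ge0//; lra.
have [M [M1 hM]] := truncated_deviation l00 l01 E1 s00 D20 del0.
have ei0 : 0 < e^-1 by rewrite invr_gt0.
exists (M + e^-1); split; first by lra.
move=> N n r u N0 n0 Nr lr u0 uM MN MK.
have ue : u <= e.
  have h : u * e^-1 <= 1 by apply: le_trans uM; rewrite ler_pM2l//; lra.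
  by move: h; rewrite ler_pdivrMr// mul1r.
have [th _ _ hs] := hD r lr.
have Nu0 : 0 <= N%:R * u ^+ 2 + ln N%:R.
  by rewrite addr_ge0 ?mulr_ge0 ?exprn_ge0 ?(ltW u0)// ln_ge0// ler1n.
apply: (hM N n r u (trunc_level d l0 N u) _ (trunc d (power_div d r) u)) => //.
- exact: tame_le th.
- exact: tE.
- exact: sE.
- by move=> k; apply: trunc_le.
- by move=> k; apply: fE.
- by apply: le_trans uM; rewrite ler_pM2l//; lra.
- by apply: le_trans MN; lra.
- by apply: le_trans MK; rewrite ler_wpM2r//; lra.
- exact: dE.
Qed.

Lemma half_prod_ratio (u e k C eta c del : R) : 0 < e -> 0 < c -> c <= k -> 0 < del ->
  `|u - e / 2 * k| <= C * eta * e -> 2 * C * eta <= del * c ->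
  (1 - del) * (e * k) <= 2 * u <= (1 + del) * (e * k).
Proof.
move=> e0 c0 ck del0; rewrite ler_norml => /andP[h1 h2] h3.
have h4 : del * c * e <= del * (e * k).
  by rewrite -mulrA ler_pM2l// mulrC ler_pM2l.
have h5 : 2 * C * eta * e <= del * c * e by rewrite ler_pM2r.
apply/andP; split; clear -h1 h2 h4 h5; nra.
Qed.

Lemma ratio_close (N u e k s L del : R) : 0 < N -> 0 < e -> 0 < k -> 0 < s -> 0 < del -> del <= 1 ->
  (1 - del) * (e * k) <= 2 * u <= (1 + del) * (e * k) ->
  (1 - del) * (N * u ^+ 2 / (2 * s)) <= L <= (1 + del) * (N * u ^+ 2 / (2 * s)) ->
  `|L * (8 * s) / (N * (e * k) ^+ 2) - 1| <= 7 * del.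
Proof.
move=> N0 e0 k0 s0 d0 d1 /andP[h1 h2] /andP[g1 g2].
have ek : 0 < e * k by rewrite mulr_gt0.
set q := 2 * u / (e * k).
have q1 : 1 - del <= q by rewrite ler_pdivlMr.
have q2 : q <= 1 + del by rewrite ler_pdivrMr.
have Q1 : (1 - del) ^+ 2 <= q ^+ 2 by rewrite lerXn2r ?nnegrE//; clearbody q; lra.
have Q2 : q ^+ 2 <= (1 + del) ^+ 2 by rewrite lerXn2r ?nnegrE//; clearbody q; lra.
have Z0 : 0 < 8 * s / (N * (e * k) ^+ 2) by rewrite divr_gt0 ?mulr_gt0 ?exprn_gt0.
have Ze : N * u ^+ 2 / (2 * s) * (8 * s / (N * (e * k) ^+ 2)) = q ^+ 2.
  by rewrite /q; field; rewrite !gt_eqF.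
have G1 := ler_wpM2r (ltW Z0) g1; have G2 := ler_wpM2r (ltW Z0) g2.
rewrite -(mulrA (1 - del)) Ze in G1; rewrite -(mulrA (1 + del)) Ze in G2.
rewrite -(mulrA L); move: (L * _) G1 G2 => x G1 G2.
have A1 : (1 - del) * (1 - del) ^+ 2 <= x.
  by apply: le_trans G1; rewrite ler_wpM2l//; lra.
have A2 : x <= (1 + del) * (1 + del) ^+ 2.
  by apply: (le_trans G2); rewrite ler_wpM2l//; lra.
have dd : del ^+ 2 <= del by rewrite expr2 ler_piMl// ltW.
have d3 : del ^+ 3 <= del.
  by rewrite exprS ler_piMr ?(ltW d0)//; exact: le_trans dd d1.
have d30 : 0 <= del ^+ 2 by exact: sqr_ge0.
have d33 : 0 <= del ^+ 3 by rewrite exprn_ge0// ltW.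
have e1 : (1 - del) * (1 - del) ^+ 2 = 1 - 3 * del + 3 * del ^+ 2 - del ^+ 3 by ring.
have e2 : (1 + del) * (1 + del) ^+ 2 = 1 + 3 * del + 3 * del ^+ 2 + del ^+ 3 by ring.
rewrite ler_norml; apply/andP; split; clear -A1 A2 dd d3 d30 d33 e1 e2 d0 d1; lra.
Qed.

Lemma eps_ge0 (N : nat) (p : 'I_N -> R) : 0 <= eps p.
Proof. by rewrite /eps mulr_ge0 ?invr_ge0// sumr_ge0// => m _; exact: sqr_ge0. Qed.

Lemma eps_le_sup (N : nat) (p : 'I_N -> R) (eta : R) : (0 < N)%N ->
  (forall m, `|eps_cell p m| <= eta) -> eta <= 1 -> eps p <= eta.
Proof.
move=> N0 pe eta1.
have eta0 : 0 <= eta by apply: le_trans (pe (Ordinal N0)).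
apply: (@le_trans _ _ (eta ^+ 2)); last by rewrite expr2 ler_piMl.
rewrite /eps mulrC ler_pdivrMr ?ltr0n//.
apply: (@le_trans _ _ (\sum_(m < N) eta ^+ 2)); last first.
  by rewrite sumr_const card_ord mulr_natr.
apply: ler_sum => m _; rewrite -real_normK ?num_real//.
by rewrite lerXn2r ?nnegrE//; exact: pe.
Qed.

(** With u = eps p / 2 * curv up to a factor close to 1, the exponent N * u ^
    2 / (2 * resid_var) is N * r ^ 2 * eps p ^ 2 times curv ^ 2 / (8 * r ^ 2 *
    resid_var), and by rho_sq the latter is rho ^ 2 / 4. *)
Lemma slope_ratio (d l0 l1 del : R) : -1 < d -> 0 < l0 -> l0 <= l1 -> 0 < del -> del <= 1 ->
  exists M : R, 1 <= M /\ forall (N n : nat) (p : 'I_N -> R) (eta : R),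
    (0 < N)%N -> (0 < n)%N -> l0 <= n%:R / N%:R <= l1 ->
    (forall m, 0 < p m) -> \sum_m p m = 1 -> (forall m, `|eps_cell p m| <= eta) ->
    eta * M <= 1 -> M <= N%:R * eps p ^+ 2 ->
    (forall u, 0 < u -> u <= M * eps p ->
       M * (N%:R * u ^+ 2 + ln N%:R) <= trunc_level d l0 N u) ->
    let r := n%:R / N%:R in let h := power_div d r in
    let P := multinomial_prob (@uniform_cells R N)
            [pred k : counts N n | N%:R * A1 n p h < sym_stat h k] in
    [/\ 0 < P, 0 < n%:R * r * eps p ^+ 2, 0 < 4^-1 * rho h r ^+ 2 &
    `| - ln P / (n%:R * r * eps p ^+ 2) / (4^-1 * rho h r ^+ 2) - 1| <= 7 * del].
Proof.
move=> d1 l00 l01 del0 del1.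
have l10 : 0 < l1 by exact: lt_le_trans l01.
have [D [c [s0 [[D1 c_0 s00] hD]]]] := power_div_uniform d1 l00 l01.
have [M [M1 hM]] := power_div_deviation d1 l00 l01 del0.
have [C [C0 hC]] := A1_expansion D (ltW l10).
pose A := 1 + 2 * C / (del * c) + 4 * C / c.
have dc : 0 < del * c by rewrite mulr_gt0.
have A1' : 1 <= A by rewrite /A -addrA lerDl addr_ge0// divr_ge0 ?mulr_ge0// ltW.
pose c' := 4 / c; have c'0 : 0 < c' by rewrite divr_gt0.
pose S := A + c' ^+ 2 + (D + C).
have c'2 : 0 <= c' ^+ 2 by exact: sqr_ge0.
have [S1 SA Sc SD] : [/\ 1 <= S, A <= S, c' ^+ 2 <= S & D + C <= S].
  by rewrite /S; clearbody A c'; split; lra.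
pose M' := M * S.
have M0 : 0 <= M by lra.
have SM : S <= M' by rewrite /M' ler_peMl//; clearbody S; lra.
have M'A : A <= M' /\ M <= M' /\ M * c' ^+ 2 <= M' /\ M * (D + C) <= M'.
  split; first exact: le_trans SM.
  split; first by rewrite /M' ler_peMr.
  by split; rewrite /M' ler_wpM2l.
have [MA [MM [Mc MDC]]] := M'A.
have MDC' := le_trans SD SM; clear M'A SM; clearbody M'.
exists M'; split; first by exact: le_trans M1 MM.
move=> N n p eta N0 n0 lr pp p1 pe etaM MN MK r h P.
have Nr : N%:R * r = n%:R by rewrite /r mulrC divfK// pnatr_eq0 -lt0n.
have rp : 0 < r by case/andP: lr => h1 _; apply: lt_le_trans h1.
have [th ck kD sh] := hD r lr; rewrite -/h in th ck kD sh.
have NR : 0 < N%:R :> R by rewrite ltr0n.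
have M'0 : 0 < M' by lra.
have e0 : 0 < eps p.
  have e0 := eps_ge0 p.
  rewrite lt_neqAle e0 andbT; apply/eqP => E; move: MN; rewrite -E expr0n mulr0; lra.
have eta0 : 0 <= eta.
  by apply: le_trans (pe (Ordinal N0)).
have eta1 : eta <= 1.
  by apply: le_trans etaM; rewrite ler_peMr//; lra.
have ee : eps p <= eta by exact: eps_le_sup.
pose u := A1 n p h - pmean r h.
have hu : `|u - eps p / 2 * curv r h| <= C * eta * eps p.
  by apply: hC => //; case/andP: lr.
have k0 : 0 < curv r h by lra.
have hr : (1 - del) * (eps p * curv r h) <= 2 * u <= (1 + del) * (eps p * curv r h).
  apply: (half_prod_ratio (c := c) e0) hu _ => //.
  have h1 : 2 * C / (del * c) <= M'.
    apply: le_trans MA; rewrite /A addrAC lerDr addr_ge0// divr_ge0//.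
      by rewrite mulr_ge0.
    exact: ltW.
  rewrite ler_pdivrMr// in h1.
  have h2 := ler_wpM2r eta0 h1; apply: (le_trans h2).
  by rewrite mulrAC ler_piMl ?(ltW dc)// mulrC.
have hu4 : c * eps p <= 4 * u.
  have h1 : eps p / 2 * curv r h - C * eta * eps p <= u.
    by move: hu; rewrite ler_norml => /andP[h1 _]; clear -h1; lra.
  have h2 : C * eta <= c / 4.
    have h2 : 4 * C / c <= M'.
      apply: le_trans MA; rewrite /A lerDr addr_ge0// divr_ge0//.
        by rewrite mulr_ge0.
      exact: ltW.
    rewrite ler_pdivrMr// in h2.
    have h3 := ler_wpM2r eta0 h2.
    have h4 : M' * c * eta <= c by rewrite mulrAC ler_piMl ?(ltW c_0)// mulrC.
    by clear -h3 h4; lra.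
  have h3 : C * eta * eps p <= c / 4 * eps p by rewrite ler_pM2r.
  have h4 : eps p * c <= eps p * curv r h by rewrite ler_pM2l.
  clear -h1 h3 h4; lra.
have u0 : 0 < u.
  have : 0 < c * eps p by rewrite mulr_gt0.
  clear -hu4; lra.
have uD : u <= (D + C) * eps p.
  have h1 : u <= eps p / 2 * curv r h + C * eta * eps p.
    by move: hu; rewrite ler_norml => /andP[_ h1]; clear -h1; lra.
  have h2 : eps p * curv r h <= eps p * D.
    by rewrite ler_pM2l// (le_trans (ler_norm _)).
  have h3 : C * eta * eps p <= C * eps p.
    by rewrite ler_pM2r// ler_piMr.
  have h4 : 0 <= eps p * D by rewrite mulr_ge0//; lra.
  clear -h1 h2 h3 h4; lra.
have [PL PU] : let P := urn_prob R n (fun x : 'I_N -> nat =>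
        N%:R * (pmean r h + u) < \sum_(m < N) h (x m)) in
    let p := N%:R * u ^+ 2 / (2 * resid_var r h) in
    expR (- ((1 + del) * p)) <= P /\ P <= expR (- ((1 - del) * p)).
  apply: hM => //.
  - apply: le_trans etaM; apply: (@le_trans _ _ ((D + C) * eps p * M)).
      by rewrite ler_wpM2r.
    have h1 : (D + C) * eps p * M = eps p * (M * (D + C)) by ring.
    rewrite h1; apply: ler_pM => //; first exact: ltW.
    by apply: mulr_ge0 => //; clear -D1 C0; lra.
  - have c2 : 0 < c' ^+ 2 by rewrite exprn_gt0.
    have uc : eps p <= u * c' by rewrite /c' mulrA ler_pdivlMr// mulrC (mulrC u).
    have uc0 : 0 <= u * c' by exact: le_trans (ltW e0) uc.
    have : M * c' ^+ 2 <= N%:R * u ^+ 2 * c' ^+ 2; last by rewrite ler_pM2r.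
    apply: (le_trans Mc); apply: (le_trans MN).
    rewrite -mulrA -exprMn ler_pM2l// lerXn2r ?nnegrE//.
    exact: ltW.
  - apply: le_trans (MK u u0 _); last first.
      by apply: (le_trans uD); rewrite ler_pM2r.
    rewrite ler_wpM2r// addr_ge0 ?mulr_ge0 ?exprn_ge0 ?(ltW u0)//.
    by rewrite ln_ge0// ler1n.
have PE : urn_prob R n (fun x : 'I_N -> nat => N%:R * (pmean r h + u) < \sum_(m < N) h (x m)) = P.
  by rewrite /u addrC subrK.
rewrite PE in PL PU; move: PL PU; set q := _ / (2 * _) => PL PU.
have P0 : 0 < P by apply: lt_le_trans PL; exact: expR_gt0.
have s_0 : 0 < resid_var r h by lra.
have den : 0 < n%:R * r * eps p ^+ 2.
  apply: mulr_gt0; last exact: exprn_gt0.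
  by apply: mulr_gt0 => //; rewrite ltr0n.
have rh := rho_sq rp th.
have rho0 : 0 < 4^-1 * rho h r ^+ 2.
  have r2 : 0 < r ^+ 2 by exact: exprn_gt0.
  have k2 : 0 < curv r h ^+ 2 by exact: exprn_gt0.
  by rewrite rh mulr_gt0 ?invr_gt0// divr_gt0// mulr_gt0// mulr_gt0.
split=> //.
have -> : - ln P / (n%:R * r * eps p ^+ 2) / (4^-1 * rho h r ^+ 2) =
   - ln P * (8 * resid_var r h) / (N%:R * (eps p * curv r h) ^+ 2).
  by rewrite rh -Nr; field; rewrite !gt_eqF.
apply: (ratio_close NR e0 k0 s_0 del0 del1 hr).
rewrite -/q; apply/andP; split.
  by rewrite lerNr -(expRK (- (_ * q))) ler_ln ?posrE ?expR_gt0.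
by rewrite lerNl -(expRK (- (_ * q))) ler_ln ?posrE ?expR_gt0.
Qed.

Lemma trunc_level_nonpos (N M e u : R) : 1 <= M -> 16 * M ^+ 2 <= N ->
  2 * M ^+ 3 * e ^+ 2 <= 1 -> 0 < u -> u <= M * e -> M * (N * u ^+ 2 + ln N) <= N.
Proof.
move=> M1 MN Me u0 ue.
have M2 : 0 < M ^+ 2 by rewrite exprn_gt0//; lra.
have N0 : 0 < N by lra.
have u2 : u ^+ 2 <= (M * e) ^+ 2 by rewrite lerXn2r ?nnegrE//; lra.
have h1 : M * (N * u ^+ 2) <= N / 2.
  apply: (@le_trans _ _ (M * (N * (M * e) ^+ 2))).
    by rewrite ler_pM2l ?ler_pM2l//; lra.
  have -> : M * (N * (M * e) ^+ 2) = N / 2 * (2 * M ^+ 3 * e ^+ 2) by field.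
  by rewrite ler_piMr//; lra.
(* ln N is twice the logarithm of sqrt N, hence at most 2 * sqrt N. *)
set s := Num.sqrt N; have s0 : 0 < s by rewrite sqrtr_gt0.
have sN : N = s * s by rewrite -expr2 sqr_sqrtr// ltW.
have s4 : 4 * M <= s.
  rewrite -(@ler_pXn2r _ 2) ?nnegrE ?(ltW s0)//; last lra.
  by rewrite /s sqr_sqrtr ?(ltW N0)//; lra.
have h2 : M * ln N <= N / 2.
  have l : ln N <= 2 * s.
    rewrite sN lnM ?posrE//; have := ln_sublinear s0; lra.
  have h3 : M * ln N <= M * (2 * s) by rewrite ler_pM2l//; lra.
  have h4 : 4 * M * s <= s * s by rewrite ler_pM2r.
  by clear -h3 h4 sN; lra.
by rewrite mulrDr; clear -h1 h2; lra.
Qed.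

(** Put x = n ^ (1 / (1 + 2 d)). If u is small against x ^ (- d), then N * u ^
    2 is small against x while the level u ^ (- 1 / d) is large against x: the
    exponent d / (1 + 2 d) is where the two orders meet. *)
Lemma cutoff_level_large (d l0 M : R) : 0 < d -> 0 < l0 -> 1 <= M ->
  exists2 del : R, 0 < del & forall (N n : nat) (u e : R), (0 < N)%N -> (0 < n)%N ->
    l0 <= n%:R / N%:R -> 0 < u -> u <= M * e -> e <= del * n%:R `^ (- (d / (1 + 2 * d))) ->
    M * (N%:R * u ^+ 2 + ln N%:R) <= cutoff_level d l0 u.
Proof.
move=> d0 l00 M1.
have c0 := pd_coef_gt0 d0; set c := pd_coef d in c0.
have M0 : 0 < M by lra.
have d12 : 0 < 1 + 2 * d by lra.
pose A := M * (M ^+ 2 / l0 + (1 + 2 * d) + `|ln l0|).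
have A0 : 0 < A.
  have h1 : 0 <= M ^+ 2 / l0 by rewrite divr_ge0 ?exprn_ge0 ?ltW.
  have h2 : 0 <= `|ln l0| by [].
  by rewrite mulr_gt0//; lra.
pose G := A / l0; have G0 : 0 < G by rewrite divr_gt0.
pose del := Num.min 1 ((c * M)^-1 * G `^ (- d)).
have cM : 0 < c * M by exact: mulr_gt0.
have del0 : 0 < del.
  rewrite lt_min ltr01/=; apply: mulr_gt0; first by rewrite invr_gt0.
  exact: powR_gt0.
have del1 : del <= 1 by rewrite ge_min lexx.
have delG : c * M * del <= G `^ (- d).
  by rewrite -ler_pdivlMl// ge_min lexx orbT.
exists del => // N n u e N0 n0 lnN u0 ue en.
have NR : 0 < N%:R :> R by rewrite ltr0n.
have nR : 0 < n%:R :> R by rewrite ltr0n.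
pose x := n%:R `^ (1 + 2 * d)^-1 : R; have x0 : 0 < x by exact: powR_gt0.
have x1 : 1 <= x.
  rewrite /x -[leLHS](powRr0 n%:R) ler_powR ?ler1n// invr_ge0; lra.
pose v := x `^ d; have v0 : 0 < v by exact: powR_gt0.
have nv : n%:R `^ (- (d / (1 + 2 * d))) = v^-1.
  by rewrite /v -powRN -powRrM mulrN mulrC.
have nx : n%:R = x * v ^+ 2.
  have -> : n%:R = x `^ (1 + 2 * d) by rewrite -powRrM mulVf ?gt_eqF// powRr1// ltW.
  rewrite powRD; last by rewrite (gt_eqF x0) implybT.
  by rewrite powRr1 ?(ltW x0)// (mulrC 2) powRrM -/v powR_mulrn// ltW.
have lnx : ln n%:R = (1 + 2 * d) * ln x.
  by rewrite /x ln_powR mulrA divff ?mul1r// gt_eqF.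
have Gv : (G * x) `^ d = G `^ d * v by rewrite powRM ?(ltW G0) ?(ltW x0).
clearbody v x.
have uv : u <= M * (del / v) by apply: (le_trans ue); rewrite ler_pM2l// -nv.
have Nn : N%:R <= n%:R / l0 by rewrite ler_pdivlMr// mulrC -ler_pdivlMr.
have h1 : N%:R * u ^+ 2 <= M ^+ 2 / l0 * x.
  apply: (@le_trans _ _ (n%:R / l0 * (M * (del / v)) ^+ 2)).
    rewrite ler_pM ?sqr_ge0// lerXn2r ?nnegrE ?(ltW u0)//.
    exact: le_trans (ltW u0) uv.
  have -> : n%:R / l0 * (M * (del / v)) ^+ 2 = M ^+ 2 / l0 * x * del ^+ 2.
    by rewrite nx; field; rewrite !gt_eqF.
  rewrite ler_piMr//; last by rewrite expr_le1// ltW.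
  by rewrite !mulr_ge0 ?exprn_ge0 ?invr_ge0 ?ltW.
have h2 : ln N%:R <= ((1 + 2 * d) + `|ln l0|) * x.
  apply: (@le_trans _ _ (ln (n%:R / l0))).
    by rewrite ler_ln ?posrE ?divr_gt0.
  rewrite ln_div ?posrE// lnx [leRHS]mulrDl lerD//.
    by rewrite ler_pM2l// ltW// ln_sublinear.
  apply: (@le_trans _ _ `|ln l0|); first by rewrite -normrN ler_norm.
  by rewrite ler_peMr.
have h3 : M * (N%:R * u ^+ 2 + ln N%:R) <= A * x.
  by rewrite /A -mulrA ler_pM2l// -addrA mulrDl lerD.
apply: (le_trans h3).
have -> : A * x = l0 * (G * x) by rewrite /G mulrA (mulrC l0) divfK// gt_eqF.
rewrite /cutoff_level ler_pM2l//.
have Gx0 : 0 <= G * x by apply: mulr_ge0; exact: ltW.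
have Gd : 0 < G `^ d by exact: powR_gt0.
have h4 : (G * x) `^ d <= (c * u)^-1.
  have h5 : c * u <= (G `^ d * v)^-1.
    apply: (@le_trans _ _ (c * M * del / v)).
      have -> : c * M * del / v = c * (M * (del / v)) by rewrite !mulrA.
      by have := ler_wpM2l (ltW c0) uv.
    rewrite invfM ler_pM2r ?invr_gt0//.
    by apply: (le_trans delG); rewrite powRN.
  have Gv0 : 0 < G `^ d * v by exact: mulr_gt0.
  have cu0 : 0 < c * u by exact: mulr_gt0.
  by rewrite Gv -[leLHS]invrK lef_pV2 ?posrE ?invr_gt0.
have -> : G * x = ((G * x) `^ d) `^ d^-1.
  by rewrite -powRrM divff ?gt_eqF// powRr1.
have cu1 : 0 <= (c * u)^-1 by rewrite invr_ge0 ltW//; exact: mulr_gt0.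
by rewrite ge0_ler_powR ?nnegrE ?powR_ge0// invr_ge0 ltW.
Qed.

Lemma trunc_level_large (N : nat -> nat) (p : forall n, 'I_(N n) -> R) (d l0 M : R) :
  0 < l0 -> 1 <= M -> (N n)%:R @[n --> \oo] --> (+oo : set_system R) ->
  (\forall n \near \oo, l0 <= lambda N n) ->
  (forall del : R, 0 < del -> \forall n \near \oo, eps (p n) <= del) ->
  (d <= 0 \/ 0 < d /\ forall del : R, 0 < del ->
     \forall n \near \oo, eps (p n) <= del * n%:R `^ (- (d / (1 + 2 * d)))) ->
  \forall n \near \oo, forall u, 0 < u -> u <= M * eps (p n) ->
    M * ((N n)%:R * u ^+ 2 + ln (N n)%:R) <= trunc_level d l0 (N n) u.
Proof.
move=> l00 M1 /cvgryPge hN hlam he hd.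
have M0 : 0 < M by lra.
case: hd => [dle|[dgt hd]].
  have k0 : 0 < (2 * M ^+ 3)^-1 :> R by rewrite invr_gt0 mulr_gt0// exprn_gt0.
  near=> n => u u0 ue; rewrite /trunc_level dle.
  have e1 : eps (p n) <= 1 by near: n; exact: he.
  have e2 : eps (p n) <= (2 * M ^+ 3)^-1 by near: n; exact: he.
  apply: (trunc_level_nonpos M1 _ _ u0 ue).
    by near: n; exact: hN.
  rewrite mulrC -ler_pdivlMr ?mul1r//; last by rewrite -invr_gt0.
  by apply: le_trans e2; rewrite expr2 ler_piMl// eps_ge0.
have [del del0 hdel] := cutoff_level_large dgt l00 M1.
near=> n => u u0 ue; rewrite /trunc_level (lt_geF dgt).
apply: (hdel _ n _ (eps (p n))) => //.
- by rewrite -(ltr0n R); apply: (@lt_le_trans _ _ 1) => //; near: n; exact: hN.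
- by near: n; exact: nbhs_infty_gt.
- by near: n; exact: hlam.
- by near: n; exact: hd.
Unshelve. all: by end_near. Qed.

End Assembly.

(** * Asymptotics along intermediate alternatives *)

Section Final.
Context {R : realType}.

(** For noninteger d: x / (1 + 2 x) increases with x, so the rate at max 1 d
    is below the one at d. *)
Lemma rate_domination (e : nat -> R) (d : R) :
  [\/ d <= 0,
      [/\ 1 <= d, d \is a Num.int &
          (e : nat -> R) =o_\oo (fun n : nat => n%:R `^ (- (d / (1 + 2 * d))) : R)] |
      [/\ 0 < d, d \isn't a Num.int &
          (e : nat -> R) =o_\oo
            (fun n : nat =>
               let dstar := Num.max 1 d in
               Num.min (n%:R `^ (- (3 / 8)))
                       (n%:R `^ (- (dstar / (1 + 2 * dstar)))) : R)]] ->
  d <= 0 \/ 0 < d /\ forall del : R, 0 < del ->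
     \forall n \near \oo, e n <= del * n%:R `^ (- (d / (1 + 2 * d))).
Proof.
have close g : (forall n, (0 < n)%N -> 0 <= g n <= n%:R `^ (- (d / (1 + 2 * d)))) ->
    e =o_\oo (g : nat -> R) -> forall del : R, 0 < del ->
    \forall n \near \oo, e n <= del * n%:R `^ (- (d / (1 + 2 * d))).
  move=> hg /eqoP he del del0; near=> n.
  have n0 : (0 < n)%N by near: n; exact: nbhs_infty_gt.
  have /andP[g0 gn] := hg n n0.
  apply: le_trans (ler_norm _) _; apply: (@le_trans _ _ (del * `|g n|)).
    by near: n; exact: he.
  by rewrite ger0_norm// ler_pM2l.
case=> [dle|[d1 _ he]|[d0 _ he]]; first by left.
  right; split; first by lra.
  by apply: close he => n _; rewrite powR_ge0/=.
right; split=> //; apply: close he => n n0 /=.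
rewrite le_min !powR_ge0/= ge_min; apply/orP; right.
rewrite ler_powR ?ler1n// lerN2.
set s := Num.max 1 d; have ds : d <= s by rewrite le_max lexx orbT.
have s1 : 1 <= s by rewrite le_max lexx.
clearbody s; have d2 : 0 < 1 + 2 * d by lra.
have s2 : 0 < 1 + 2 * s by lra.
by rewrite ler_pdivrMr// mulrAC ler_pdivlMr//; lra.
Unshelve. all: by end_near. Qed.

End Final.

Theorem theorem3p1 (R : realType) (N : nat -> nat)
    (p : forall n : nat, 'I_(N n) -> R) (lam d : R)
    (hN : (N n)%:R @[n --> \oo] --> (+oo : set_system R))
    (hnlam : (n%:R * lambda N n : R) @[n --> \oo] --> +oo)
    (hlam0 : 0 < lam)
    (hlam : lambda N n @[n --> \oo] --> lam)
    (hd : -1 < d)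
    (halt : intermediate_alternatives p)
    (hcase :
      [\/ d <= 0,
          [/\ 1 <= d, d \is a Num.int &
              (fun n : nat => eps (p n) : R) =o_\oo
                (fun n : nat => n%:R `^ (- (d / (1 + 2 * d))) : R)] |
          [/\ 0 < d, d \isn't a Num.int &
              (fun n : nat => eps (p n) : R) =o_\oo
                (fun n : nat =>
                   let dstar := Num.max 1 d in
                   Num.min (n%:R `^ (- (3 / 8)))
                           (n%:R `^ (- (dstar / (1 + 2 * dstar)))) : R)]]) :
  exists r : nat -> R,
    r n @[n --> \oo] --> (0 : R) /\
    \forall n \near \oo,
      (alpha_slope n (p n) (power_div d (lambda N n))
         * (n%:R * lambda N n * eps (p n) ^+ 2)^-1%:E)%E =
      (4^-1 * rho (power_div d (lambda N n)) (lambda N n) ^+ 2 * (1 + r n))%:E.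
Proof.
  Proof.
have [[pp p1 _ heta] hgrow _] := halt.
have l00 : 0 < lam / 2 by rewrite divr_gt0.
have l01 : lam / 2 <= 2 * lam by lra.
have hl : \forall n \near \oo, lam / 2 <= lambda N n <= 2 * lam.
  move/cvgrPdist_le : hlam => /(_ _ l00); apply: filterS => n.
  by rewrite ler_norml => /andP[h1 h2]; apply/andP; split; lra.
have heta' (M : R) : 0 < M -> \forall n \near \oo, \big[Num.max/0]_(m < N n) `|eps_cell (p n) m| <= M.
  move=> M0; move/cvgrPdist_le : heta => /(_ _ M0); apply: filterS => n.
  by rewrite sub0r normrN => h; apply: le_trans (ler_norm _) h.
have cell n m : `|eps_cell (p n) m| <= \big[Num.max/0]_(m < N n) `|eps_cell (p n) m|.
  exact: le_bigmax.
have hN1 : \forall n \near \oo, (0 < N n)%N.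
  move/cvgryPge : hN => /(_ 1); apply: filterS => n.
  by rewrite ler1n.
have heps (M : R) : 0 < M -> \forall n \near \oo, eps (p n) <= M.
  move=> M0; near=> n.
  have h1 : \big[Num.max/0]_(m < N n) `|eps_cell (p n) m| <= 1 by near: n; exact: heta'.
  have h2 : \big[Num.max/0]_(m < N n) `|eps_cell (p n) m| <= M by near: n; exact: heta'.
  by apply: le_trans h2; apply: eps_le_sup => //; near: n.
have hNe (M : R) : 1 <= M -> \forall n \near \oo, M <= (N n)%:R * eps (p n) ^+ 2.
  move=> M1; near=> n.
  have N0 : (0 < N n)%N by near: n.
  have NR : 0 < (N n)%:R :> R by rewrite ltr0n.
  have h : 2 * lam * M <= Num.sqrt (n%:R * lambda N n) * eps (p n).
    by near: n; move/cvgryPge : hgrow; apply.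
  have /andP[lo hi] : lam / 2 <= lambda N n <= 2 * lam by near: n.
  have l0 : (0 : R) <= lambda N n by apply: le_trans lo; exact: ltW.
  have nE : n%:R = (N n)%:R * lambda N n :> R by rewrite /lambda mulrC divfK// gt_eqF.
  have h2 : (2 * lam * M) ^+ 2 <= (2 * lam) ^+ 2 * ((N n)%:R * eps (p n) ^+ 2).
    apply: (@le_trans _ _ ((Num.sqrt (n%:R * lambda N n) * eps (p n)) ^+ 2)).
      have a0 : 0 <= 2 * lam * M by apply: mulr_ge0; lra.
      by rewrite lerXn2r ?nnegrE//; exact: le_trans a0 h.
    rewrite exprMn sqr_sqrtr ?mulr_ge0// nE.
    have -> : (N n)%:R * lambda N n * lambda N n * eps (p n) ^+ 2 =
       lambda N n ^+ 2 * ((N n)%:R * eps (p n) ^+ 2) by ring.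
    apply: ler_wpM2r; first by apply: mulr_ge0 => //; exact: sqr_ge0.
    by rewrite lerXn2r ?nnegrE//; lra.
  rewrite exprMn ler_pM2l ?exprn_gt0// in h2; last by rewrite mulr_gt0.
  apply: le_trans h2; rewrite expr2 ler_peMl//; lra.
have hlev := trunc_level_large l00 _ hN _ heps (rate_domination hcase).
pose P n := multinomial_prob (@uniform_cells R (N n)) [pred k : counts (N n) n |
  (N n)%:R * A1 n (p n) (power_div d (lambda N n)) < sym_stat (power_div d (lambda N n)) k].
pose rhon n := 4^-1 * rho (power_div d (lambda N n)) (lambda N n) ^+ 2.
pose den n := n%:R * lambda N n * eps (p n) ^+ 2.
have key (E : R) : 0 < E -> \forall n \near \oo,
    [/\ 0 < P n, 0 < den n, 0 < rhon n & `|- ln (P n) / den n / rhon n - 1| <= E].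
  move=> E0; pose del := Num.min 1 (E / 7).
  have del0 : 0 < del by rewrite lt_min ltr01 divr_gt0.
  have del1 : del <= 1 by rewrite ge_min lexx.
  have delE : 7 * del <= E by rewrite mulrC -ler_pdivlMr// ge_min lexx orbT.
  have [M [M1 hM]] := slope_ratio hd l00 l01 del0 del1.
  have M0 : 0 < M by exact: lt_le_trans M1.
  have Mi : 0 < M^-1 by rewrite invr_gt0.
  near=> n.
  have n0 : (0 < n)%N by near: n; exact: nbhs_infty_gt.
  have [] := hM (N n) n (p n) (\big[Num.max/0]_(m < N n) `|eps_cell (p n) m|).
  - by near: n.
  - exact: n0.
  - by near: n.
  - by move=> m; exact: pp.
  - exact: p1.
  - exact: cell.
  - rewrite -(ler_pdivlMr _ _ M0) mul1r; near: n; exact: heta'.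
  - by near: n; exact: hNe.
  - near: n; apply: hlev => //.
    by apply: filterS hl => n /andP[].
  by rewrite -/(lambda N n) => h1 h2 h3 h4; split => //; exact: le_trans delE.
exists (fun n => - ln (P n) / den n / rhon n - 1); split.
  apply/cvgrPdist_le => E E0; apply: filterS (key E E0) => n [_ _ _ h].
  by rewrite sub0r normrN.
apply: filterS (key 1 ltr01) => n [P0 d0 r0 _].
rewrite /alpha_slope -/(P n) lne_EFin// -/(den n) -/(rhon n) -EFinN -EFinM.
congr EFin; rewrite addrCA subrr addr0. by rewrite mulrCA divff ?mulr1// gt_eqF.
Unshelve. all: by end_near. Qed.
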